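(* Let $\varrho\in(0,1]$, $r\ge2$, $L\ge0$, $T>0$, and let $$\mathcal{A}^{RM}_n(\tilde X,\tilde W)=\sum_{i=0}^{n-1}\tilde X(t_i)\,(\tilde W(t_{i+1})-\tilde W(t_i))$$ be the Riemann-Maruyama quadrature based on the equidistant mesh $t_i=iT/n$, $i=0,1,\dots,n$. (i) Let $s\ge0$ and $q\in(r,+\infty)$. Then $$e^{(r)}(\mathcal{A}^{RM}_n,F^{\varrho,r,q}_L,\mathcal{W}_s,\delta_1,\delta_2)=\mathcal{O}(n^{-\varrho}+\delta_1+\delta_2),$$ as $n\to+\infty$ and $\max\{\delta_1,\delta_2\}\to0+$. (ii) Let $s\ge0$ and $q\in(r,+\infty)$. Then $$e^{(r)}(\mathcal{A}^{RM}_n,F^{\varrho,r,q}_L,\mathcal{\bar W}_s,\delta_1,\delta_2)=\mathcal{O}\bigl(n^{-\varrho}+\delta_1+\delta_2(1+n^{1/2})\bigr),$$ as $n\to+\infty$ and $\max\{\delta_1,\delta_2\}\to0+$. (iii) Let $\alpha,\beta\in(0,1]$ and $q\in[r,+\infty)$. Then $$e^{(r)}(\mathcal{A}^{RM}_n,F^{\varrho,r,q}_L,\mathcal{W}_{\alpha,\beta},\delta_1,\delta_2)=\mathcal{O}\bigl(n^{-\varrho}+\delta_1+\delta_2\,n^{1-\min\{\alpha,\beta/2\}}\bigr),$$ as $n\to+\infty$ and $\max\{\delta_1,\delta_2\}\to0+$.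
   Context: $W=\{W(t)\}_{t\ge0}$ is a standard one-dimensional Wiener process on a complete probability space $(\Omega,\Sigma,\mathbb{P})$ with respect to a filtration $\{\Sigma_t\}_{t\ge0}$ satisfying the usual conditions. For a real random variable $Y$, $\|Y\|_q=(\mathbb{E}|Y|^q)^{1/q}$. $\mathcal{I}(X,W)=\int_0^T X(t)\,dW(t)$ is the It\^o integral. Integrands: for $r,q\in[2,+\infty)$, $q\ge r$, $L\ge0$, $\varrho\in(0,1]$, $F^{\varrho,r,q}_L$ is the class of all $\{\Sigma_t\}$-progressively measurable processes $X:[0,T]\times\Omega\to\mathbb{R}$ such that $\bigl\|\sup_{t\in[0,T]}|X(t)|\bigr\|_q\le L$ and $\|X(t)-X(z)\|_r\le L|t-z|^{\varrho}$ for all $t,z\in[0,T]$. Disturbing functions $p:[0,T]\times\mathbb{R}\to\mathbb{R}$ (with the convention $|y|^s:=0$ for all $y$ if $s=0$): - $\mathcal{K}^1$: $p$ Borel measurable with $|p(t,y)|\le 1+|y|$ for all $t,y$. - $\mathcal{K}^2_s$, $s\ge0$: $p\in C^{1,2}([0,T]\times\mathbb{R})$ with $\max\{|\partial_t p(t,y)|,|\partial_y p(t,y)|,|\partial_y^2 p(t,y)|\}\le 1+|y|^s$ for all $t,y$. - $\mathcal{\bar K}^2_s$, $s\ge0$: $p\in C^{1,1}([0,T]\times\mathbb{R})$ (continuously differentiable once in each variable) with $\max\{|\partial_t p(t,y)|,|\partial_y p(t,y)|\}\le 1+|y|^s$ for all $t,y$. - $\mathcal{K}^3_{\alpha,\beta}$,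 $\alpha,\beta\in(0,1]$: $|p(t,x)-p(z,y)|\le|t-z|^{\alpha}+|x-y|^{\beta}$ for all $t,z\in[0,T]$, $x,y\in\mathbb{R}$. Noisy versions, for $\delta_1,\delta_2\ge0$: $V_X(\delta_1)$ is the set of processes $\tilde X$ of the form $\tilde X(t,\omega)=X(t,\omega)+\delta_1 p_X(t,X(t,\omega))$ for all $(t,\omega)\in[0,T]\times\Omega$, with some $p_X\in\mathcal{K}^1$. The sets $\mathcal{W}_s(\delta_2)$, $\mathcal{\bar W}_s(\delta_2)$, $\mathcal{W}_{\alpha,\beta}(\delta_2)$ consist of the processes $\tilde W$ of the form $\tilde W(t,\omega)=W(t,\omega)+\delta_2 p_W(t,W(t,\omega))$ for all $(t,\omega)\in[0,T]\times\Omega$, with some $p_W\in\mathcal{K}^2_s$, $p_W\in\mathcal{\bar K}^2_s$, $p_W\in\mathcal{K}^3_{\alpha,\beta}$, respectively. Worst-case error of an algorithm $\mathcal{A}$ in a class $\mathcal{G}\subset F^{\varrho,r,q}_L$, for $\mathcal{W}\in\{\mathcal{W}_s,\mathcal{\bar W}_s,\mathcal{W}_{\alpha,\beta}\}$: $$e^{(r)}(\mathcal{A},\mathcal{G},\mathcal{W},\delta_1,\delta_2)=\sup_{X\in\mathcal{G}}\ \sup_{(\tilde X,\tilde W)\in V_X(\delta_1)\times\mathcal{W}(\delta_2)}\|\mathcal{I}(X,W)-\mathcal{A}(\tilde X,\tilde W)\|_r .$$ Asymptotic notation: $\mathcal{O}$ ''as $n\to+\infty$ and $\max\{\delta_1,\delta_2\}\to0+$''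 means that there are constants $C,n_0,\delta_0>0$ such that the bound with constant $C$ holds for all $n\ge n_0$ and all $\delta_1,\delta_2\in[0,\delta_0]$; the constants depend only on the parameters of the respective classes ($r,q,L,\varrho,T$ and $s$, or $\alpha,\beta$). *)

(* Defs.v *)
From HB Require Import structures.
From mathcomp Require Import all_boot all_order all_algebra.
From mathcomp Require Import all_classical all_reals all_analysis.

Set Implicit Arguments.
Unset Strict Implicit.
Unset Printing Implicit Defensive.
Import Order.TTheory GRing.Theory Num.Theory.
Import numFieldNormedType.Exports.

Local Open Scope classical_set_scope.
Local Open Scope ring_scope.

(* Processes and filtrations are indexed by all of R, but only their values at
   nonnegative times (for integrands and noisy data: at times in [0, T]) are
   ever constrained or used. *)

Section StochasticBasis.
Context (R : realType) (d : measure_display) (Omega : measurableType d).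
Variables (P : probability Omega R) (F : R -> set (set Omega)).

Definition adapted_at (t : R) (Y : Omega -> R) : Prop :=
  @measurable_fun _ _ (g_sigma_algebraType (F t)) R setT Y.

Definition filtration : Prop :=
  [/\ forall t : R, 0 <= t -> sigma_algebra setT (F t),
      forall t : R, 0 <= t -> F t `<=` measurable &
      forall s t : R, 0 <= s -> s <= t -> F s `<=` F t].

Definition usual_conditions : Prop :=
  [/\ measure_is_complete P,
      filtration,
      P.-negligible `<=` F 0 &
      forall t : R, 0 <= t -> F t = \bigcap_(u in [set u | t < u]) F u].

Definition wiener (W : R -> Omega -> R) : Prop :=
  [/\ {ae P, forall w, W 0 w = 0},
      {ae P, forall w, {within `[0, +oo[, continuous (fun t => W t w)}},
      forall t : R, 0 <= t -> adapted_at t (W t),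
      forall (s t : R) (A : set Omega) (B : set R),
        0 <= s -> s < t -> F s A -> measurable B ->
        P (A `&` (W t \- W s) @^-1` B) =
          (P A * P ((W t \- W s)%R @^-1` B))%E &
      forall (s t : R) (B : set R), 0 <= s -> s < t -> measurable B ->
        P ((W t \- W s) @^-1` B) = normal_prob 0 (Num.sqrt (t - s)) B].

Definition progressive (T : R) (X : R -> Omega -> R) : Prop :=
  forall t : R, 0 <= t <= T ->
    measurable_fun (`[0, t] `*` setT)
      (fun z : R * g_sigma_algebraType (F t) => X z.1 z.2).

End StochasticBasis.

Section ItoIntegral.
Context (R : realType) (d : measure_display) (Omega : measurableType d).
Variables (P : probability Omega R) (F : R -> set (set Omega)).
Variables (W : R -> Omega -> R) (T : R).

(* \sum_(i < sp_size) sp_coef i * 1_] sp_knot i, sp_knot i.+1 ] *)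
Record simple_process := SimpleProcess {
  sp_size : nat ;
  sp_knot : nat -> R ;
  sp_coef : nat -> Omega -> R }.

Definition sp_admissible (H : simple_process) : Prop :=
  [/\ 0 <= sp_knot H 0%N,
      forall i, (i < sp_size H)%N -> sp_knot H i <= sp_knot H i.+1,
      sp_knot H (sp_size H) <= T,
      forall i, (i < sp_size H)%N ->
        adapted_at F (sp_knot H i) (sp_coef H i) &
      forall i, (i < sp_size H)%N ->
        ('N[P]_(2%:E)[EFin \o sp_coef H i] < +oo)%E].

Definition sp_val (H : simple_process) (t : R) (w : Omega) : R :=
  \sum_(i < sp_size H)
    sp_coef H i w * \1_(`]sp_knot H i, sp_knot H i.+1]) t.

Definition sp_integral (H : simple_process) (w : Omega) : R :=
  \sum_(i < sp_size H)
    sp_coef H i w * (W (sp_knot H i.+1) w - W (sp_knot H i) w).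

Definition is_ito_integral (X : R -> Omega -> R) (I : Omega -> R) : Prop :=
  measurable_fun setT I /\
  exists H : nat -> simple_process,
    [/\ forall k, sp_admissible (H k),
        (\int[P]_w \int[lebesgue_measure]_(t in `[0%R, T])
           ((X t w - sp_val (H k) t w) ^+ 2)%:E)%E @[k --> \oo] --> 0%E &
        (\int[P]_w ((I w - sp_integral (H k) w) ^+ 2)%:E)%E
           @[k --> \oo] --> 0%E].

(* is_ito_integral determines I up to almost sure equality, and it is satisfiable
   for every progressive X with E \int_0^T X^2 dt < +oo; ito_integral picks one
   representative (and is 0 for an X that is not Ito integrable). *)
Definition ito_integral (X : R -> Omega -> R) : Omega -> R :=
  xget (cst 0) [set I | is_ito_integral X I].

End ItoIntegral.

Section Classes.
Context (R : realType).
Variable T : R.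

(* For X progressive on a complete space this is measurable, so the (lower)
   integral in 'N[P]_q of it is the usual one. *)
Definition sup_abs (Omega : Type) (X : R -> Omega -> R) (w : Omega) : \bar R :=
  ereal_sup [set (`|X t w|)%:E | t in `[0, T]].

Definition integrand_class (d : measure_display) (Omega : measurableType d)
    (P : probability Omega R) (F : R -> set (set Omega))
    (rho r q L : R) : set (R -> Omega -> R) :=
  [set X | [/\ progressive F T X,
    ('N[P]_(q%:E)[sup_abs X] <= L%:E)%E &
    forall t z : R, 0 <= t <= T -> 0 <= z <= T ->
      ('N[P]_(r%:E)[EFin \o (X t \- X z)%R] <= (L * `|t - z| `^ rho)%:E)%E]].

(* |y|^s, with the convention that it vanishes identically for s = 0 *)
Definition abspow0 (s y : R) : R := if s == 0 then 0 else `|y| `^ s.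

Definition strip : set (R * R) := `[0, T] `*` setT.

Definition cont_strip (f : R -> R -> R) : Prop :=
  {within strip, continuous (fun z : R * R => f z.1 z.2)}.

(* one-sided at t = 0 and t = T *)
Definition is_partial_t (p dtp : R -> R -> R) : Prop :=
  forall t y : R, 0 <= t <= T ->
    (fun u => (p u y - p t y) / (u - t)) @ within `[0, T] t^' --> dtp t y.

Definition is_partial_y (p dyp : R -> R -> R) : Prop :=
  forall t y : R, 0 <= t <= T -> is_derive y 1 (p t) (dyp t y).

Definition K1 : set (R -> R -> R) :=
  [set p : R -> R -> R | measurable_fun strip (fun z : R * R => p z.1 z.2) /\
    forall t y : R, 0 <= t <= T -> `|p t y| <= 1 + `|y|].

Definition K2 (s : R) : set (R -> R -> R) :=
  [set p : R -> R -> R | exists dtp dyp dyyp : R -> R -> R,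
    [/\ is_partial_t p dtp, is_partial_y p dyp & is_partial_y dyp dyyp] /\
    [/\ cont_strip p, cont_strip dtp, cont_strip dyp & cont_strip dyyp] /\
    forall t y : R, 0 <= t <= T ->
      [/\ `|dtp t y| <= 1 + abspow0 s y, `|dyp t y| <= 1 + abspow0 s y &
          `|dyyp t y| <= 1 + abspow0 s y]].

Definition K2bar (s : R) : set (R -> R -> R) :=
  [set p : R -> R -> R | exists dtp dyp : R -> R -> R,
    [/\ is_partial_t p dtp & is_partial_y p dyp] /\
    [/\ cont_strip p, cont_strip dtp & cont_strip dyp] /\
    forall t y : R, 0 <= t <= T ->
      `|dtp t y| <= 1 + abspow0 s y /\ `|dyp t y| <= 1 + abspow0 s y].

Definition K3 (alpha beta : R) : set (R -> R -> R) :=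
  [set p : R -> R -> R | forall t z x y : R, 0 <= t <= T -> 0 <= z <= T ->
    `|p t x - p z y| <= `|t - z| `^ alpha + `|x - y| `^ beta].

(* V_X(delta) is noisy (K1 T) delta X; the sets of noisy Wiener processes are
   noisy K delta W with K one of K2 T s, K2bar T s, K3 T alpha beta. *)
Definition noisy (K : set (R -> R -> R)) (delta : R) (Omega : Type)
    (Y : R -> Omega -> R) : set (R -> Omega -> R) :=
  [set Z | exists2 p, K p &
    forall (t : R) (w : Omega), 0 <= t <= T -> Z t w = Y t w + delta * p t (Y t w)].

Definition worst_case_error (d : measure_display) (Omega : measurableType d)
    (P : probability Omega R) (F : R -> set (set Omega)) (W : R -> Omega -> R)
    (r : R) (A : (R -> Omega -> R) -> (R -> Omega -> R) -> Omega -> R)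
    (G : set (R -> Omega -> R)) (KW : set (R -> R -> R))
    (delta1 delta2 : R) : \bar R :=
  ereal_sup [set
    ereal_sup [set
      'N[P]_(r%:E)[EFin \o (ito_integral P F W T X \- A Z.1 Z.2)%R]%E
      | Z in noisy K1 delta1 X `*` noisy KW delta2 W]
    | X in G].

Definition riemann_maruyama (n : nat) (Omega : Type)
    (X W : R -> Omega -> R) (w : Omega) : R :=
  let t (i : nat) : R := i%:R * T / n%:R in
  \sum_(i < n) X (t i) w * (W (t i.+1) w - W (t i) w).

Definition RM_error (rho r q L : R) (KW : set (R -> R -> R))
    (d : measure_display) (Omega : measurableType d)
    (P : probability Omega R) (F : R -> set (set Omega)) (W : R -> Omega -> R)
    (n : nat) (delta1 delta2 : R) : \bar R :=
  worst_case_error P F W r (@riemann_maruyama n Omega)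
    (integrand_class P F rho r q L) KW delta1 delta2.

End Classes.

(* e = O(g) as n --> +oo and max(delta1, delta2) --> 0+, with constants that do
   not depend on the probability space, the filtration or the Wiener process. *)
Definition uniform_bigO (R : realType)
    (e : forall (d : measure_display) (Omega : measurableType d)
           (P : probability Omega R) (F : R -> set (set Omega))
           (W : R -> Omega -> R), nat -> R -> R -> \bar R)
    (g : nat -> R -> R -> R) : Prop :=
  exists (C : R) (n0 : nat) (delta0 : R),
    [/\ 0 < C, (0 < n0)%N & 0 < delta0] /\
    forall (d : measure_display) (Omega : measurableType d)
      (P : probability Omega R) (F : R -> set (set Omega))
      (W : R -> Omega -> R),
      usual_conditions P F -> wiener P F W ->
      forall (n : nat) (delta1 delta2 : R), (n0 <= n)%N ->
        0 <= delta1 <= delta0 -> 0 <= delta2 <= delta0 ->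
        (e d Omega P F W n delta1 delta2 <= (C * g n delta1 delta2)%:E)%E.

(* Main.v *)
(** Everything reduces to a moment bound for discrete martingale transforms,
    [E |\sum_i h_i (W(t_{i+1}) - W(t_i))|^r <= K max_i E |h_i|^r] on a uniform mesh
    of [[0, T]], obtained for [r >= 2] by induction on the number of terms from the
    expansion of [|x + y|^r] to second order and from the independence of [W(t_{i+1}) - W(t_i)]
    and the past.  Applied to the difference of two Riemann sums on nested
    meshes, it shows that the sums on dyadic meshes converge almost surely and in
    [L^r]; by the Ito isometry the limit is the Ito integral of [X], and the
    error of the [n]-th sum is [O(n^-rho)].

    The noise contributes [delta1 \sum_i p_X(t_i, X_i) dW_i], again a martingale
    transform, and [delta2 \sum_i Y_i dp_i] where [dp_i] is the increment of
    [t |-> p_W(t, W(t))] and [Y_i] the noisy integrand.  Minkowski's inequality bounds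
    the latter by [n] times the size of [Y_i dp_i], which is of order
    [n^-min(alpha, beta/2)] for Hoelder [p_W] and of order [n^(-1/2)] for [p_W] of
    class [C^1].  For [p_W] of class [C^2] the first-order term
    [Y_i (d/dy)p_W(t_i, W_i) dW_i] is split off as one more martingale transform and
    the remainder is of order [1/n]. *)

Require Import Defs.
From HB Require Import structures.
From mathcomp Require Import all_boot all_order all_algebra.
From mathcomp Require Import all_classical all_reals all_analysis.
From mathcomp Require Import measurable_realfun ring lra.

Set Implicit Arguments.
Unset Strict Implicit.
Unset Printing Implicit Defensive.
Import Order.TTheory GRing.Theory Num.Theory.
Import numFieldNormedType.Exports.

Local Open Scope classical_set_scope.
Local Open Scope ring_scope.

(** * Inequalities for real powers *)

(** The Ito integral is only given through [xget], so the estimate needs both that some [I]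
    satisfies [is_ito_integral] and that all such [I] agree almost surely; the second is where an
    isometry for simple processes with unrelated knots enters. Conditional expectations never occur:
    adaptedness and independence act through [E[Y k(dW)] = E Y * E k(dW)] for [Y] in the past. For
    smooth disturbances the growth [1 + |y|^s] multiplies the noisy integrand by a power of
    [1 + |W(t_i)|], which is not independent of it; Young's inequality separates the two at the cost
    of a moment of order above [r], whence [q > r] in the first two parts. A Hoelder disturbance
    only produces factors independent of the past, and [q = r] is enough. Constants must be fixed
    before the probability space, so the moment lemmas first produce their constant and only then
    quantify over spaces, filtrations and Wiener processes. The noise is dominated pointwise by a
    measurable variable, and errors are compared by monotonicity of the integral. *)

Section PowerInequalities.
Context {R : realType}.
Implicit Types a b c e p r u x y : R.

Lemma ler_powR2 a b p : 0 <= p -> 0 <= a -> a <= b -> a `^ p <= b `^ p.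
Proof.
move=> p0 a0 ab; apply: ge0_ler_powR => //; rewrite nnegrE//.
exact: le_trans ab.
Qed.

Lemma powR_split a r : 0 <= a -> 2 <= r -> a `^ r = a `^ (r - 2) * a ^+ 2.
Proof.
move=> a0 r2; rewrite -(@powR_mulrn _ a 2)// -powRD ?subrK//.
by apply/implyP => /eqP; lra.
Qed.

(** For [u >= 0] the bound [e^v <= 1 + v e^v] is used twice; for [u < 0], [e^u <= 1 / (1 - u)] and
    [(1 + u + u^2)(1 - u) = 1 - u^3 >= 1]. *)
Lemma expR_le_taylor u : expR u <= 1 + u + u ^+ 2 * expR `|u|.
Proof.
have [u0|u0] := leP 0 u.
  rewrite ger0_norm//.
  have h (v : R) : expR v <= 1 + v * expR v.
    have := expR_ge1Dx (- v); rewrite -(ler_pM2r (expR_gt0 v)) -expRD addNr expR0.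
    lra.
  have := ler_wpM2l u0 (h u); have := h u; rewrite expr2 -mulrA; lra.
have h : expR u * (1 - u) <= 1.
  have := expR_ge1Dx (- u); rewrite -(ler_pM2r (expR_gt0 u)) -expRD addNr expR0.
  lra.
have h1 : expR u <= 1 + u + u ^+ 2.
  have u1 : 0 < 1 - u by lra.
  rewrite -(ler_pM2r u1) (le_trans h)//.
  have : 0 <= (- u) ^+ 3 by rewrite exprn_ge0; lra.
  by move=> h3; rewrite (_ : _ * _ = 1 + (-u) ^+ 3); [lra|ring].
rewrite (le_trans h1)// lerD2l ler_peMr ?sqr_ge0//.
by rewrite -expR0 ler_expR.
Qed.

(** The first two summands pay for [|x + y|^r] and for the linear term when [|x| <= 2|y|], the third
    for the Taylor remainder otherwise. *)
Definition powR_add_cst r : R := 3 `^ r + r * 2 `^ (r - 2) * 2 + r ^+ 2 * expR r.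

Lemma powR_add_cst_ge0 r : 2 <= r -> 0 <= powR_add_cst r.
Proof.
by move=> r2; rewrite /powR_add_cst !addr_ge0 ?mulr_ge0 ?powR_ge0 ?expR_ge0//; lra.
Qed.

(** If [|x| <= 2|y|], every term is at most a multiple of [|y|^r]. Otherwise [z = y / x] satisfies
    [|z| < 1/2], and [(1 + z)^r <= e^(rz)] is expanded to second order. The linear term is kept
    exactly because it has mean zero when [y] is a later increment times a past factor. *)
Lemma powR_norm_add_le r x y : 2 <= r ->
  `|x + y| `^ r <= `|x| `^ r + (r * `|x| `^ (r - 2) * x) * y
                   + powR_add_cst r * (`|x| `^ (r - 2) * y ^+ 2 + `|y| `^ r).
Proof.
move=> r2; have r0 : 0 <= r by lra.
have xr0 := powR_ge0 `|x| (r - 2); have yr0 := powR_ge0 `|y| r.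
have xxr0 := powR_ge0 `|x| r.
have xy0 : 0 <= `|x| `^ (r - 2) * y ^+ 2 by rewrite mulr_ge0 ?sqr_ge0.
have [xy|xy] := leP `|x| (2 * `|y|).
  have h1 : `|x + y| `^ r <= 3 `^ r * `|y| `^ r.
    rewrite -powRM// ler_powR2//; have := ler_normD x y; lra.
  have h2 : - (r * `|x| `^ (r - 2) * x * y) <= r * 2 `^ (r - 2) * 2 * `|y| `^ r.
    apply: (le_trans (ler_norm _)); rewrite normrN !normrM (ger0_norm r0).
    rewrite (ger0_norm xr0) -!mulrA ler_wpM2l//.
    rewrite (powR_split (normr_ge0 y) r2) expr2.
    have : `|x| `^ (r - 2) <= 2 `^ (r - 2) * `|y| `^ (r - 2).
      by rewrite -powRM// ler_powR2//; lra.
    move=> h.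
    have h' : `|x| * `|y| <= 2 * (`|y| * `|y|) by rewrite mulrA ler_wpM2r.
    rewrite (_ : 2 `^ (r - 2) * _ =
      (2 `^ (r - 2) * `|y| `^ (r - 2)) * (2 * (`|y| * `|y|))); last by ring.
    apply: ler_pM => //.
  rewrite /powR_add_cst.
  have g1 : 0 <= 3 `^ r * (`|x| `^ (r - 2) * y ^+ 2).
    by rewrite mulr_ge0 ?powR_ge0.
  have g2 : 0 <= r * 2 `^ (r - 2) * 2 * (`|x| `^ (r - 2) * y ^+ 2).
    by do 3!rewrite mulr_ge0 ?powR_ge0//.
  have g3 : 0 <= r ^+ 2 * expR r * (`|x| `^ (r - 2) * y ^+ 2 + `|y| `^ r).
    by rewrite mulr_ge0 ?addr_ge0// mulr_ge0 ?sqr_ge0 ?expR_ge0.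
  lra.
have x0 : 0 < `|x| by have := normr_ge0 y; lra.
have xN0 : x != 0 by rewrite -normr_gt0.
pose z := y / x.
have zE : y = x * z by rewrite /z mulrC divfK.
have z2 : `|z| < 1 / 2.
  by rewrite /z normrM normfV ltr_pdivrMr//; lra.
have z1 : 0 < 1 + z by move: z2; rewrite ltr_norml => /andP[]; lra.
have -> : `|x + y| `^ r = `|x| `^ r * (1 + z) `^ r.
  rewrite zE -[X in `|X + _|]mulr1 -mulrDr normrM (gtr0_norm z1) powRM//.
  exact: ltW.
have hz : (1 + z) `^ r <= 1 + r * z + r ^+ 2 * expR r * z ^+ 2.
  rewrite /powR gt_eqF//.
  have hl : r * ln (1 + z) <= r * z.
    rewrite ler_wpM2l// -ler_expR lnK ?posrE//; exact: expR_ge1Dx.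
  apply: (@le_trans _ _ (expR (r * z))); first by rewrite ler_expR.
  apply: (le_trans (expR_le_taylor _)).
  rewrite lerD2l [leRHS](_ : _ = (r * z) ^+ 2 * expR r); last by ring.
  rewrite ler_wpM2l ?sqr_ge0//.
  rewrite ler_expR normrM (ger0_norm r0) ler_piMr//; lra.
apply: (le_trans (ler_wpM2l xxr0 hz)).
have e1 : `|x| `^ r * z = `|x| `^ (r - 2) * x * y.
  rewrite (powR_split (normr_ge0 x) r2) zE real_normK ?num_real//; ring.
have e2 : `|x| `^ r * z ^+ 2 = `|x| `^ (r - 2) * y ^+ 2.
  rewrite (powR_split (normr_ge0 x) r2) zE real_normK ?num_real//; ring.
rewrite [leLHS](_ : _ = `|x| `^ r + r * (`|x| `^ r * z)
   + r ^+ 2 * expR r * (`|x| `^ r * z ^+ 2)); last by ring.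
rewrite e1 e2 /powR_add_cst.
have g0 : 0 <= `|x| `^ (r - 2) * y ^+ 2 + `|y| `^ r.
  by rewrite addr_ge0.
have g1 : 0 <= 3 `^ r * (`|x| `^ (r - 2) * y ^+ 2 + `|y| `^ r).
  by rewrite mulr_ge0 ?powR_ge0.
have g2 : 0 <= r * 2 `^ (r - 2) * 2 * (`|x| `^ (r - 2) * y ^+ 2 + `|y| `^ r).
  by rewrite mulr_ge0// mulr_ge0// mulr_ge0 ?powR_ge0.
have g3 : 0 <= r ^+ 2 * expR r * `|y| `^ r.
  by rewrite mulr_ge0// mulr_ge0 ?sqr_ge0 ?expR_ge0.
lra.
Qed.

(** A power of integer order at least [|p|] is one term of the exponential series, up to a
    factorial. This reduces polynomial Gaussian moments to exponential ones. *)
Lemma powR_1D_le_expR p :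
  exists2 c, 0 < c & forall u, 0 <= u -> (1 + u) `^ p <= c * expR u.
Proof.
pose n := Num.bound `|p|.
exists (n.+1`!%:R * expR 1); first by rewrite mulr_gt0 ?expR_gt0 ?ltr0n ?fact_gt0.
move=> u u0; rewrite -mulrA -expRD.
have u1 : 1 <= 1 + u by lra.
apply: (@le_trans _ _ ((1 + u) ^+ n.+1)).
  rewrite -powR_mulrn; last by lra.
  apply: ler_powR => //; rewrite (le_trans (ler_norm p))//.
  rewrite (le_trans (ltW (archi_boundP (normr_ge0 p))))//.
  by rewrite ler_nat.
have := @expR_ge1Dxn R (1 + u) n ltac:(lra).
have f0 : 0 < n.+1`!%:R :> R by rewrite ltr0n fact_gt0.
rewrite -(ler_pM2l f0) mulrDr mulr1 => h.
apply: le_trans h; rewrite mulrC divfK ?gt_eqF//; lra.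
Qed.

(* Young's inequality with unnormalised constants, by comparing [b] with
   [a `^ (p - 1)]. *)
Lemma mul_le_powRD a b p : 0 <= a -> 0 <= b -> 1 < p ->
  a * b <= a `^ p + b `^ (p / (p - 1)).
Proof.
move=> a0 b0 p1; have := powR_ge0 a p; have := powR_ge0 b (p / (p - 1)).
move=> h1 h2; have [h|h] := leP b (a `^ (p - 1)).
  have := ler_wpM2l a0 h; rewrite mulr_powRB1//; lra.
have p10 : 0 < p - 1 by lra.
have ha : a <= b `^ (1 / (p - 1)).
  rewrite -(@powRr1 _ a)// -[X in a `^ X](@divff _ (p - 1)) ?gt_eqF//.
  by rewrite powRrM div1r ler_powR2 ?powR_ge0 ?invr_ge0// ltW.
have h3 : b `^ (1 / (p - 1)) * b = b `^ (p / (p - 1)).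
  have -> : 1 / (p - 1) = p / (p - 1) - 1 by field; rewrite gt_eqF.
  by rewrite mulrC mulr_powRB1// divr_gt0//; lra.
by have := ler_wpM2r b0 ha; rewrite h3; lra.
Qed.

Lemma powR_le_1D a p q : 0 <= a -> 0 <= p -> p <= q -> a `^ p <= 1 + a `^ q.
Proof.
move=> a0 p0 pq; have [a1|a1] := leP a 1.
  have := ler_powR2 p0 a0 a1; have := powR_ge0 a q; rewrite powR1; lra.
by have := @ler_powR _ a (ltW a1) _ _ pq; lra.
Qed.

(* For [p <= r], [|x|^p] is below [e^p] when [|x| <= e] and below
   [e^(p - r) |x|^r] otherwise. *)
Lemma powR_le_scaled e x p r : 0 < e -> 0 <= x -> 0 <= p -> p <= r ->
  x `^ p <= e `^ p + e `^ (p - r) * x `^ r.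
Proof.
move=> e0 x0 p0 pr; have e00 := ltW e0.
have h : (x / e) `^ p <= 1 + (x / e) `^ r by apply: powR_le_1D => //; exact: divr_ge0.
have := ler_wpM2l (powR_ge0 e p) h; rewrite mulrDr mulr1 -powRM ?divr_ge0//.
rewrite mulrC divfK ?gt_eqF// => /le_trans; apply; rewrite lerD2l.
rewrite powRM// ?invr_ge0// -powR_inv1// -powRrM mulN1r.
rewrite mulrCA -powRD; last by rewrite (gt_eqF e0) implybT.
by rewrite mulrC lexx.
Qed.

Lemma powR_add_le x y p : 0 <= p -> 0 <= x -> 0 <= y ->
  (x + y) `^ p <= 2 `^ p * (x `^ p + y `^ p).
Proof.
move=> p0 x0 y0; wlog xy : x y x0 y0 / x <= y => [h|].
  have [|/ltW] := leP x y; first exact: h.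
  by move=> yx; rewrite addrC [_ `^ p + _]addrC h.
apply: (@le_trans _ _ ((2 * y) `^ p)); first by rewrite ler_powR2 ?addr_ge0//; lra.
by rewrite powRM// ler_wpM2l ?powR_ge0// lerDr powR_ge0.
Qed.

Lemma powR_invl a p : 0 <= a -> a^-1 `^ p = a `^ (- p).
Proof. by move=> a0; rewrite -(powR_inv1 a0) -powRrM mulN1r. Qed.

Lemma powR_split_le x y r : 2 <= r -> 0 <= x ->
  x `^ (r - 2) * y ^+ 2 <= x `^ r + `|y| `^ r.
Proof.
move=> r2 x0; have r20 : 0 <= r - 2 by lra.
have := powR_ge0 x r; have := powR_ge0 `|y| r; move=> hx hy.
rewrite -(real_normK (num_real y)); have [xy|/ltW xy] := leP x `|y|.
  have e : x `^ (r - 2) <= `|y| `^ (r - 2) by apply: ler_powR2.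
  by have := ler_wpM2r (sqr_ge0 `|y|) e; rewrite -powR_split//; lra.
have e : `|y| ^+ 2 <= x ^+ 2 by rewrite lerXn2r// nnegrE.
by have := ler_wpM2l (powR_ge0 x (r - 2)) e; rewrite -powR_split//; lra.
Qed.

End PowerInequalities.

(** * Gaussian moments *)

Section MeasurablePowers.
Context d (T : measurableType d) (R : realType).

Lemma measurable_norm_powR (f : T -> R) p :
  measurable_fun setT f -> measurable_fun setT (fun x => `|f x| `^ p).
Proof.
move=> mf; apply: (measurableT_comp (measurable_powR p)).
exact: measurableT_comp.
Qed.

End MeasurablePowers.

(** * Integrability and expectation of real random variables *)

Section Expectation.
Context d (T : measurableType d) (R : realType) (P : probability T R).
Implicit Types (f g : T -> R) (c : R).

Definition Lone f := P.-integrable setT (EFin \o f).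
Definition Ex f : R := (\int[P]_w f w)%R.

Lemma Lone_le f g : measurable_fun setT f -> Lone g ->
  (forall x, `|f x| <= g x) -> Lone f.
Proof.
move=> mf Lg fg; apply: (le_integrable measurableT _ _ Lg).
  by apply/measurable_EFinP.
by move=> x _ /=; rewrite lee_fin (le_trans (fg x))// ler_norm.
Qed.

Lemma LoneD f g : Lone f -> Lone g -> Lone (fun x => f x + g x).
Proof. by move=> Lf Lg; exact: (integrableD measurableT Lf Lg). Qed.

Lemma LoneZ c f : Lone f -> Lone (fun x => c * f x).
Proof. by move=> Lf; exact: (integrableZl measurableT c Lf). Qed.

Lemma LoneB f g : Lone f -> Lone g -> Lone (fun x => f x - g x).
Proof. by move=> Lf Lg; exact: (integrableB measurableT Lf Lg). Qed.

Lemma Lone_cst c : Lone (fun=> c).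
Proof. exact: finite_measure_integrable_cst. Qed.

Lemma Lone_norm f : Lone f -> Lone (fun x => `|f x|).
Proof. by move=> Lf; exact: (integrable_norm Lf). Qed.

Lemma Lone_sum (I : Type) (r : seq I) (f : I -> T -> R) :
  (forall i, Lone (f i)) -> Lone (fun x => \sum_(i <- r) f i x).
Proof.
move=> Lf; elim: r => [|i r ih].
  by under eq_fun do rewrite big_nil; exact: Lone_cst.
by under eq_fun do rewrite big_cons; exact: LoneD.
Qed.

Lemma ExD f g : Lone f -> Lone g -> Ex (fun x => f x + g x) = Ex f + Ex g.
Proof. by move=> Lf Lg; exact: RintegralD. Qed.

Lemma ExB f g : Lone f -> Lone g -> Ex (fun x => f x - g x) = Ex f - Ex g.
Proof. by move=> Lf Lg; exact: RintegralB. Qed.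

Lemma ExZ c f : Lone f -> Ex (fun x => c * f x) = c * Ex f.
Proof. by move=> Lf; exact: RintegralZl. Qed.

Lemma Ex_cst c : Ex (fun=> c) = c.
Proof.
rewrite /Ex Rintegral_cst// -[RHS]mulr1; congr *%R.
by rewrite -[RHS]/(fine 1%E); congr fine; exact: probability_setT.
Qed.

Lemma Ex_ge0 f : (forall x, 0 <= f x) -> 0 <= Ex f.
Proof. by move=> f0; exact: Rintegral_ge0. Qed.

Lemma Ex_le f g : Lone f -> Lone g -> (forall x, f x <= g x) -> Ex f <= Ex g.
Proof. by move=> Lf Lg fg; apply: le_Rintegral => // x _. Qed.

Lemma Ex_sum (I : Type) (r : seq I) (f : I -> T -> R) : (forall i, Lone (f i)) ->
  Ex (fun x => \sum_(i <- r) f i x) = \sum_(i <- r) Ex (f i).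
Proof.
move=> Lf; elim: r => [|i r ih].
  by rewrite big_nil; under eq_fun do rewrite big_nil; rewrite Ex_cst.
rewrite big_cons -ih; under eq_fun do rewrite big_cons.
by rewrite ExD//; exact: Lone_sum.
Qed.

Lemma Ex_integral f : Lone f -> (\int[P]_w (f w)%:E)%E = (Ex f)%:E.
Proof.
by move=> Lf; rewrite /Ex /Rintegral fineK//; exact: integrable_fin_num Lf.
Qed.

Lemma Lone_integral_le f c : measurable_fun setT f -> (forall x, 0 <= f x) ->
  (\int[P]_w (f w)%:E <= c%:E)%E -> Lone f /\ Ex f <= c.
Proof.
move=> mf f0 fc.
have Lf : Lone f.
  apply/integrableP; split; first exact/measurable_EFinP.
  apply: le_lt_trans (ltry c); apply: le_trans fc; rewrite le_eqVlt; apply/orP; left.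
  by apply/eqP; apply: eq_integral => x _ /=; rewrite ger0_norm.
by split=> //; rewrite -lee_fin -Ex_integral.
Qed.

Lemma eq_Ex f g : f =1 g -> Ex f = Ex g.
Proof. by move=> fg; congr Ex; exact/funext. Qed.

Lemma Lone_powR_le f p q : measurable_fun setT f -> 0 <= p -> p <= q ->
  Lone (fun x => `|f x| `^ q) -> Lone (fun x => `|f x| `^ p).
Proof.
move=> mf p0 pq Lq; apply: (@Lone_le _ (fun x => 1 + `|f x| `^ q)).
- exact: measurable_norm_powR.
- by apply: LoneD => //; exact: Lone_cst.
- by move=> x; rewrite ger0_norm ?powR_ge0// powR_le_1D.
Qed.

Lemma Lone_mul_sqr f g : measurable_fun setT f -> measurable_fun setT g ->
  Lone (fun x => f x ^+ 2) -> Lone (fun x => g x ^+ 2) ->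
  Lone (fun x => f x * g x).
Proof.
move=> mf mg Lf Lg; apply: (@Lone_le _ (fun x => f x ^+ 2 + g x ^+ 2)).
- exact: measurable_funM.
- exact: LoneD.
- move=> x; rewrite ler_norml; have := sqr_ge0 (f x - g x).
  have := sqr_ge0 (f x + g x); rewrite sqrrB sqrrD; have := sqr_ge0 (f x).
  have := sqr_ge0 (g x); lra.
Qed.

End Expectation.

(** * The moment generating function of the normal law *)

Section NormalMoments.
Context {R : realType}.
Local Notation mu := (@lebesgue_measure R).

(** The change of variables comes with the Radon-Nikodym derivative of [normal_prob]; it has the
    same integral as [normal_pdf] over every measurable set, hence equals it almost everywhere. *)
Lemma ge0_integral_normal_prob (m s : R) (f : R -> \bar R) :
  (forall x, 0 <= f x)%E -> measurable_fun setT f ->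
  (\int[normal_prob m s]_x f x = \int[mu]_x (f x * (normal_pdf m s x)%:E))%E.
Proof.
move=> f0 mf.
have ac : normal_prob m s `<< mu := normal_prob_dominates m s.
rewrite -(Radon_Nikodym_SigmaFinite.change_of_variables ac)//.
have RNi := Radon_Nikodym_SigmaFinite.f_integrable ac.
apply: ae_eq_integral => //.
- apply: emeasurable_funM => //; exact: measurable_int RNi.
- apply: emeasurable_funM => //; apply/measurable_EFinP.
  exact: measurable_normal_pdf.
have [N [mN N0 HN]] : ae_eq mu setT
   (Radon_Nikodym_SigmaFinite.f (normal_prob m s) mu)
   (fun x => (normal_pdf m s x)%:E).
  apply: integral_ae_eq => //.
    apply/measurable_EFinP; exact: measurable_normal_pdf.
  by move=> A _ mA; rewrite -Radon_Nikodym_SigmaFinite.f_integral.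
exists N; split => // x /= h; apply: HN => /= h'; apply: h => Dx.
by rewrite h'.
Qed.

(* Completing the square: [e^(l x)] times the centred density is a multiple of the
   density with mean [l s^2]. *)
Lemma normal_mgf_integral (s l : R) : 0 < s ->
  (\int[normal_prob 0 s]_x (expR (l * x))%:E = (expR (l ^+ 2 * s ^+ 2 / 2))%:E)%E.
Proof.
move=> s0; rewrite ge0_integral_normal_prob//; last first.
  by apply/measurable_EFinP; apply: measurableT_comp => //; exact: measurable_funM.
transitivity (\int[mu]_x ((expR (l ^+ 2 * s ^+ 2 / 2))%:E *
    (normal_pdf (l * s ^+ 2) s x)%:E))%E.
  apply: eq_integral => x _; rewrite -!EFinM; congr EFin.
  rewrite /normal_pdf gt_eqF// /normal_fun mulrCA [RHS]mulrCA; congr *%R.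
  rewrite -!expRD; congr expR; field.
  by rewrite gt_eqF.
rewrite ge0_integralZl//; last 2 first.
- by apply/measurable_EFinP; exact: measurable_normal_pdf.
- by move=> x _; rewrite lee_fin normal_pdf_ge0.
by rewrite integral_normal_pdf mule1.
Qed.

End NormalMoments.

Section HyperbolicCosine.
Context {R : realType}.
Implicit Types x y : R.

Lemma ler_sinh y : 0 <= y -> 2 * y <= expR y - expR (- y).
Proof.
move=> y0.
have [||c _] := @MVT_segment R (fun z => expR z - expR (- z))
  (fun z => expR z + expR (- z)) 0 y y0.
- by move=> z _; apply: is_derive_eq; rewrite /GRing.scale /=; ring.
- apply: continuous_subspaceT => z.
  apply: cvgB; first exact: continuous_expR.
  apply: (@cvg_comp _ _ _ -%R expR); [exact: opp_continuous|exact: continuous_expR].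
rewrite !subr0 oppr0 subrr subr0 => ->; rewrite ler_wpM2r//.
have := expR_ge1Dx c; have := expR_ge1Dx (- c); lra.
Qed.

Lemma sinh_le y : 0 <= y -> expR y - expR (- y) <= 2 * y * expR y.
Proof.
move=> y0; have := expR_ge1Dx (- (2 * y)); rewrite -(ler_pM2r (expR_gt0 y)) -expRD.
by rewrite (_ : - (2 * y) + y = - y); [lra|ring].
Qed.

Lemma cosh_sqrE x :
  expR x + expR (- x) - 2 = (expR (x / 2) - expR (- (x / 2))) ^+ 2.
Proof.
have h : expR (x / 2) * expR (- (x / 2)) = 1 by rewrite expRxMexpNx_1.
have e (z : R) : expR z = expR (z / 2) ^+ 2.
  by rewrite -expRM_natl mulrC divfK.
rewrite (e x) (e (- x)) mulNr sqrrB h; ring.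
Qed.

(** The middle term is the square of [2 sinh (x / 2)], which for [x >= 0] lies between [x] and
    [x e^(x/2)]; evenness gives the rest. It plays the part of a second difference quotient when the
    variance is read off the generating function. *)
Lemma cosh_bounds x : x ^+ 2 <= expR x + expR (- x) - 2 <= x ^+ 2 * expR `|x|.
Proof.
wlog x0 : x / 0 <= x => [h|].
  have [|x0] := leP 0 x; first exact: h.
  have := h (- x); rewrite opprK sqrrN normrN [expR (- x) + _]addrC; apply; lra.
have y0 : 0 <= x / 2 by lra.
have h1 := ler_sinh y0; have h2 := sinh_le y0.
rewrite cosh_sqrE ger0_norm//; apply/andP; split.
  by rewrite lerXn2r ?nnegrE//; lra.
have -> : x ^+ 2 * expR x = (2 * (x / 2) * expR (x / 2)) ^+ 2.
  by rewrite exprMn -expRM_natl; congr (_ ^+ 2 * expR _); lra.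
by rewrite lerXn2r ?nnegrE ?mulr_ge0 ?expR_ge0//; lra.
Qed.

End HyperbolicCosine.

(** * Mean and variance from the moment generating function *)

Section GaussianMoments.
Context d (Omega : measurableType d) (R : realType) (P : probability Omega R).
Variables (Z : Omega -> R) (tau : R).
Hypothesis mZ : measurable_fun setT Z.
Hypothesis tau0 : 0 <= tau.
Hypothesis mgf : forall l : R, Lone P (fun w => expR (l * Z w)) /\
  Ex P (fun w => expR (l * Z w)) = expR (l ^+ 2 * tau / 2).
Local Notation Lone := (Lone P).
Local Notation Ex := (Ex P).

Lemma mgf_norm (l : R) : 0 <= l -> Lone (fun w => expR (l * `|Z w|)) /\
  Ex (fun w => expR (l * `|Z w|)) <= 2 * expR (l ^+ 2 * tau / 2).
Proof.
move=> l0; have [L1 E1] := mgf l; have [L2 E2] := mgf (- l).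
have le w : expR (l * `|Z w|) <= expR (l * Z w) + expR (- l * Z w).
  have := expR_ge0 (l * Z w); have := expR_ge0 (- l * Z w).
  by have [z0|z0] := ger0P (Z w); rewrite ?mulrN ?mulNr; lra.
have L : Lone (fun w => expR (l * `|Z w|)).
  apply: Lone_le (LoneD L1 L2) _ => [|w]; last by rewrite ger0_norm ?expR_ge0.
  apply: measurableT_comp => //; apply: measurable_funM => //.
  exact: measurableT_comp.
split=> //; apply: le_trans (Ex_le L (LoneD L1 L2) le) _.
rewrite ExD// E1 E2 sqrrN; lra.
Qed.

(* [1 + x <= e^x] at [x = l Z] gives [l E Z <= e^(l^2 tau / 2) - 1] for [l] of both
   signs; then [l] tends to [0]. *)
Lemma mgf_mean : Lone Z /\ Ex Z = 0.
Proof.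
have LZ : Lone Z.
  have [L1 _] := mgf_norm ler01; apply: Lone_le L1 _ => // w.
  by rewrite mul1r; have := expR_ge1Dx `|Z w|; lra.
split=> //.
have key (l : R) : l * Ex Z <= expR (l ^+ 2 * tau / 2) - 1.
  have [L1 E1] := mgf l; rewrite -E1 -ExZ// -[X in _ - X](Ex_cst P 1) -ExB//.
    apply: Ex_le; [exact: LoneZ|by apply: LoneB => //; exact: Lone_cst|].
    by move=> w; have := expR_ge1Dx (l * Z w); lra.
  exact: Lone_cst.
pose K := tau / 2 * expR (tau / 2).
have K0 : 0 <= K by rewrite mulr_ge0 ?expR_ge0 ?divr_ge0.
have key2 (l : R) : `|l| <= 1 -> l * Ex Z <= l ^+ 2 * K.
  move=> l1; apply: le_trans (key l) _.
  have l2 : l ^+ 2 <= 1 by rewrite -(real_normK (num_real l)) expr_le1.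
  have l20 := sqr_ge0 l.
  have h (u : R) : expR u <= 1 + u * expR u.
    have := expR_ge1Dx (- u); rewrite -(ler_pM2r (expR_gt0 u)) -expRD addNr expR0; lra.
  have := h (l ^+ 2 * tau / 2); rewrite -lerBlDl => /le_trans; apply.
  rewrite [leRHS](_ : _ = l ^+ 2 * tau / 2 * expR (tau / 2)); last by rewrite /K; ring.
  have u0 : 0 <= l ^+ 2 * tau / 2 by rewrite divr_ge0// mulr_ge0.
  by rewrite ler_wpM2l// ler_expR -mulrA ler_piMl// divr_ge0.
apply/eqP/negPn/negP => E0.
have E0' : 0 < `|Ex Z| by rewrite normr_gt0.
(* Chosen so that [q <= 1] and [q * K < |Ex Z|]; at [l] of modulus [q] and of the sign of [Ex Z],
   [key2] would give [|Ex Z| <= q * K]. *)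
pose q : R := `|Ex Z| / (`|Ex Z| + K + 1).
have D0 : 0 < `|Ex Z| + K + 1 by lra.
have q0 : 0 < q by rewrite divr_gt0.
have q1 : q <= 1 by rewrite ler_pdivrMr//; lra.
have qD : q * (`|Ex Z| + K + 1) = `|Ex Z| by rewrite /q divfK// gt_eqF.
pose l : R := Num.sg (Ex Z) * q.
have ln : `|l| = q by rewrite /l normrM normr_sg E0 mul1r gtr0_norm.
have lE : l * Ex Z = q * `|Ex Z| by rewrite /l -mulrA mulrCA -normrEsg.
clearbody l q.
have := key2 l; rewrite ln => /(_ q1).
rewrite -(real_normK (num_real l)) ln lE expr2 -mulrA ler_pM2l// => h.
nra.
Qed.

(* [x^2 <= e^x + e^-x - 2 <= x^2 e^|x|] at [x = l Z], with [l] tending to [0+]. *)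
Lemma mgf_variance : Lone (fun w => Z w ^+ 2) /\ Ex (fun w => Z w ^+ 2) = tau.
Proof.
have [L1 _] := mgf_norm ler01.
have [L2 _] := mgf_norm (ler0n R 2).
have mZ2 : measurable_fun setT (fun w => Z w ^+ 2) by exact: measurable_funX.
have mE (l : R) : measurable_fun setT (fun w => expR (l * `|Z w|)).
  apply: measurableT_comp => //; apply: measurable_funM => //.
  exact: measurableT_comp.
have Z2le w : Z w ^+ 2 <= 2 * expR (1 * `|Z w|).
  rewrite mul1r; have := @expR_ge1Dxn R `|Z w| 1 (normr_ge0 _).
  by rewrite real_normK ?num_real// (_ : 2`!%:R = 2 :> R)//; lra.
have LZ2 : Lone (fun w => Z w ^+ 2).
  apply: Lone_le (LoneZ 2 L1) _ => // w.
  by rewrite ger0_norm ?sqr_ge0.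
(* The left side bounds [Z^2 (e^|lZ| - 1) / l] for [0 < l <= 1], the error of the quadratic
   approximation; it is integrable because [|Z|^3 <= 3! e^|Z|]. *)
have Z3le w : Z w ^+ 2 * (`|Z w| * expR `|Z w|) <= 6 * expR (2 * `|Z w|).
  rewrite -(real_normK (num_real (Z w))) mulrA -exprSr.
  have -> : expR (2 * `|Z w|) = expR `|Z w| * expR `|Z w|.
    by rewrite -expRD; congr expR; ring.
  rewrite mulrA.
  rewrite ler_wpM2r ?expR_ge0//.
  have := @expR_ge1Dxn R `|Z w| 2 (normr_ge0 _).
  by rewrite (_ : 3`!%:R = 6 :> R)//; lra.
have LZ3 : Lone (fun w => Z w ^+ 2 * (`|Z w| * expR `|Z w|)).
  apply: Lone_le (LoneZ 6 L2) _ => // [|w].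
    apply: measurable_funM => //; apply: measurable_funM.
      exact: measurableT_comp.
    by have := mE 1; under eq_fun do rewrite mul1r.
  by rewrite ger0_norm// mulr_ge0 ?sqr_ge0// mulr_ge0 ?expR_ge0.
have LC0 (l : R) : Lone (fun w => expR (l * Z w) + expR (- l * Z w)).
  exact: LoneD (mgf l).1 (mgf (- l)).1.
have LC (l : R) : Lone (fun w => expR (l * Z w) + expR (- l * Z w) - 2).
  exact: LoneB (LC0 l) (Lone_cst P 2).
have EC (l : R) : Ex (fun w => expR (l * Z w) + expR (- l * Z w) - 2)
    = 2 * (expR (l ^+ 2 * tau / 2) - 1).
  rewrite (ExB (LC0 l) (Lone_cst P 2)) (ExD (mgf l).1 (mgf (- l)).1) Ex_cst.
  by rewrite !(mgf _).2 sqrrN; lra.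
split=> //; set v := Ex _.
have v0 : 0 <= v by apply: Ex_ge0 => w; exact: sqr_ge0.
set K := Ex (fun w => Z w ^+ 2 * (`|Z w| * expR `|Z w|)).
have K0 : 0 <= K.
  by apply: Ex_ge0 => w; rewrite mulr_ge0 ?sqr_ge0// mulr_ge0 ?expR_ge0.
have hexp (u : R) : expR u <= 1 + u * expR u.
  have := expR_ge1Dx (- u); rewrite -(ler_pM2r (expR_gt0 u)) -expRD addNr expR0; lra.
have up (l : R) : 0 < l -> l <= 1 -> v <= tau + l * (tau ^+ 2 / 2 * expR (tau / 2)).
  move=> l0 l1; have l20 : 0 < l ^+ 2 by rewrite exprn_gt0.
  have l21 : l ^+ 2 <= 1 by rewrite expr_le1// ltW.
  have h : l ^+ 2 * v <= 2 * (expR (l ^+ 2 * tau / 2) - 1).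
    rewrite -EC -ExZ//; apply: Ex_le => //; first exact: LoneZ.
    by move=> w; have /andP[] := cosh_bounds (l * Z w); rewrite exprMn mulNr.
  rewrite -(ler_pM2l l20); apply: (le_trans h).
  have hu := hexp (l ^+ 2 * tau / 2); set u := l ^+ 2 * tau / 2 in hu *.
  have u0 : 0 <= u by rewrite /u divr_ge0// mulr_ge0// ltW.
  have hu' : u * (expR u - 1) <= u * (u * expR (tau / 2)).
    rewrite ler_wpM2l// (@le_trans _ _ (u * expR u))//; first lra.
    by rewrite ler_wpM2l// ler_expR /u -mulrA ler_piMl// divr_ge0.
  rewrite (_ : l ^+ 2 * (tau + _) = 2 * u + 2 * (l * (u * (tau / 2 * expR (tau / 2)))));
    last by rewrite /u; field.
  have : u * (u * expR (tau / 2)) <= l * (u * (tau / 2 * expR (tau / 2))).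
    rewrite [leRHS](_ : _ = u * (l * (tau / 2) * expR (tau / 2))); last by ring.
    rewrite ler_wpM2l// ler_wpM2r ?expR_ge0// /u -mulrA ler_wpM2r ?divr_ge0//.
    by rewrite expr2 ler_piMl// ltW.
  nra.
have lo (l : R) : 0 < l -> l <= 1 -> tau <= v + l * K.
  move=> l0 l1; have l20 : 0 < l ^+ 2 by rewrite exprn_gt0.
  rewrite -(ler_pM2l l20).
  have h : 2 * (expR (l ^+ 2 * tau / 2) - 1) <= l ^+ 2 * (v + l * K).
    rewrite -EC /v /K -ExZ// -ExD//; last exact: LoneZ.
    rewrite -ExZ; last by apply: LoneD => //; exact: LoneZ.
    apply: Ex_le => //; first by apply: LoneZ; apply: LoneD => //; exact: LoneZ.
    move=> w; have /andP[_] := cosh_bounds (l * Z w); rewrite -mulNr => /le_trans; apply.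
    rewrite exprMn -mulrA ler_wpM2l ?(ltW l20)//.
    have := ler_wpM2l (sqr_ge0 (Z w)) (hexp `|l * Z w|).
    move=> /le_trans; apply; rewrite mulrDr mulr1 lerD2l [leRHS]mulrCA ler_wpM2l ?sqr_ge0//.
    rewrite normrM (gtr0_norm l0) [leRHS]mulrA ler_wpM2l ?mulr_ge0 ?(ltW l0)//.
    by rewrite ler_expR ler_piMl.
  have := expR_ge1Dx (l ^+ 2 * tau / 2); lra.
have lim (a b c : R) : 0 <= c ->
    (forall l, 0 < l -> l <= 1 -> a <= b + l * c) -> a <= b.
  move=> c0 h; apply/ler_addgt0Pr => e e0.
  (* This value of [l] is at most 1 and makes [l * c] at most [e]. *)
  have q : 0 < e / (e + c + 1) by rewrite divr_gt0//; lra.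
  have q1 : e / (e + c + 1) <= 1 by rewrite ler_pdivrMr; lra.
  apply: (le_trans (h _ q q1)); rewrite lerD2l mulrAC ler_pdivrMr; last lra.
  by rewrite ler_pM2l//; lra.
apply/eqP; rewrite eq_le; apply/andP; split.
  by apply: (lim _ _ _ _ up); rewrite mulr_ge0 ?expR_ge0// divr_ge0 ?sqr_ge0.
by apply: (lim _ _ _ _ lo).
Qed.

End GaussianMoments.

(** * Increments of the Wiener process *)

Section IndependentProduct.
Context d (Omega : measurableType d) (R : realType) (P : probability Omega R).
Variables Y Z : {mfun Omega >-> R}.
Hypothesis ind : forall A B : set R, measurable A -> measurable B ->
  (P (Y @^-1` A `&` Z @^-1` B) = P (Y @^-1` A) * P (Z @^-1` B))%E.
Hypotheses (LY : Lone P Y) (LZ : Lone P Z).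

Let YZ w := (Y w, Z w).
Let mYZ : measurable_fun setT YZ.
Proof. by apply: measurable_fun_pair. Qed.
Let YZ_pack : {mfun Omega >-> (R * R)%type} :=
  HB.pack YZ (isMeasurableFun.Build _ _ _ _ _ mYZ).

Let m1 := distribution P Y.
Let m2 := distribution P Z.

Let joint_law (X : set (R * R)) : measurable X ->
  (m1 \x m2)%E X = distribution P YZ_pack X.
Proof.
by move=> mX; apply: product_measure_unique => // A B mA mB; exact: ind.
Qed.

Let mprod : measurable_fun setT (fun z : R * R => (z.1 * z.2)%:E).
Proof.
by apply/measurable_EFinP; apply: measurable_funM.
Qed.

Let distribution_integral (f : R -> R) (X : {mfun Omega >-> R}) :
  measurable_fun setT f -> Lone P (f \o X) ->
  (\int[distribution P X]_x (f x)%:E = (Ex P (f \o X))%:E)%E.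
Proof.
move=> mf Lf; rewrite integral_distribution -?Ex_integral//.
by apply/measurable_EFinP.
Qed.

Let mid : measurable_fun [set: R] (@idfun R).
Proof. exact: measurable_id. Qed.

Let LabsZ : Lone P (Num.norm \o Z). Proof. exact: Lone_norm. Qed.
Let LabsY : Lone P (Num.norm \o Y). Proof. exact: Lone_norm. Qed.

Let integrable_prod : (m1 \x m2)%E.-integrable setT (fun z : R * R => (z.1 * z.2)%:E).
Proof.
apply/integrable12ltyP => //=.
rewrite (_ : integral _ _ _ = ((Ex P (Num.norm \o Y)) * Ex P (Num.norm \o Z))%:E) ?ltry//.
transitivity (\int[m1]_x ((Ex P (Num.norm \o Z))%:E * `|x|%:E))%E.
  apply: eq_integral => x _.
  under eq_integral do rewrite normrM EFinM.
  rewrite ge0_integralZl//; last first.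
    by apply/measurable_EFinP; exact: normr_measurable.
  by rewrite distribution_integral// muleC.
rewrite ge0_integralZl//; last 2 first.
- by apply/measurable_EFinP; exact: normr_measurable.
- by rewrite lee_fin Ex_ge0//= => x; exact: normr_ge0.
by rewrite distribution_integral// -EFinM mulrC.
Qed.

(** Independence says that the joint law and the product of the two laws agree on rectangles, hence
    everywhere. Tonelli's theorem then gives integrability of the product and Fubini's theorem its
    mean. *)
Lemma indep_Lone_Ex_mul : Lone P (fun w => Y w * Z w) /\
  Ex P (fun w => Y w * Z w) = Ex P Y * Ex P Z.
Proof.
have L : Lone P (fun w => Y w * Z w).
  apply/integrableP; split.
    by apply/measurable_EFinP; exact: measurable_funM.
  move/integrableP : integrable_prod => [_].
  rewrite (eq_measure_integral (distribution P YZ_pack)); last first.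
    by move=> X mX _; exact: joint_law.
  by rewrite ge0_integral_distribution//; exact: measurableT_comp.
split=> //; apply/EFin_inj; rewrite -Ex_integral//.
transitivity (\int[m1 \x m2]_z (z.1 * z.2)%:E)%E.
  rewrite (eq_measure_integral (distribution P YZ_pack)); last first.
    by move=> X mX _; exact: joint_law.
  by rewrite integral_distribution.
rewrite -integral12_prod_meas1//.
transitivity (\int[m1]_x ((Ex P Z)%:E * x%:E))%E.
  apply: eq_integral => x _; rewrite /fubini_F/=.
  under eq_integral do rewrite EFinM.
  rewrite integralZl//; last first.
    by apply: integrable_pushforward => //; exact/measurable_EFinP.
  by rewrite (distribution_integral mid)//; rewrite muleC.
rewrite integralZl//; last first.
  by apply: integrable_pushforward => //; exact/measurable_EFinP.
by rewrite (distribution_integral mid)// -EFinM mulrC.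
Qed.

End IndependentProduct.

Definition incr (R : realType) (Omega : Type) (W : R -> Omega -> R) (s t : R)
  (w : Omega) : R := W t w - W s w.

Section WienerIncrements.
Context d (Omega : measurableType d) (R : realType) (P : probability Omega R).
Variables (F : R -> set (set Omega)) (W : R -> Omega -> R).
Hypotheses (hF : usual_conditions P F) (hW : wiener P F W).
Implicit Types (s t a b : R) (Y : Omega -> R).
Local Notation Lone := (Lone P).
Local Notation Ex := (Ex P).

Lemma adapted_preimage t Y (B : set R) : 0 <= t -> adapted_at F t Y ->
  measurable B -> F t (Y @^-1` B).
Proof.
move=> t0 aY mB; have [_ [sF _ _] _ _] := hF.
have := aY measurableT B mB; rewrite setTI.
by rewrite /measurable/= sigma_algebra_id//; exact: sF.
Qed.

Lemma adapted_measurable t Y : 0 <= t -> adapted_at F t Y ->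
  measurable_fun setT Y.
Proof.
move=> t0 aY _ B mB; rewrite setTI; have [_ [_ sm _] _ _] := hF.
by apply: (sm t t0); exact: adapted_preimage.
Qed.

Lemma adapted_le s t Y : 0 <= s -> s <= t -> adapted_at F s Y -> adapted_at F t Y.
Proof.
move=> s0 st aY _ B mB; rewrite setTI; apply: sub_sigma_algebra.
have [_ [_ _ mono] _ _] := hF.
by apply: (mono s t s0 st); exact: adapted_preimage.
Qed.

Lemma wiener_adapted t : 0 <= t -> adapted_at F t (W t).
Proof. by move=> t0; have [_ _ aW _ _] := hW; exact: aW. Qed.

Lemma incr_adapted s t : 0 <= s -> s <= t -> adapted_at F t (incr W s t).
Proof.
move=> s0 st; apply: measurable_funB.
  by apply: wiener_adapted; exact: le_trans st.
by apply: (adapted_le s0 st); exact: wiener_adapted.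
Qed.

Lemma incr_measurable s t : 0 <= s -> s <= t -> measurable_fun setT (incr W s t).
Proof.
by move=> s0 st; apply: adapted_measurable (incr_adapted s0 st); exact: le_trans st.
Qed.

(** The degenerate increment [s = t] is included, so that increments over empty cells fall under the
    same mean and variance formulas. *)
Lemma incr_mgf s t : 0 <= s -> s <= t -> forall l : R,
  Lone (fun w => expR (l * incr W s t w)) /\
  Ex (fun w => expR (l * incr W s t w)) = expR (l ^+ 2 * (t - s) / 2).
Proof.
move=> s0; rewrite le_eqVlt => /predU1P[<- l|st l].
  have e w : expR (l * incr W s s w) = 1 by rewrite /incr subrr mulr0 expR0.
  rewrite (_ : (fun w => _) = fun=> 1); last by apply/funext.
  rewrite Ex_cst subrr mulr0 mul0r expR0; split=> //; exact: Lone_cst.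
have [_ _ _ _ law] := hW.
have mI := incr_measurable s0 (ltW st).
have tau0 : 0 < Num.sqrt (t - s) by rewrite sqrtr_gt0 subr_gt0.
have mE : measurable_fun setT (fun x : R => (expR (l * x))%:E).
  by apply/measurable_EFinP; apply: measurableT_comp => //; exact: measurable_funM.
have E : (\int[P]_w (expR (l * incr W s t w))%:E = (expR (l ^+ 2 * (t - s) / 2))%:E)%E.
  transitivity (\int[pushforward P (incr W s t : Omega -> measurableTypeR R)]_x
      (expR (l * x))%:E)%E.
    by rewrite ge0_integral_pushforward.
  rewrite (eq_measure_integral (normal_prob 0 (Num.sqrt (t - s)))); last first.
    by move=> B mB _; exact: law.
  by rewrite normal_mgf_integral// sqr_sqrtr// subr_ge0 ltW.
have [L _] := @Lone_integral_le _ _ _ P (fun w => expR (l * incr W s t w)) _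
  ltac:(apply: measurableT_comp => //; exact: measurable_funM)
  ltac:(by move=> w; exact: expR_ge0)
  ltac:(by rewrite E).
by split=> //; apply/EFin_inj; rewrite -E -Ex_integral.
Qed.

Lemma incr_mean s t : 0 <= s -> s <= t -> Lone (incr W s t) /\ Ex (incr W s t) = 0.
Proof.
move=> s0 st; apply: mgf_mean (incr_measurable s0 st) _ (incr_mgf s0 st).
by rewrite subr_ge0.
Qed.

Lemma incr_variance s t : 0 <= s -> s <= t -> Lone (fun w => incr W s t w ^+ 2) /\
  Ex (fun w => incr W s t w ^+ 2) = t - s.
Proof.
move=> s0 st; apply: mgf_variance (incr_measurable s0 st) _ (incr_mgf s0 st).
by rewrite subr_ge0.
Qed.

(** Preimages under [k] of the increment are events of the increment, so the independence in
    [wiener] passes to [k]. The cases of the identity, the square and the absolute [r]-th power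
    replace conditioning on the past. *)
Lemma incr_indep s t Y (k : R -> R) : 0 <= s -> s <= t -> adapted_at F s Y ->
  Lone Y -> measurable_fun setT k -> Lone (k \o incr W s t) ->
  Lone (fun w => Y w * k (incr W s t w)) /\
  Ex (fun w => Y w * k (incr W s t w)) = Ex Y * Ex (k \o incr W s t).
Proof.
move=> s0; rewrite le_eqVlt => /predU1P[<-|st] aY LY mk Lk.
  have e : k \o incr W s s = fun=> k 0 by apply/funext => w; rewrite /= /incr subrr.
  rewrite (_ : (fun w => _) = fun w => k 0 * Y w); last first.
    by apply/funext => w; rewrite /incr subrr mulrC.
  by rewrite e Ex_cst ExZ// mulrC; split=> //; exact: LoneZ.
have mY := adapted_measurable s0 aY.
have mkI : measurable_fun setT (k \o incr W s t).
  by apply: measurableT_comp => //; exact: incr_measurable (ltW st).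
pose Y' : {mfun Omega >-> R} := HB.pack Y (isMeasurableFun.Build _ _ _ _ _ mY).
pose Z' : {mfun Omega >-> R} :=
  HB.pack (k \o incr W s t) (isMeasurableFun.Build _ _ _ _ _ mkI).
apply: (@indep_Lone_Ex_mul _ _ _ P Y' Z') => //= A B mA mB.
have [_ _ _ ind _] := hW.
rewrite (_ : (k \o _) @^-1` B = (W t \- W s) @^-1` (k @^-1` B))//.
apply: ind => //; first exact: adapted_preimage.
by rewrite -[X in measurable X]setTI; exact: mk.
Qed.

Lemma incr_orth s t Y : 0 <= s -> s <= t -> adapted_at F s Y -> Lone Y ->
  Lone (fun w => Y w * incr W s t w) /\ Ex (fun w => Y w * incr W s t w) = 0.
Proof.
move=> s0 st aY LY; have [L E] := incr_mean s0 st.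
have [? ->] := @incr_indep s t Y idfun s0 st aY LY (@measurable_id _ _ setT) L.
by rewrite (_ : idfun \o _ = incr W s t)// E mulr0.
Qed.

Lemma incr_sqr_indep s t Y : 0 <= s -> s <= t -> adapted_at F s Y -> Lone Y ->
  Lone (fun w => Y w * incr W s t w ^+ 2) /\
  Ex (fun w => Y w * incr W s t w ^+ 2) = Ex Y * (t - s).
Proof.
move=> s0 st aY LY; have [L E] := incr_variance s0 st.
have [? ->] := @incr_indep s t Y (fun x => x ^+ 2) s0 st aY LY
  (measurable_funX 2 (@measurable_id _ _ setT)) L.
by rewrite (_ : _ \o incr W s t = fun w => incr W s t w ^+ 2)// E.
Qed.

End WienerIncrements.

(** At [l = 1 / sqrt (t - s)] the exponential moment of the absolute increment is at most
    [2 e^(1/2)], whatever the interval; hence a constant that depends on [p] alone. *)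
Lemma incr_moment (R : realType) (p : R) :
  exists2 G : R, 0 < G &
  forall d (Omega : measurableType d) (P : probability Omega R)
    (F : R -> set (set Omega)) (W : R -> Omega -> R) (s t : R),
    usual_conditions P F -> wiener P F W -> 0 <= s -> s < t ->
    Lone P (fun w => (1 + `|incr W s t w| / Num.sqrt (t - s)) `^ p) /\
    Ex P (fun w => (1 + `|incr W s t w| / Num.sqrt (t - s)) `^ p) <= G.
Proof.
have [c c0 hc] := powR_1D_le_expR p.
exists (c * (2 * expR (1 / 2))); first by rewrite !mulr_gt0 ?expR_gt0.
move=> d Omega P F W s t hF hW s0 st.
have mI := incr_measurable hF hW s0 (ltW st).
pose q := Num.sqrt (t - s).
have q0 : 0 < q by rewrite sqrtr_gt0 subr_gt0.
have ts0 : 0 <= t - s by rewrite subr_ge0 ltW.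
have iq0 : 0 <= q^-1 by rewrite invr_ge0 ltW.
have [L E] := mgf_norm mI (incr_mgf hF hW s0 (ltW st)) iq0.
have le w : (1 + `|incr W s t w| / q) `^ p <= c * expR (q^-1 * `|incr W s t w|).
  by rewrite [q^-1 * _]mulrC; apply: hc; rewrite divr_ge0// ltW.
have L' : Lone P (fun w => (1 + `|incr W s t w| / q) `^ p).
  apply: Lone_le (LoneZ c L) _ => [|w]; last by rewrite ger0_norm ?powR_ge0.
  apply: (measurableT_comp (measurable_powR p)); apply: measurable_funD => //.
  by apply: measurable_funM => //; exact: measurableT_comp.
split=> //; apply: (le_trans (Ex_le L' (LoneZ c L) le)).
rewrite ExZ// ler_wpM2l ?(ltW c0)//; apply: (le_trans E).
by rewrite exprVn sqr_sqrtr// mulVf// gt_eqF// subr_gt0.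
Qed.

(** * Martingale transforms *)

Section MartingaleTransform.
Context {R : realType}.
Implicit Types (r T s t : R).

Lemma incr_abs_moment r : 0 <= r ->
  exists2 G : R, 0 < G &
  forall d (Omega : measurableType d) (P : probability Omega R)
    (F : R -> set (set Omega)) (W : R -> Omega -> R) (s t : R),
    usual_conditions P F -> wiener P F W -> 0 <= s -> s < t ->
    Lone P (fun w => `|incr W s t w| `^ r) /\
    Ex P (fun w => `|incr W s t w| `^ r) <= G * (t - s) `^ (r / 2).
Proof.
move=> r0; have [G G0 HG] := incr_moment r; exists G => // d Omega P F W s t hF hW s0 st.
have [L E] := HG _ _ P F W s t hF hW s0 st.
have ts0 : 0 < t - s by rewrite subr_gt0.
pose q := Num.sqrt (t - s); have q0 : 0 < q by rewrite sqrtr_gt0.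
have qr : q `^ r = (t - s) `^ (r / 2).
  by rewrite /q -powR12_sqrt ?(ltW ts0)// -powRrM mulrC.
have mI := incr_measurable hF hW s0 (ltW st).
have le w : `|incr W s t w| `^ r <= q `^ r * (1 + `|incr W s t w| / q) `^ r.
  have iq : 0 <= `|incr W s t w| / q by rewrite divr_ge0// ltW.
  rewrite -powRM ?addr_ge0 ?(ltW q0)// ler_powR2// mulrDr mulr1 mulrC divfK ?gt_eqF//.
  by rewrite lerDr ltW.
have LI : Lone P (fun w => `|incr W s t w| `^ r).
  apply: Lone_le (LoneZ (q `^ r) L) _ => [|w].
    exact: measurable_norm_powR.
  by rewrite ger0_norm ?powR_ge0.
split=> //; apply: (le_trans (Ex_le LI (LoneZ _ L) le)).
by rewrite ExZ// qr mulrC ler_wpM2r// powR_ge0.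
Qed.

(** In the second-order expansion of [|S + h Z|^r] the linear term has mean zero, the quadratic one
    has mean [E[|S|^(r-2) h^2] (t - s)], and the last one factors into [E|h|^r E|Z|^r], of order
    [(t - s)^(r/2)]. Since [r >= 2] and [t - s <= T], that power is at most a constant times
    [t - s], so the whole growth is linear in [t - s]. *)
Lemma martingale_step r T : 2 <= r -> 0 < T ->
  exists2 K : R, 0 < K &
  forall d (Omega : measurableType d) (P : probability Omega R)
    (F : R -> set (set Omega)) (W : R -> Omega -> R) (s t : R) (S h : Omega -> R),
    usual_conditions P F -> wiener P F W -> 0 <= s -> s < t -> t - s <= T ->
    adapted_at F s S -> adapted_at F s h ->
    Lone P (fun w => `|S w| `^ r) -> Lone P (fun w => `|h w| `^ r) ->
    let e := Ex P (fun w => `|S w| `^ r) in let b := Ex P (fun w => `|h w| `^ r) in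
    Lone P (fun w => `|S w + h w * incr W s t w| `^ r) /\
    Ex P (fun w => `|S w + h w * incr W s t w| `^ r) <= e + K * (t - s) * (e + b).
Proof.
move=> r2 T0; have r0 : 0 <= r by lra.
have [G G0 HG] := incr_abs_moment r0.
pose C := powR_add_cst r; have C0 : 0 <= C by exact: powR_add_cst_ge0.
have TG0 : 0 <= G * T `^ (r / 2 - 1) by rewrite mulr_ge0 ?powR_ge0// ltW.
exists (C * (1 + G * T `^ (r / 2 - 1)) + 1).
  by rewrite ltr_wpDl// mulr_ge0// addr_ge0.
move=> d Omega P F W s t S h hF hW s0 st tsT aS ah LS Lh e b.
have ts0 : 0 < t - s by rewrite subr_gt0.
have [LZ EZ] := HG _ _ P F W s t hF hW s0 st.
have mI := incr_measurable hF hW s0 (ltW st).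
have mS := adapted_measurable hF s0 aS.
have mh := adapted_measurable hF s0 ah.
pose Z := incr W s t.
pose A1 w := r * `|S w| `^ (r - 2) * S w * h w.
pose A2 w := `|S w| `^ (r - 2) * h w ^+ 2.
have aA1 : adapted_at F s A1.
  apply: measurable_funM => //; apply: measurable_funM => //.
  by apply: measurable_funM => //; exact: measurable_norm_powR.
have aA2 : adapted_at F s A2.
  by apply: measurable_funM; [exact: measurable_norm_powR|exact: measurable_funX].
have ah' : adapted_at F s (fun w => `|h w| `^ r) by exact: measurable_norm_powR.
have A2le w : A2 w <= `|S w| `^ r + `|h w| `^ r by exact: powR_split_le.
have A20 w : 0 <= A2 w by rewrite mulr_ge0 ?powR_ge0 ?sqr_ge0.
have LA2 : Lone P A2.
  apply: Lone_le (LoneD LS Lh) _ => [|w]; last by rewrite ger0_norm.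
  exact: (adapted_measurable hF s0 aA2).
have LA1 : Lone P A1.
  apply: Lone_le (LoneZ r (LoneD LS (LoneD LS Lh))) _ => [|w].
    exact: (adapted_measurable hF s0 aA1).
  rewrite /A1 !normrM (ger0_norm r0) (ger0_norm (powR_ge0 _ _)) -!mulrA ler_wpM2l//.
  apply: (@le_trans _ _ (`|S w| `^ r + A2 w)); last by rewrite lerD2l.
  rewrite (powR_split (normr_ge0 (S w)) r2) -mulrDr ler_wpM2l ?powR_ge0//.
  rewrite -(real_normK (num_real (h w))).
  have := sqr_ge0 (`|S w| - `|h w|); have := sqr_ge0 `|S w|; have := sqr_ge0 `|h w|.
  by rewrite sqrrB; lra.
have [L1 E1] := incr_orth hF hW s0 (ltW st) aA1 LA1.
have [L2 E2] := incr_sqr_indep hF hW s0 (ltW st) aA2 LA2.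
have mnr : measurable_fun setT (fun x : R => `|x| `^ r).
  exact: measurable_norm_powR.
have [L3 E3] := incr_indep hF hW s0 (ltW st) ah' Lh mnr LZ.
pose U w := `|S w| `^ r + A1 w * Z w + (C * (A2 w * Z w ^+ 2)
   + C * (`|h w| `^ r * `|Z w| `^ r)).
have LU : Lone P U.
  by apply: LoneD; [exact: LoneD|apply: LoneD; exact: LoneZ].
have le w : `|S w + h w * Z w| `^ r <= U w.
  apply: (le_trans (powR_norm_add_le (S w) (h w * Z w) r2)); rewrite /U /A1 /A2 -/C.
  rewrite normrM powRM// exprMn le_eqVlt; apply/orP; left; apply/eqP; ring.
have LSZ : Lone P (fun w => `|S w + h w * Z w| `^ r).
  apply: Lone_le LU _ => [|w]; last by rewrite ger0_norm ?powR_ge0.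
  by apply: measurable_norm_powR; apply: measurable_funD => //; exact: measurable_funM.
split=> //; apply: (le_trans (Ex_le LSZ LU le)).
rewrite /U ExD ?ExD ?ExZ ?E1 ?E2 ?E3//; [|exact: LoneZ|exact: LoneZ|exact: LoneD|].
  2: by apply: LoneD; exact: LoneZ.
have b0 : 0 <= b by apply: Ex_ge0 => w; exact: powR_ge0.
have e0 : 0 <= e by apply: Ex_ge0 => w; exact: powR_ge0.
have EA2 : Ex P A2 <= e + b.
  by apply: (le_trans (Ex_le LA2 (LoneD LS Lh) A2le)); rewrite ExD.
rewrite -/e -/b addr0 lerD2l.
have hp : (t - s) `^ (r / 2) <= (t - s) * T `^ (r / 2 - 1).
  rewrite -(@mulr_powRB1 _ (t - s) (r / 2)) ?(ltW ts0)//; last lra.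
  by rewrite ler_wpM2l ?(ltW ts0)// ler_powR2 ?(ltW ts0)//; lra.
have EZ' : Ex P (fun w => `|Z w| `^ r) <= G * T `^ (r / 2 - 1) * (t - s).
  by apply: (le_trans EZ); rewrite -mulrA ler_wpM2l ?(ltW G0)// [leRHS]mulrC.
have -> : (fun x : R => `|x| `^ r) \o incr W s t = fun w => `|Z w| `^ r by [].
set Y := Ex P _ in EZ' *.
set q := G * _ in EZ' TG0 *.
have h1 : C * (Ex P A2 * (t - s)) <= C * ((e + b) * (t - s)).
  by rewrite ler_wpM2l// ler_wpM2r// ltW.
have h2 : C * (b * Y) <= C * ((e + b) * (q * (t - s))).
  rewrite ler_wpM2l//; apply: (@le_trans _ _ (b * (q * (t - s)))).
    by rewrite ler_wpM2l.
  by rewrite ler_wpM2r ?lerDr// mulr_ge0// ltW.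
apply: (le_trans (lerD h1 h2)).
have : 0 <= (t - s) * (e + b) by exact: mulr_ge0 (ltW ts0) (addr_ge0 e0 b0).
lra.
Qed.

Definition mesh T (n i : nat) : R := i%:R * T / n%:R.

Lemma mesh0 T n : mesh T n 0 = 0.
Proof. by rewrite /mesh !mul0r. Qed.

Lemma mesh_ge0 T n i : 0 <= T -> 0 <= mesh T n i.
Proof. by move=> T0; rewrite /mesh divr_ge0 ?mulr_ge0. Qed.

Lemma mesh_last T n : (0 < n)%N -> mesh T n n = T.
Proof. by move=> n0; rewrite /mesh mulrAC divff ?mul1r// pnatr_eq0 -lt0n. Qed.

Lemma mesh_le T n i j : 0 <= T -> (i <= j)%N -> mesh T n i <= mesh T n j.
Proof.
by move=> T0 ij; rewrite /mesh ler_wpM2r ?invr_ge0// ler_wpM2r// ler_nat.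
Qed.

Lemma mesh_leT T n i : 0 <= T -> (0 < n)%N -> (i <= n)%N -> mesh T n i <= T.
Proof. by move=> T0 n0 /(mesh_le n T0); rewrite mesh_last. Qed.

Lemma meshS T n i : mesh T n i.+1 - mesh T n i = T / n%:R.
Proof. by rewrite /mesh -mulrBl -mulrBl -natr1 addrAC subrr add0r mul1r. Qed.

Lemma meshS_lt T n i : 0 < T -> (0 < n)%N -> mesh T n i < mesh T n i.+1.
Proof. by move=> T0 n0; rewrite -subr_gt0 meshS divr_gt0// ltr0n. Qed.

Definition transform (Omega : Type) (W : R -> Omega -> R) (T : R) (n : nat)
    (h : nat -> Omega -> R) (w : Omega) : R :=
  \sum_(i < n) h i w * incr W (mesh T n i) (mesh T n i.+1) w.

(** A discrete Gronwall argument: the partial moment plus [b] grows by a factor at most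
    [1 + K T / n] per step, and [(1 + K T / n)^n <= e^(K T)] is free of [n]. *)
Lemma martingale_transform_moment r T : 2 <= r -> 0 < T ->
  exists2 K : R, 0 < K &
  forall d (Omega : measurableType d) (P : probability Omega R)
    (F : R -> set (set Omega)) (W : R -> Omega -> R) (n : nat)
    (h : nat -> Omega -> R) (b : R),
    usual_conditions P F -> wiener P F W -> (0 < n)%N ->
    (forall i, (i < n)%N -> adapted_at F (mesh T n i) (h i)) ->
    (forall i, (i < n)%N -> Lone P (fun w => `|h i w| `^ r) /\
       Ex P (fun w => `|h i w| `^ r) <= b) ->
    [/\ measurable_fun setT (transform W T n h),
      Lone P (fun w => `|transform W T n h w| `^ r) &
      Ex P (fun w => `|transform W T n h w| `^ r) <= K * b].
Proof.
move=> r2 T0; have r0 : 0 < r by lra.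
have [K K0 HK] := martingale_step r2 T0; have T00 := ltW T0.
exists (expR (K * T)); first exact: expR_gt0.
move=> d Omega P F W n h b hF hW n0 ah Lh.
have b0 : 0 <= b.
  by have [_] := Lh 0%N n0; apply: le_trans; apply: Ex_ge0 => w; exact: powR_ge0.
pose D := T / n%:R; have D0 : 0 < D by rewrite divr_gt0 ?ltr0n.
have DT : D <= T by rewrite ler_pdivrMr ?ltr0n// ler_peMr// ler1n.
have key k : (k <= n)%N ->
    let S := fun w => \sum_(i < k) h i w * incr W (mesh T n i) (mesh T n i.+1) w in
    [/\ adapted_at F (mesh T n k) S, Lone P (fun w => `|S w| `^ r) &
      Ex P (fun w => `|S w| `^ r) + b <= (1 + K * D) ^+ k * b].
  elim: k => [_|k ih kn].
    have -> : (fun w => \sum_(i < 0) h i w * incr W (mesh T n i) (mesh T n i.+1) w)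
      = fun=> 0 by apply/funext => w; rewrite big_ord0.
    split; first exact: measurable_cst.
      exact: Lone_cst.
    by rewrite Ex_cst normr0 powR0 ?gt_eqF// expr0 mul1r add0r.
  have [aS LS ES] := ih (ltnW kn); have [Lk Ek] := Lh k kn.
  have m0 := mesh_ge0 n k T00; have ltk := meshS_lt k T0 n0.
  have e : (fun w => \sum_(i < k.+1) h i w * incr W (mesh T n i) (mesh T n i.+1) w)
    = fun w => (\sum_(i < k) h i w * incr W (mesh T n i) (mesh T n i.+1) w)
       + h k w * incr W (mesh T n k) (mesh T n k.+1) w.
    by apply/funext => w; rewrite big_ord_recr.
  have [L E] := HK _ _ P F W _ _ _ _ hF hW m0 ltk
    ltac:(by rewrite meshS) aS (ah k kn) LS Lk.
  rewrite e; split=> //.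
    apply: measurable_funD.
      exact: (adapted_le hF m0 (ltW ltk)).
    apply: measurable_funM; first exact: (adapted_le hF m0 (ltW ltk) (ah k kn)).
    exact: (incr_adapted hF hW m0 (ltW ltk)).
  apply: (le_trans (lerD E (lexx b))); rewrite meshS -/D.
  set x := Ex P _ in ES *; set y := Ex P _ in Ek *.
  have KD : 0 <= K * D by rewrite mulr_ge0// ltW.
  have h1 : K * D * (x + y) <= K * D * (x + b) by rewrite ler_wpM2l// lerD2l.
  have h2 : (1 + K * D) * (x + b) <= (1 + K * D) * ((1 + K * D) ^+ k * b).
    by rewrite ler_wpM2l// addr_ge0.
  rewrite exprS -[leRHS]mulrA; apply: le_trans h2; lra.
have [aS LS ES] := key n (leqnn n); split=> //.
  by apply: (adapted_measurable hF (mesh_ge0 n n T00)); exact: aS.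
apply: (@le_trans _ _ ((1 + K * D) ^+ n * b)).
  by apply: le_trans ES; rewrite lerDl.
rewrite ler_wpM2r//.
have -> : K * T = n%:R * (K * D).
  by rewrite /D mulrCA [n%:R * _]mulrC divfK// pnatr_eq0 -lt0n.
rewrite expRM_natl lerXn2r ?nnegrE ?expR_ge0 ?expR_ge1Dx//.
by rewrite addr_ge0// mulr_ge0// ltW.
Qed.

End MartingaleTransform.

(** * Ito isometry *)

Section ItoIsometry.
Context d (Omega : measurableType d) (R : realType) (P : probability Omega R).
Variables (F : R -> set (set Omega)) (W : R -> Omega -> R).
Hypotheses (hF : usual_conditions P F) (hW : wiener P F W).
Local Notation Lone := (Lone P).
Local Notation Ex := (Ex P).
Local Notation incr := (incr W).
Implicit Types (a b c e : R) (h k : Omega -> R).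

(** The length of the intersection of []a, b]] and []c, e]]. *)
Definition overlap (R' : realType) (a b c e : R') : R' :=
  Num.max 0 (Num.min b e - Num.max a c).

Lemma Lone_sqr_mul_incr a b h : 0 <= a -> a <= b -> adapted_at F a h ->
  Lone (fun w => h w ^+ 2) -> Lone (fun w => (h w * incr a b w) ^+ 2).
Proof.
move=> a0 ab ah Lh.
have ah2 : adapted_at F a (fun w => h w ^+ 2) by exact: measurable_funX.
have [L _] := incr_sqr_indep hF hW a0 ab ah2 Lh.
by under eq_fun do rewrite exprMn.
Qed.

(* Both increments are split at [c] and [min b e]: products of disjoint increments
   have mean zero, and only the common part contributes. *)
Let incr_inner_le a b c e h k : 0 <= a -> a <= b -> a <= c -> c <= e ->
  adapted_at F a h -> adapted_at F c k ->
  Lone (fun w => h w ^+ 2) -> Lone (fun w => k w ^+ 2) ->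
  Lone (fun w => h w * incr a b w * (k w * incr c e w)) /\
  Ex (fun w => h w * incr a b w * (k w * incr c e w)) =
    Ex (fun w => h w * k w) * overlap a b c e.
Proof.
move=> a0 ab ac ce ah ak Lh Lk.
have c0 : 0 <= c by exact: le_trans ac.
have mh := adapted_measurable hF a0 ah.
have mk := adapted_measurable hF c0 ak.
have past b' : a <= b' -> b' <= c ->
    Lone (fun w => h w * incr a b' w * k w * incr c e w) /\
    Ex (fun w => h w * incr a b' w * k w * incr c e w) = 0.
  move=> ab' b'c; apply: (incr_orth hF hW c0 ce).
    apply: measurable_funM => //; apply: measurable_funM.
      exact: (adapted_le hF a0 ac).
    apply: (adapted_le hF (le_trans a0 ab') b'c); exact: (incr_adapted hF hW).
  apply: Lone_mul_sqr => //; last exact: Lone_sqr_mul_incr.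
  by apply: measurable_funM => //; exact: (incr_measurable hF hW).
have [bc|/ltW cb] := leP b c.
  have [L E] := past b ab bc.
  have e1 : (fun w => h w * incr a b w * (k w * incr c e w)) =
    (fun w => h w * incr a b w * k w * incr c e w).
    by apply/funext => w; rewrite mulrA.
  rewrite e1 E; split=> //.
  rewrite /overlap (max_idPl _) ?mulr0// (max_idPr ac) subr_le0.
  by rewrite ge_min bc.
pose m := Num.min b e.
have cm : c <= m by rewrite le_min cb.
have mb : m <= b by rewrite ge_min lexx.
have me : m <= e by rewrite ge_min lexx orbT.
have m0 : 0 <= m := le_trans c0 cm.
have Lhk : Lone (fun w => h w * k w) by exact: Lone_mul_sqr.
have ahk : adapted_at F c (fun w => h w * k w).
  by apply: measurable_funM => //; exact: (adapted_le hF a0 ac).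
have [L1 E1] := past c ac (lexx c).
have [L2 E2] := incr_sqr_indep hF hW c0 cm ahk Lhk.
have [L3 _] := incr_orth hF hW c0 cm ahk Lhk.
have a3 : adapted_at F m (fun w => h w * k w * incr c m w).
  apply: measurable_funM; first exact: (adapted_le hF c0 cm).
  exact: (incr_adapted hF hW).
have [L4 E4] := incr_orth hF hW m0 mb a3 L3.
have [L5 E5] := incr_orth hF hW m0 me a3 L3.
(* [m] is [b] or [e], so one of the two leftover increments vanishes identically. *)
have z w : incr m b w * incr m e w = 0.
  rewrite /incr /m; case: (leP b e) => _; first by rewrite subrr mul0r.
  by rewrite subrr mulr0.
have e1 : (fun w => h w * incr a b w * (k w * incr c e w)) =
  (fun w => h w * incr a c w * k w * incr c e w + h w * k w * incr c m w ^+ 2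
    + (h w * k w * incr c m w * incr m b w + h w * k w * incr c m w * incr m e w)).
  apply/funext => w.
  have ib : incr a b w = incr a c w + incr c m w + incr m b w by rewrite /incr; ring.
  have ie : incr c e w = incr c m w + incr m e w by rewrite /incr; ring.
  have zz : h w * k w * (incr m b w * incr m e w) = 0 by rewrite z mulr0.
  rewrite ib ie; apply/eqP; rewrite -subr_eq0 -zz; apply/eqP; ring.
rewrite e1; split; first by apply: LoneD; exact: LoneD.
rewrite !ExD// ?E1 ?E2 ?E4 ?E5; try exact: LoneD.
by rewrite add0r !addr0 /overlap (max_idPr ac) (max_idPr _)// subr_ge0.
Qed.

Lemma incr_inner a b c e h k : 0 <= a -> a <= b -> 0 <= c -> c <= e ->
  adapted_at F a h -> adapted_at F c k ->
  Lone (fun w => h w ^+ 2) -> Lone (fun w => k w ^+ 2) ->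
  Lone (fun w => h w * incr a b w * (k w * incr c e w)) /\
  Ex (fun w => h w * incr a b w * (k w * incr c e w)) =
    Ex (fun w => h w * k w) * overlap a b c e.
Proof.
move=> a0 ab c0 ce ah ak Lh Lk; have [ac|/ltW ca] := leP a c.
  exact: incr_inner_le.
have [L E] := incr_inner_le c0 ce ca ab ak ah Lk Lh.
have e1 : (fun w => h w * incr a b w * (k w * incr c e w)) =
  (fun w => k w * incr c e w * (h w * incr a b w)).
  by apply/funext => w; rewrite mulrC.
rewrite e1 E; split=> //; congr (_ * _).
  by apply: eq_Ex => w; rewrite mulrC.
by rewrite /overlap [Num.min e b]minC [Num.max c a]maxC.
Qed.

(** The product of two indicators is the indicator of the intersection, which [a0] and [bT] keep
    inside [[0, T]]. *)
Lemma integral_step_sqr (T : R) (I : finType) (x a b : I -> R) :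
  (forall i, 0 <= a i) -> (forall i, b i <= T) ->
  (\int[lebesgue_measure]_(t in `[0%R, T])
     ((\sum_i x i * \1_(`]a i, b i]) t) ^+ 2)%:E =
   (\sum_i \sum_j x i * x j * overlap (a i) (b i) (a j) (b j))%:E)%E.
Proof.
move=> a0 bT.
pose A i j := `]Num.max (a i) (a j), Num.min (b i) (b j)]%classic.
have mA i j : measurable (A i j) by exact: measurable_itv.
transitivity (\int[lebesgue_measure]_(t in `[0%R, T])
   (\sum_i \sum_j (x i * x j)%:E * (\1_(A i j) t)%:E))%E.
  apply: eq_integral => t _; rewrite expr2 mulr_suml -sumEFin.
  apply: eq_bigr => i _; rewrite mulr_sumr -sumEFin; apply: eq_bigr => j _.
  rewrite -EFinM; congr EFin.
  have -> : \1_(A i j) t = \1_(`]a i, b i]) t * \1_(`]a j, b j]) t :> R.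
    rewrite !indicE /A !mem_setE !in_itv/= gt_max le_min.
    by case: (a i < t); case: (a j < t); case: (t <= b i); case: (t <= b j);
      rewrite ?(mul0r, mulr0, mul1r).
  ring.
have iA i j : lebesgue_measure.-integrable `[0%R, T]
    (fun t : R => ((x i * x j)%:E * (\1_(A i j) t)%:E)%E).
  apply: integrableZl => //; apply: (integrableS measurableT) => //.
  exact: integrable_indic_itv.
rewrite integral_sum//; last first.
  by move=> i; apply: integrable_sum => // j _; exact: iA.
rewrite -sumEFin; apply: eq_bigr => i _.
rewrite integral_sum//.
rewrite -sumEFin; apply: eq_bigr => j _.
rewrite integralZl//; last first.
  by apply: (integrableS measurableT) => //; exact: integrable_indic_itv.
rewrite integral_indic; [|exact: measurable_itv|exact: measurable_itv].
rewrite [RHS]EFinM; congr (_ * _)%E.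
rewrite (_ : _ `&` _ = A i j); last first.
  apply/seteqP; split=> [t []//|t At]; split=> //.
  move: At; rewrite /A /= !in_itv/= gt_max le_min => /andP[/andP[ht _] /andP[tb _]].
  by rewrite (ltW (le_lt_trans (a0 i) ht)) (le_trans tb (bT i)).
rewrite /A /= lebesgue_measure_itv/= lte_fin /overlap; case: ltP => h.
  by rewrite -EFinB [Num.max 0 _](max_idPr _)// subr_ge0 ltW.
by rewrite [Num.max 0 _](max_idPl _)// subr_le0.
Qed.

(** Both sides expand into the same double sum of [E[c_i c_j]] times overlaps. The intervals may
    overlap arbitrarily, which lets the lemma apply to differences of simple processes. *)
Lemma ito_isometry (T : R) (I : finType) (c : I -> Omega -> R) (a b : I -> R) :
  (forall i, [/\ 0 <= a i, a i <= b i & b i <= T]) ->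
  (forall i, adapted_at F (a i) (c i)) ->
  (forall i, Lone (fun w => c i w ^+ 2)) ->
  let S w := \sum_i c i w * incr (a i) (b i) w in
  Lone (fun w => S w ^+ 2) /\
  (\int[P]_w \int[lebesgue_measure]_(t in `[0%R, T])
     ((\sum_i c i w * \1_(`]a i, b i]) t) ^+ 2)%:E =
   (Ex (fun w => S w ^+ 2))%:E)%E.
Proof.
move=> hab ac Lc S.
have a0 i : 0 <= a i by case: (hab i).
have ab i : a i <= b i by case: (hab i).
have bT i : b i <= T by case: (hab i).
have mc i : measurable_fun setT (c i) := adapted_measurable hF (a0 i) (ac i).
have In i j := incr_inner (a0 i) (ab i) (a0 j) (ab j) (ac i) (ac j) (Lc i) (Lc j).
have eS : (fun w => S w ^+ 2) = fun w =>
  \sum_i \sum_j c i w * incr (a i) (b i) w * (c j w * incr (a j) (b j) w).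
  apply/funext => w; rewrite expr2 /S mulr_suml; apply: eq_bigr => i _.
  by rewrite mulr_sumr.
rewrite eS; split.
  by apply: Lone_sum => i; apply: Lone_sum => j; exact: (In i j).1.
under eq_integral do rewrite integral_step_sqr//.
have Lcc i j : Lone (fun w => c i w * c j w) by exact: Lone_mul_sqr.
have Lo i j : Lone (fun w => c i w * c j w * overlap (a i) (b i) (a j) (b j)).
  by under eq_fun do rewrite mulrC; exact: LoneZ.
rewrite Ex_integral; last first.
  by apply: Lone_sum => i; apply: Lone_sum => j; exact: Lo.
congr EFin; rewrite !Ex_sum//; first last.
- by move=> i; apply: Lone_sum => j; exact: Lo.
- by move=> i; apply: Lone_sum => j; exact: (In i j).1.
apply: eq_bigr => i _; rewrite !Ex_sum//; last by move=> j; exact: (In i j).1.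
apply: eq_bigr => j _; rewrite (In i j).2 [RHS]mulrC -ExZ//.
by apply: eq_Ex => w; rewrite mulrC.
Qed.

End ItoIsometry.

(** * Norms and moments *)

Section LnormMoments.
Context d (Omega : measurableType d) (R : realType) (P : probability Omega R).
Implicit Types (f g : Omega -> R) (c p : R).

Lemma lee_poweR2 (x y : \bar R) p : 0 <= p -> (0 <= x)%E -> (x <= y)%E ->
  (x `^ p <= y `^ p)%E.
Proof.
move=> p0 x0 xy; apply: (gt0_ler_poweR p0) => //.
  by rewrite in_itv/= x0 leey.
by rewrite in_itv/= (le_trans x0 xy) leey.
Qed.

(** The integral of a nonnegative function is a supremum over the simple functions below it, so it
    is monotone for arbitrary functions. The supremum [sup_abs] and the errors of the noisy
    algorithm are compared in this way. *)
Lemma le_integral_any (f g : Omega -> \bar R) : (forall x, 0 <= f x)%E ->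
  (forall x, f x <= g x)%E -> (\int[P]_x f x <= \int[P]_x g x)%E.
Proof.
move=> f0 fg; rewrite !ge0_integralTE//; last by move=> x; exact: le_trans (fg x).
apply: le_ereal_sup => _ [h hf <-]; exists h => // x.
exact: le_trans (hf x) (fg x).
Qed.

Lemma Lnorm_le_integral (f : Omega -> \bar R) c p : 0 < p -> 0 <= c ->
  ('N[P]_(p%:E)[f] <= c%:E)%E <-> (\int[P]_x (`|f x| `^ p) <= (c `^ p)%:E)%E.
Proof.
move=> p0 c0; rewrite -powR_Lnorm ?gt_eqF// -poweR_EFin; split=> h.
  by apply: lee_poweR2 (ltW p0) (Lnorm_ge0 _ _ _) h.
have ip0 : 0 <= p^-1 by rewrite invr_ge0 ltW.
have := lee_poweR2 ip0 (poweR_ge0 _ _) h.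
by rewrite -!poweRrM divff ?gt_eqF// !poweRe1// Lnorm_ge0.
Qed.

Lemma Lnorm_moment f c p : 0 < p -> 0 <= c -> measurable_fun setT f ->
  ('N[P]_(p%:E)[EFin \o f] <= c%:E)%E ->
  Lone P (fun w => `|f w| `^ p) /\ Ex P (fun w => `|f w| `^ p) <= c `^ p.
Proof.
move=> p0 c0 mf /(Lnorm_le_integral _ p0 c0) h; apply: Lone_integral_le => //.
exact: measurable_norm_powR.
Qed.

(** The dominating [g] carries the integrability, so the bound reaches an error [f] known only
    through a pointwise estimate. *)
Lemma moment_Lnorm f g c p : 0 < p -> 0 <= c -> Lone P (fun w => `|g w| `^ p) ->
  Ex P (fun w => `|g w| `^ p) <= c `^ p -> (forall w, `|f w| <= `|g w|) ->
  ('N[P]_(p%:E)[EFin \o f] <= c%:E)%E.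
Proof.
move=> p0 c0 Lg Eg fg; apply/(Lnorm_le_integral _ p0 c0).
apply: (@le_trans _ _ (\int[P]_x (`|g x| `^ p)%:E)%E); last first.
  by rewrite Ex_integral// lee_fin.
apply: le_integral_any => w /=; first by rewrite lee_fin powR_ge0.
by rewrite lee_fin ler_powR2// ltW.
Qed.

End LnormMoments.

(** * The class of integrands *)

Section IntegrandClass.
Context d (Omega : measurableType d) (R : realType) (P : probability Omega R).
Variables (F : R -> set (set Omega)) (T rho r q L : R) (X : R -> Omega -> R).
Hypotheses (hF : usual_conditions P F) (T0 : 0 < T) (r2 : 2 <= r) (rq : r <= q).
Hypotheses (L0 : 0 <= L) (hX : integrand_class T P F rho r q L X).
Implicit Types t z p : R.

Lemma integrand_adapted t : 0 <= t <= T -> adapted_at F t (X t).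
Proof.
move=> tT; have [pX _ _] := hX; have /andP[t0 _] := tT.
pose GT := g_sigma_algebraType (F t).
have mI : measurable (`[0, t]%classic : set R) by exact: measurable_itv.
have := measurable_comp (F := `[0, t]%classic `*` (setT : set GT))
  (measurableX mI measurableT) _ (pX t tT) (pair1_measurable (T2 := GT) t).
by apply=> _ [w _ <-]; split=> //=; rewrite in_itv/= t0 lexx.
Qed.

Lemma integrand_measurable t : 0 <= t <= T -> measurable_fun setT (X t).
Proof.
move=> tT; have /andP[t0 _] := tT.
exact: (adapted_measurable hF t0 (integrand_adapted tT)).
Qed.

(** Progressive measurability at time [T], with [F T] enlarged to the full sigma-algebra; Tonelli's
    theorem is applied to [X] in this form. *)
Lemma integrand_joint :
  measurable_fun (`[0, T] `*` setT) (fun z : R * Omega => X z.1 z.2).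
Proof.
have [pX _ _] := hX; have [_ [sF sm _] _ _] := hF.
have TT : 0 <= T <= T by rewrite ltW/=.
pose GT := g_sigma_algebraType (F T).
have mid : measurable_fun setT (fun z : R * Omega => (z.1, z.2) : R * GT).
  apply: measurable_fun_pair => //; move=> _ B mB; rewrite setTI.
  rewrite (_ : snd @^-1` B = setT `*` B); last first.
    by apply/seteqP; split=> [z|z []].
  apply: measurableX => //; apply: (sm T (ltW T0)).
  by move: mB; rewrite /measurable/= sigma_algebra_id//; exact: (sF T (ltW T0)).
have mI : measurable (`[0, T]%classic : set R) by exact: measurable_itv.
have := measurable_comp (F := `[0, T]%classic `*` (setT : set GT))
  (measurableX mI measurableT) _ (pX T TT) (measurable_funTS mid).
apply=> _ [[t w] [/= tT _] <-]; split=> //.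
Qed.

Lemma integrand_moment_q t : 0 <= t <= T ->
  Lone P (fun w => `|X t w| `^ q) /\ Ex P (fun w => `|X t w| `^ q) <= L `^ q.
Proof.
move=> tT; have [_ hsup _] := hX; have q0 : 0 < q by exact: lt_le_trans (lt_le_trans (ltr0n R 2) r2) rq.
apply: Lnorm_moment => //; first exact: integrand_measurable.
apply/(Lnorm_le_integral P _ q0 L0).
move/(Lnorm_le_integral P _ q0 L0) : hsup; apply: le_trans.
apply: le_integral_any => w; first by rewrite poweR_ge0.
have s0 : (0 <= `|sup_abs T X w|)%E by [].
apply: lee_poweR2; [exact: ltW|by []|].
apply: le_trans (lee_abs _); apply: ereal_sup_ubound => /=.
by exists t => //=; rewrite in_itv.
Qed.

Lemma integrand_moment p t : 0 <= p -> p <= q -> 0 <= t <= T ->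
  Lone P (fun w => `|X t w| `^ p) /\ Ex P (fun w => `|X t w| `^ p) <= 1 + L `^ q.
Proof.
move=> p0 pq tT; have [Lq Eq] := integrand_moment_q tT.
have mX := integrand_measurable tT.
have Lp : Lone P (fun w => `|X t w| `^ p) by exact: (Lone_powR_le mX p0 pq Lq).
split=> //; apply: (@le_trans _ _ (Ex P (fun w => 1 + `|X t w| `^ q))).
  apply: Ex_le => //; first by apply: LoneD => //; exact: Lone_cst.
  by move=> w; exact: powR_le_1D.
by rewrite ExD// ?Ex_cst ?lerD2l//; exact: Lone_cst.
Qed.

Lemma integrand_holder t z : 0 <= t <= T -> 0 <= z <= T ->
  Lone P (fun w => `|X t w - X z w| `^ r) /\
  Ex P (fun w => `|X t w - X z w| `^ r) <= (L * `|t - z| `^ rho) `^ r.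
Proof.
move=> tT zT; have [_ _ hh] := hX.
apply: (Lnorm_moment (f := fun w => X t w - X z w)); [exact: lt_le_trans r2| | |exact: hh].
  by rewrite mulr_ge0 ?powR_ge0.
by apply: measurable_funB; exact: integrand_measurable.
Qed.

End IntegrandClass.

(** * Passing moments to limits and to smaller exponents *)

Section FatouMoments.
Context d (Omega : measurableType d) (R : realType) (P : probability Omega R).

(** Away from 0 the power is differentiable, hence continuous; at the limit 0 the threshold
    [e^(1/p)] is used directly. *)
Lemma cvg_norm_powR (u : R^nat) (x p : R) : 0 < p -> u @ \oo --> x ->
  (fun n => `|u n| `^ p) @ \oo --> `|x| `^ p.
Proof.
move=> p0 ux; have nux : (fun n => `|u n|) @ \oo --> `|x| by exact: cvg_norm.
have [x0|x0] := eqVneq x 0; last first.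
  have xn0 : 0 < `|x| by rewrite normr_gt0.
  have cp : {for `|x|, continuous (fun y : R => y `^ p)}.
    apply: differentiable_continuous; apply/derivable1_diffP.
    by have [] := is_derive1_powR p xn0.
  exact: (@cvg_comp _ _ _ (fun n => `|u n|) (fun y => y `^ p) _ _ _ nux cp).
rewrite x0 normr0 powR0 ?gt_eqF//; apply/cvgrPdist_le => e e0.
rewrite x0 in ux; move/cvgrPdist_le : ux => /(_ (e `^ p^-1) (powR_gt0 _ e0)).
apply: filterS => n; rewrite !sub0r !normrN => h.
rewrite ger0_norm ?powR_ge0//; apply: (le_trans (ler_powR2 (ltW p0) _ h)) => //.
by rewrite -powRrM mulVf ?gt_eqF// powRr1// ltW.
Qed.

Lemma limn_einf_le (u : (\bar R)^nat) (c : \bar R) : (forall n, u n <= c)%E ->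
  (limn_einf u <= c)%E.
Proof.
move=> uc; rewrite limn_einf_lim; apply: lime_le; first exact: is_cvg_einfs.
apply: nearW => n; apply: le_trans (uc n).
by apply: ereal_inf_lbound; exists n => /=.
Qed.

Lemma fatou_moment (f : nat -> Omega -> R) (g : Omega -> R) (p c : R) : 0 < p ->
  (forall n, measurable_fun setT (f n)) -> measurable_fun setT g ->
  {ae P, forall w, f ^~ w @ \oo --> g w} ->
  (forall n, Lone P (fun w => `|f n w| `^ p) /\ Ex P (fun w => `|f n w| `^ p) <= c) ->
  Lone P (fun w => `|g w| `^ p) /\ Ex P (fun w => `|g w| `^ p) <= c.
Proof.
move=> p0 mf mg fg fc; apply: Lone_integral_le.
- exact: measurable_norm_powR.
- by move=> w; exact: powR_ge0.
pose h n w := (`|f n w| `^ p)%:E.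
have mh n : measurable_fun setT (h n).
  by apply/measurable_EFinP; exact: measurable_norm_powR.
have h0 n w : setT w -> (0 <= h n w)%E by rewrite lee_fin powR_ge0.
apply: (@le_trans _ _ (\int[P]_w limn_einf (h ^~ w))%E).
  apply: ae_ge0_le_integral => //.
  - by apply/measurable_EFinP; exact: measurable_norm_powR.
  - move=> w _; rewrite limn_einf_lim; apply: lime_ge; first exact: is_cvg_einfs.
    by apply: nearW => n; apply: le_ereal_inf_tmp => _ [k _ <-]; exact: h0.
  - rewrite (_ : (fun w => _) = fun w => (- limn_esup ((fun n w => - h n w) ^~ w))%E).
      apply: measurableT_comp => //; apply: measurable_fun_limn_esup => n.
      exact: measurableT_comp.
    by apply/funext => w; rewrite -[LHS]oppeK -limn_esupN.
  apply: filterS fg => w fgw _.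
  have hc : (fun n => (`|f n w| `^ p)%:E) @ \oo --> (`|g w| `^ p)%:E.
    by apply: cvg_EFin; [exact: nearW|exact: cvg_norm_powR].
  by rewrite (cvg_limn_einf_sup hc).1.
apply: (le_trans (fatou P measurableT mh h0)); apply: limn_einf_le => n.
by have [L E] := fc n; rewrite Ex_integral// lee_fin.
Qed.

(** Integrating [powR_le_scaled] at the scale [e] keeps the order [e^p] for a smaller exponent. The
    exponent 1 serves almost sure convergence, the exponent 2 the Ito integral. *)
Lemma scaled_moment (f : Omega -> R) (p r e K : R) : 0 < e -> 0 <= p -> p <= r ->
  measurable_fun setT f -> Lone P (fun w => `|f w| `^ r) ->
  Ex P (fun w => `|f w| `^ r) <= K * e `^ r ->
  Lone P (fun w => `|f w| `^ p) /\ Ex P (fun w => `|f w| `^ p) <= (1 + K) * e `^ p.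
Proof.
move=> e0 p0 pr mf Lr Er.
have Lp : Lone P (fun w => `|f w| `^ p) by exact: Lone_powR_le pr Lr.
have L' : Lone P (fun w => e `^ p + e `^ (p - r) * `|f w| `^ r).
  by apply: LoneD; [exact: Lone_cst|exact: LoneZ].
split=> //; apply: (@le_trans _ _ (Ex P (fun w => e `^ p + e `^ (p - r) * `|f w| `^ r))).
  by apply: Ex_le => // w; exact: powR_le_scaled.
rewrite ExD ?Ex_cst ?ExZ//; [|exact: Lone_cst|exact: LoneZ].
rewrite mulrDl mul1r lerD2l; apply: (le_trans (ler_wpM2l (powR_ge0 _ _) Er)).
rewrite mulrCA -powRD; last by rewrite (gt_eqF e0) implybT.
by rewrite subrK.
Qed.

Lemma ae_eq_moment (f g : Omega -> R) (p c : R) : measurable_fun setT f ->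
  measurable_fun setT g -> {ae P, forall w, f w = g w} ->
  Lone P (fun w => `|g w| `^ p) -> Ex P (fun w => `|g w| `^ p) <= c ->
  Lone P (fun w => `|f w| `^ p) /\ Ex P (fun w => `|f w| `^ p) <= c.
Proof.
move=> mf mg fg Lg Eg; apply: Lone_integral_le.
- exact: measurable_norm_powR.
- by move=> w; exact: powR_ge0.
rewrite (_ : integral _ _ _ = \int[P]_w (`|g w| `^ p)%:E)%E.
  by rewrite Ex_integral// lee_fin.
apply: ge0_ae_eq_integral => //.
- by apply/measurable_EFinP; exact: measurable_norm_powR.
- by apply/measurable_EFinP; exact: measurable_norm_powR.
- by apply: filterS fg => w -> _.
Qed.

Lemma geometric_nneseries (c x : R) : 0 <= c -> 0 <= x -> x < 1 ->
  (\sum_(0 <= j <oo) (c * x ^+ j)%:E < +oo)%E.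
Proof.
move=> c0 x0 x1; apply: (@le_lt_trans _ _ (c / (1 - x))%:E); last exact: ltry.
apply: lime_le.
  by apply: is_cvg_nneseries => n _ _; rewrite lee_fin mulr_ge0// exprn_ge0.
apply: nearW => n; rewrite sumEFin lee_fin -mulr_sumr ler_wpM2l//.
have x10 : 0 < 1 - x by rewrite subr_gt0.
rewrite -[leRHS]mul1r ler_pdivlMr// mulrC big_mkord -opprB mulNr -subrX1 opprB.
by rewrite gerBl exprn_ge0.
Qed.

End FatouMoments.

(** * Mean square distance of processes *)

Section MeanSquareDistance.
Context d (Omega : measurableType d) (R : realType) (P : probability Omega R).
Variables (T : R).
Implicit Types (Y Z : R -> Omega -> R) (c t : R).

Definition jointly_measurable Y :=
  measurable_fun (`[0, T] `*` setT) (fun z : R * Omega => Y z.1 z.2).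

Definition mean_sqr Y : \bar R :=
  (\int[P]_w \int[lebesgue_measure]_(t in `[0%R, T]) ((Y t w) ^+ 2)%:E)%E.

(** Extended by zero to the full product space, where Tonelli's theorem applies in both orders. *)
Let restricted Y (z : Omega * measurableTypeR R) : \bar R :=
  ((fun z : Omega * measurableTypeR R => ((Y z.2 z.1) ^+ 2)%:E)
     \_ (setT `*` `[0, T]%classic)) z.

Let restricted_ge0 Y z : (0 <= restricted Y z)%E.
Proof.
by rewrite /restricted/= erestrict_ge0// => x _; rewrite lee_fin sqr_ge0.
Qed.

Let restricted_measurable Y : jointly_measurable Y ->
  measurable_fun setT (restricted Y).
Proof.
move=> mY; apply/(measurable_restrictT _ _).1; first exact: measurableX.
apply/measurable_EFinP; apply: measurable_funX.
pose sw (z : Omega * measurableTypeR R) : R * Omega := (z.2, z.1).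
have msw : measurable_fun setT sw.
  by apply: measurable_fun_pair; [exact: measurable_snd|exact: measurable_fst].
have mS : measurable (`[0, T] `*` setT : set (R * Omega)).
  by apply: measurableX => //; exact: measurable_itv.
have := measurable_comp mS _ mY (measurable_funTS (D := setT `*` `[0, T]%classic) msw).
by apply=> _ [[w t] [_ /= tT] <-]; split.
Qed.

Let inner Y w :
  (\int[lebesgue_measure]_(t in `[0%R, T]) ((Y t w) ^+ 2)%:E =
   \int[lebesgue_measure]_t restricted Y (w, t))%E.
Proof.
rewrite integral_mkcond; apply: eq_integral => t _; rewrite /restricted !patchE.
have -> : ((w, t) \in setT `*` `[0, T]%classic) = (t \in `[0, T]%classic).
  by apply/idP/idP => /set_mem h; apply/mem_set; [case: h|].
by [].
Qed.

Let mean_sqrE Y : jointly_measurable Y ->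
  (mean_sqr Y = \int[P \x lebesgue_measure]_z restricted Y z)%E.
Proof.
move=> mY; rewrite fubini_tonelli1//; last exact: restricted_measurable.
by apply: eq_integral => w _; rewrite inner.
Qed.

Lemma mean_sqrD_le Y Z : jointly_measurable Y -> jointly_measurable Z ->
  (mean_sqr (fun t w => (Y t w + Z t w)%R) <= 2%:E * (mean_sqr Y + mean_sqr Z))%E.
Proof.
move=> mY mZ.
have mYZ : jointly_measurable (fun t w => Y t w + Z t w).
  exact: measurable_funD.
have mrY := restricted_measurable mY; have mrZ := restricted_measurable mZ.
rewrite !mean_sqrE// -ge0_integralD// -ge0_integralZl//; last 2 first.
- exact: emeasurable_funD.
- by move=> z _; exact: adde_ge0.
apply: ge0_le_integral => //.
- exact: restricted_measurable.
- by apply: emeasurable_funM => //; exact: emeasurable_funD.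
move=> z _; rewrite /restricted !patchE; case: ifPn => _; last by rewrite adde0 mule0.
rewrite -EFinD -EFinM lee_fin.
have := sqr_ge0 (Y z.2 z.1 - Z z.2 z.1); rewrite sqrrB sqrrD; lra.
Qed.

(** After exchanging the integrals only almost every time counts. Time 0 is left out because simple
    processes live on intervals open on the left and vanish there. *)
Lemma mean_sqr_le Y c : 0 <= T -> 0 <= c -> jointly_measurable Y ->
  (forall t, 0 < t -> t <= T -> (\int[P]_w ((Y t w) ^+ 2)%:E <= c%:E)%E) ->
  (mean_sqr Y <= (c * T)%:E)%E.
Proof.
move=> T0 c0 mY hY; rewrite mean_sqrE//.
rewrite fubini_tonelli2//; last exact: restricted_measurable.
have mG := measurable_fun_fubini_tonelli_G (m1 := P) (restricted Y) (restricted_measurable mY)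
  (restricted_ge0 Y).
apply: (@le_trans _ _ (\int[lebesgue_measure]_(t in `]0%R, T]) c%:E)%E); last first.
  rewrite integral_cst//= lebesgue_measure_itv/= lte_fin; case: ifPn => _.
    by rewrite -EFinB subr0.
  by rewrite mule0 lee_fin mulr_ge0.
rewrite [leLHS](_ : _ = \int[lebesgue_measure]_(t in `]0%R, T])
    \int[P]_w restricted Y (w, t))%E; last first.
  rewrite (integral_itv_obnd_cbnd (r := 0%R)); last exact: measurable_funTS.
  rewrite [RHS]integral_mkcond; apply: eq_integral => t _; rewrite patchE.
  case: ifPn => // tT; apply: integral0_eq => w _; rewrite /restricted patchE.
  case: ifPn => // /set_mem[_ /= h].
  by move: tT; rewrite notin_setE.
apply: ge0_le_integral => //.
- by move=> t _; apply: integral_ge0.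
- exact: measurable_funTS.
move=> t; rewrite /= in_itv/= => /andP[t0 tT].
apply: le_trans (hY t t0 tT); rewrite le_eqVlt; apply/orP; left; apply/eqP.
apply: eq_integral => w _; rewrite /restricted patchE ifT//.
by apply/mem_set; split=> //=; rewrite in_itv/= (ltW t0).
Qed.

End MeanSquareDistance.

(** * Simple processes *)

Section SimpleProcesses.
Context d (Omega : measurableType d) (R : realType) (P : probability Omega R).
Variables (F : R -> set (set Omega)) (W : R -> Omega -> R) (T : R).
Hypotheses (hF : usual_conditions P F) (hW : wiener P F W).
Implicit Types H : simple_process R Omega.

Lemma sp_knot_itv H i : sp_admissible P F T H -> (i < sp_size H)%N ->
  [/\ 0 <= sp_knot H i, sp_knot H i <= sp_knot H i.+1 & sp_knot H i.+1 <= T].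
Proof.
move=> [h0 hm hT _ _] ni.
have mono m n : (m <= n)%N -> (n <= sp_size H)%N -> sp_knot H m <= sp_knot H n.
  elim: n => [|n ih]; first by rewrite leqn0 => /eqP->.
  rewrite leq_eqVlt => /predU1P[->//|mn] nH.
  by apply: (le_trans (ih mn (ltnW nH))); exact: hm.
split; first by apply: (le_trans h0); apply: mono => //; exact: ltnW.
  exact: hm.
by apply: le_trans hT; exact: mono.
Qed.

Lemma sp_coef_sqr H i : sp_admissible P F T H -> (i < sp_size H)%N ->
  Lone P (fun w => sp_coef H i w ^+ 2).
Proof.
move=> aH ni; have [k0 _ _] := sp_knot_itv aH ni; have [_ _ _ ac N2] := aH.
have mc := adapted_measurable hF k0 (ac i ni).
have /= fin := N2 i ni.
have N0 : (0 <= 'N[P]_(2%:E)[EFin \o sp_coef H i])%E by exact: Lnorm_ge0.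
have [l _] := @Lnorm_moment _ _ _ P (sp_coef H i)
  (fine 'N[P]_(2%:E)[EFin \o sp_coef H i]) 2 (ltr0n R 2) (fine_ge0 N0) mc
  ltac:(by rewrite fineK// ge0_fin_numE).
rewrite (_ : (fun w => _) = fun w => `|sp_coef H i w| `^ 2)//; apply/funext => w.
by rewrite powR_mulrn// real_normK// num_real.
Qed.

Lemma sp_val_jointly_measurable H : sp_admissible P F T H ->
  jointly_measurable T (sp_val H).
Proof.
move=> aH; apply: (measurable_funS measurableT) => //.
apply: measurable_sum => i; have [k0 _ _] := sp_knot_itv aH (ltn_ord i).
have [_ _ _ ac _] := aH.
apply: measurable_funM.
  apply: measurableT_comp; last exact: measurable_snd.
  exact: (adapted_measurable hF k0 (ac i _)).
have mi : measurable_fun setT (\1_(`]sp_knot H i, sp_knot H i.+1]) : R -> R).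
  by apply: measurable_indic; exact: measurable_itv.
exact: (measurableT_comp mi measurable_fst).
Qed.

(** The difference is a single sum over the disjoint union of the two index sets, with the
    coefficients of [H2] negated; no common refinement of the knots is formed. *)
Lemma sp_integral_isometry H1 H2 : sp_admissible P F T H1 -> sp_admissible P F T H2 ->
  Lone P (fun w => (sp_integral W H1 w - sp_integral W H2 w) ^+ 2) /\
  mean_sqr P T (fun t w => sp_val H1 t w - sp_val H2 t w) =
  (Ex P (fun w => (sp_integral W H1 w - sp_integral W H2 w) ^+ 2))%:E.
Proof.
move=> a1 a2; pose I := ('I_(sp_size H1) + 'I_(sp_size H2))%type.
pose c (i : I) (w : Omega) : R :=
  match i with inl i => sp_coef H1 i w | inr j => - sp_coef H2 j w end.
pose a (i : I) : R := match i with inl i => sp_knot H1 i | inr j => sp_knot H2 j end.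
pose b (i : I) : R :=
  match i with inl i => sp_knot H1 i.+1 | inr j => sp_knot H2 j.+1 end.
have hab i : [/\ 0 <= a i, a i <= b i & b i <= T].
  by case: i => i; exact: sp_knot_itv.
have ac i : adapted_at F (a i) (c i).
  case: i => i /=; first by case: a1 => _ _ _ + _; exact.
  by apply: measurableT_comp => //; case: a2 => _ _ _ + _; exact.
have Lc i : Lone P (fun w => c i w ^+ 2).
  case: i => i /=; first exact: sp_coef_sqr.
  by under eq_fun do rewrite sqrrN; exact: sp_coef_sqr.
have [L E] := ito_isometry hF hW hab ac Lc.
have e w : \sum_i c i w * incr W (a i) (b i) w =
    sp_integral W H1 w - sp_integral W H2 w.
  rewrite big_sumType/=; congr (_ + _).
  by rewrite /sp_integral -sumrN; apply: eq_bigr => j _; rewrite mulNr.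
have eL : (fun w => (\sum_i c i w * incr W (a i) (b i) w) ^+ 2) =
    fun w => (sp_integral W H1 w - sp_integral W H2 w) ^+ 2.
  by apply/funext => w; rewrite e.
rewrite -eL; split=> //; rewrite -E /mean_sqr.
apply: eq_integral => w _; apply: eq_integral => t _; congr ((_ ^+ 2)%:E).
rewrite big_sumType/=; congr (_ + _).
by rewrite /sp_val -sumrN; apply: eq_bigr => j _; rewrite mulNr.
Qed.

End SimpleProcesses.

(** * The Ito integral as a limit of Riemann sums *)

Section Refinement.
Context {R : realType}.
Implicit Types T : R.

(** On each block of [k] consecutive indices the factor [g] is constant and the increments of [v]
    telescope. *)
Lemma telescope_blocks (g v : nat -> R) k m : (0 < k)%N ->
  \sum_(j < m * k) g (j %/ k)%N * (v j.+1 - v j) =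
  \sum_(i < m) g i * (v (i.+1 * k)%N - v (i * k)%N).
Proof.
move=> k0; elim: m => [|m ih]; first by rewrite mul0n !big_ord0.
rewrite big_ord_recr/= -ih -!(big_mkord xpredT (fun j => g (j %/ k)%N * (v j.+1 - v j))).
rewrite mulSn addnC (big_cat_nat (n := (m * k)%N)) ?leq_addr//=; congr (_ + _).
rewrite -(telescope_sumr v (leq_addr k (m * k)%N)) mulr_sumr.
apply: eq_big_nat => j /andP[mj jm]; congr (g _ * _).
by rewrite -(subnKC mj) divnMDl// divn_small ?addn0// ltn_subLR.
Qed.

Lemma mesh_mul T n k i : (0 < k)%N -> mesh T (n * k) (i * k) = mesh T n i.
Proof.
move=> k0; rewrite /mesh; have [->|n0] := eqVneq n 0%N.
  by rewrite mul0n !invr0 !mulr0.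
have kN0 : k%:R != 0 :> R by rewrite pnatr_eq0 -lt0n.
have nN0 : n%:R != 0 :> R by rewrite pnatr_eq0.
by rewrite !natrM; field; rewrite kN0 nN0.
Qed.

(** Freezing the coefficient on each coarse cell leaves the sum unchanged, so the difference of two
    nested Riemann sums becomes one transform on the finer mesh. *)
Lemma transform_refine (Omega : Type) (W : R -> Omega -> R) T n k
    (h : nat -> Omega -> R) w : (0 < k)%N ->
  transform W T n h w = transform W T (n * k) (fun j => h (j %/ k)%N) w.
Proof.
move=> k0; rewrite /transform.
rewrite (telescope_blocks (fun i => h i w) (fun j => W (mesh T (n * k) j) w))//.
by apply: eq_bigr => i _; rewrite /incr !mesh_mul.
Qed.

Lemma transformB (Omega : Type) (W : R -> Omega -> R) T n
    (h k : nat -> Omega -> R) w :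
  transform W T n h w - transform W T n k w =
  transform W T n (fun i w => h i w - k i w) w.
Proof. by rewrite /transform -sumrB; apply: eq_bigr => i _; rewrite mulrBl. Qed.

End Refinement.

Section ItoConstruction.
Context d (Omega : measurableType d) (R : realType) (P : probability Omega R).
Variables (F : R -> set (set Omega)) (W : R -> Omega -> R).
Variables (T rho r q L K : R) (X : R -> Omega -> R).
Hypotheses (hF : usual_conditions P F) (hW : wiener P F W).
Hypotheses (T0 : 0 < T) (rho0 : 0 < rho) (r2 : 2 <= r) (rq : r <= q).
Hypotheses (L0 : 0 <= L) (hX : integrand_class T P F rho r q L X).
Implicit Types t z : R.
Hypothesis K0 : 0 < K.
(** The moment bound is assumed with a given [K], which keeps that constant chosen before the
    probability space. *)
Hypothesis HK : forall n (h : nat -> Omega -> R) (b : R), (0 < n)%N ->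
  (forall i, (i < n)%N -> adapted_at F (mesh T n i) (h i)) ->
  (forall i, (i < n)%N -> Lone P (fun w => `|h i w| `^ r) /\
     Ex P (fun w => `|h i w| `^ r) <= b) ->
  [/\ measurable_fun setT (transform W T n h),
    Lone P (fun w => `|transform W T n h w| `^ r) &
    Ex P (fun w => `|transform W T n h w| `^ r) <= K * b].

(** The Hoelder bound over one cell; [L + 1] in place of [L] makes it positive, as the scale in
    [scaled_moment] has to be. *)
Definition mesh_error (n : nat) : R := (L + 1) * (T / n%:R) `^ rho.

Definition maruyama (n : nat) : Omega -> R := transform W T n (fun i => X (mesh T n i)).

Let T00 : 0 <= T. Proof. exact: ltW. Qed.
Let r0 : 0 < r. Proof. exact: lt_le_trans r2. Qed.
Let L1 : 0 < L + 1. Proof. exact: ltr_wpDl. Qed.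

Lemma mesh_error_gt0 n : (0 < n)%N -> 0 < mesh_error n.
Proof. by move=> n0; rewrite /mesh_error mulr_gt0// powR_gt0// divr_gt0// ltr0n. Qed.

Lemma mesh_error_le m n : (0 < m)%N -> (m <= n)%N -> mesh_error n <= mesh_error m.
Proof.
move=> m0 mn; have n0 := leq_trans m0 mn.
rewrite /mesh_error ler_wpM2l ?(ltW L1)// ler_powR2 ?(ltW rho0) ?divr_ge0//.
by rewrite ler_wpM2l// lef_pV2 ?posrE ?ltr0n// ler_nat.
Qed.

Lemma mesh_itv n i : (0 < n)%N -> (i <= n)%N -> 0 <= mesh T n i <= T.
Proof. by move=> n0 ni; rewrite mesh_ge0//= mesh_leT. Qed.

Lemma holder_mesh_error n t z : (0 < n)%N -> 0 <= t <= T -> 0 <= z <= T ->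
  `|t - z| <= T / n%:R -> Lone P (fun w => `|X t w - X z w| `^ r) /\
  Ex P (fun w => `|X t w - X z w| `^ r) <= mesh_error n `^ r.
Proof.
move=> n0 tT zT tz; have [l e] := integrand_holder hF r2 L0 hX tT zT.
split; first exact: l.
apply: (le_trans e); apply: ler_powR2 (ltW r0) _ _.
  by rewrite mulr_ge0 ?powR_ge0.
rewrite /mesh_error; apply: ler_pM; rewrite ?powR_ge0//; first by rewrite lerDl.
exact: ler_powR2 (ltW rho0) (normr_ge0 _) tz.
Qed.

Lemma maruyama_moment n : (0 < n)%N ->
  measurable_fun setT (maruyama n) /\ Lone P (fun w => `|maruyama n w| `^ r).
Proof.
move=> n0; have [] := HK (h := fun i => X (mesh T n i)) (b := 1 + L `^ q) n0; last by [].
- by move=> i /ltnW ni; apply: (integrand_adapted hX); exact: mesh_itv.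
- move=> i /ltnW ni.
  exact: (integrand_moment hF r2 rq L0 hX (ltW r0) rq (mesh_itv n0 ni)).
Qed.

Lemma maruyama_refine n k : (0 < n)%N -> (0 < k)%N ->
  Lone P (fun w => `|maruyama (n * k) w - maruyama n w| `^ r) /\
  Ex P (fun w => `|maruyama (n * k) w - maruyama n w| `^ r) <= K * mesh_error n `^ r.
Proof.
move=> n0 k0; have nk0 : (0 < n * k)%N by rewrite muln_gt0 n0.
pose h j (w : Omega) := X (mesh T (n * k) j) w - X (mesh T n (j %/ k)) w.
have e : (fun w => `|maruyama (n * k) w - maruyama n w| `^ r) =
    fun w => `|transform W T (n * k) h w| `^ r.
  apply/funext => w; congr (`|_| `^ r).
  by rewrite /maruyama (@transform_refine _ _ _ _ n k)// transformB.
have jk j : (j < n * k)%N -> (j %/ k < n)%N by rewrite ltn_divLR.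
have le1 j : mesh T n (j %/ k) <= mesh T (n * k) j.
  by rewrite -(mesh_mul T n (j %/ k) k0) mesh_le// leq_divM.
rewrite e; have [] := HK (h := h) (b := mesh_error n `^ r) nk0; last by [].
- move=> j jn; apply: measurable_funB.
    by apply: (integrand_adapted hX); apply: mesh_itv => //; exact: ltnW.
  apply: (adapted_le hF _ (le1 j)); first exact: mesh_ge0.
  by apply: (integrand_adapted hX); apply: mesh_itv => //; apply/ltnW/jk.
- move=> j jn; apply: holder_mesh_error => //; [by apply: mesh_itv => //; exact: ltnW| |].
    by apply: mesh_itv => //; apply/ltnW/jk.
  (* The fine knot [j] lies in the coarse cell number [j %/ k], hence within [T / n] of its left
     end. *)
  rewrite ger0_norm ?subr_ge0// -(meshS T n (j %/ k)) lerD2r.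
  by rewrite -(mesh_mul T n (j %/ k).+1 k0) mesh_le// ltnW// ltn_ceil.
Qed.

Lemma maruyama_measurable n : (0 < n)%N -> measurable_fun setT (maruyama n).
Proof. by move=> /maruyama_moment[]. Qed.

Lemma mesh_error_pow2 j : mesh_error (2 ^ j) = (L + 1) * T `^ rho * (2^-1 `^ rho) ^+ j.
Proof.
rewrite /mesh_error natrX powRM ?invr_ge0 ?exprn_ge0// mulrA; congr (_ * _).
by rewrite -exprVn -!powR_mulrn ?invr_ge0 ?powR_ge0// powRAC.
Qed.

(** The differences of consecutive dyadic sums have geometrically decreasing first moments. The sum
    of their absolute values is therefore integrable, hence almost surely finite, and the
    telescoping series converges absolutely. *)
Lemma maruyama_pow2_cvg : {ae P, forall w, cvgn (fun n => maruyama (2 ^ n) w)}.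
Proof.
pose D j w := maruyama (2 ^ j.+1) w - maruyama (2 ^ j) w.
have pow0 j : (0 < 2 ^ j)%N by rewrite expn_gt0.
have mD j : measurable_fun setT (D j) by apply: measurable_funB; exact: maruyama_measurable.
have LD j : Lone P (fun w => `|D j w|) /\
    Ex P (fun w => `|D j w|) <= (1 + K) * mesh_error (2 ^ j).
  have [l e] := maruyama_refine (pow0 j) (ltn0Sn 1).
  have r1 : 1 <= r by apply: le_trans r2; rewrite ler1n.
  have [] := @scaled_moment _ _ _ P (D j) 1 r (mesh_error (2 ^ j)) K (mesh_error_gt0 (pow0 j))
    ler01 r1 (mD j).
  - by move: l; rewrite -expnSr.
  - by move: e; rewrite -expnSr.
  by under eq_fun do rewrite powRr1//; rewrite powRr1// ltW// mesh_error_gt0.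
have fin : (\int[P]_w \sum_(0 <= j <oo) `|D j w|%:E < +oo)%E.
  rewrite integral_nneseries//; last first.
    by move=> j; apply/measurable_EFinP; exact: measurableT_comp.
  pose c := (1 + K) * ((L + 1) * T `^ rho); pose x : R := 2^-1 `^ rho.
  have c0 : 0 <= c.
    by rewrite mulr_ge0 ?mulr_ge0 ?powR_ge0 ?(ltW L1)// addr_ge0 ?(ltW K0).
  have x1 : x < 1.
    have := @gt0_ltr_powR R rho rho0 2^-1 1; rewrite powR1; apply.
    - by rewrite nnegrE invr_ge0.
    - by rewrite nnegrE.
    - by rewrite invf_lt1// ltr1n.
  apply: le_lt_trans (geometric_nneseries c0 (powR_ge0 _ _) x1).
  apply: lee_nneseries => [j *|j *]; first by apply: integral_ge0 => w _; rewrite lee_fin.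
  have [l e] := LD j; rewrite Ex_integral// lee_fin (le_trans e)//.
  by rewrite mesh_error_pow2 mulrA.
have mS : measurable_fun setT (fun w => \sum_(0 <= j <oo) `|D j w|%:E)%E.
  apply: (ge0_emeasurable_sum (P := xpredT)) => // j _.
  by apply/measurable_EFinP; exact: measurableT_comp.
have iS : P.-integrable setT (fun w => \sum_(0 <= j <oo) `|D j w|%:E)%E.
  apply/integrableP; split=> //.
  under eq_integral do rewrite gee0_abs ?nneseries_ge0//.
  exact: fin.
apply: filterS (integrable_ae measurableT iS) => w /(_ Logic.I) fw.
have cD : cvgn (series (D ^~ w)).
  apply: normed_cvg; apply: nondecreasing_is_cvgn.
    by apply: nondecreasing_series => n _ _; exact: normr_ge0.
  exists (fine (\sum_(0 <= j <oo) `|D j w|%:E)%E) => _ [n _ <-].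
  rewrite -lee_fin fineK// /= -sumEFin.
  by apply: nneseries_lim_ge => j _ _; rewrite lee_fin.
have -> : (fun n => maruyama (2 ^ n) w) = (fun n => maruyama 1 w + series (D ^~ w) n).
  apply/funext => n; rewrite /series/= telescope_sumr// expn0.
  by rewrite addrC subrK.
by apply: is_cvgD => //; exact: is_cvg_cst.
Qed.

(* The limsup only makes the limit measurable off the almost sure event where
   the dyadic sums converge. *)
Definition ito_limit (w : Omega) : R := fine (limn_esup (fun n => (maruyama (2 ^ n) w)%:E)).

Lemma ito_limit_measurable : measurable_fun setT ito_limit.
Proof.
apply: measurableT_comp => //.
apply: measurable_fun_limn_esup => n; apply/measurable_EFinP.
by apply: maruyama_measurable; rewrite expn_gt0.
Qed.

Lemma ito_limit_cvg : {ae P, forall w, maruyama (2 ^ n) w @[n --> \oo] --> ito_limit w}.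
Proof.
apply: filterS maruyama_pow2_cvg => w cw.
have h : (maruyama (2 ^ n) w)%:E @[n --> \oo] --> (limn (fun n => maruyama (2 ^ n) w))%:E.
  by apply: cvg_EFin; [exact: nearW|exact: cw].
by rewrite /ito_limit (cvg_limn_einf_sup h).2.
Qed.

(** Fatou's lemma in [n], with [k] fixed, applied to the bound between the meshes [2^(n + k)] and
    [2^k]. *)
Lemma ito_limit_moment k :
  Lone P (fun w => `|ito_limit w - maruyama (2 ^ k) w| `^ r) /\
  Ex P (fun w => `|ito_limit w - maruyama (2 ^ k) w| `^ r) <= K * mesh_error (2 ^ k) `^ r.
Proof.
have k0 : (0 < 2 ^ k)%N by rewrite expn_gt0.
apply: (@fatou_moment _ _ _ P (fun n w => maruyama (2 ^ (n + k)) w - maruyama (2 ^ k) w)) => //.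
- move=> n; apply: measurable_funB; apply: maruyama_measurable => //.
  by rewrite expn_gt0.
- by apply: measurable_funB; [exact: ito_limit_measurable|exact: maruyama_measurable].
- apply: filterS ito_limit_cvg => w cw; apply: cvgB; last exact: cvg_cst.
  by rewrite (cvg_shiftn k (fun n => maruyama (2 ^ n) w)).
- by move=> n; rewrite addnC expnD; apply: maruyama_refine => //; rewrite expn_gt0.
Qed.

Lemma norm_powR2 (x : R) : `|x| `^ 2 = x ^+ 2.
Proof. by rewrite powR_mulrn// real_normK// num_real. Qed.

Definition step (n : nat) : simple_process R Omega :=
  SimpleProcess n (mesh T n) (fun i => X (mesh T n i)).

Lemma step_integral n : sp_integral W (step n) = maruyama n.
Proof. by []. Qed.

Let le2q : 2 <= q. Proof. exact: le_trans rq. Qed.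

Lemma step_admissible n : (0 < n)%N -> sp_admissible P F T (step n).
Proof.
move=> n0; split => /=.
- by rewrite mesh0.
- by move=> i _; exact: mesh_le.
- by rewrite mesh_last.
- by move=> i /ltnW ni; apply: (integrand_adapted hX); exact: mesh_itv.
move=> i /ltnW ni; pose c : R := (1 + L `^ q) `^ 2^-1.
have c0 : 0 <= 1 + L `^ q by rewrite addr_ge0// powR_ge0.
apply: (@le_lt_trans _ _ c%:E); last exact: ltry.
have [l e] := integrand_moment hF r2 rq L0 hX (ler0n R 2) le2q (mesh_itv n0 ni).
apply: (moment_Lnorm (g := X (mesh T n i))) => //; first exact: powR_ge0.
by rewrite /c -powRrM mulVf// powRr1.
Qed.

Lemma mesh_cover n m t : 0 < t -> t <= mesh T n m ->
  exists2 i, (i < m)%N & mesh T n i < t <= mesh T n i.+1.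
Proof.
move=> t0; elim: m => [|m ih tm]; first by rewrite mesh0 leNgt t0.
have [/ih[i im it]|mt] := leP t (mesh T n m).
  by exists i => //; exact: ltnW.
by exists m => //; rewrite mt.
Qed.

Lemma step_val n t : (0 < n)%N -> 0 < t -> t <= T ->
  exists i, [/\ (i < n)%N, `|t - mesh T n i| <= T / n%:R &
    forall w, sp_val (step n) t w = X (mesh T n i) w].
Proof.
move=> n0 t0 tT; have [|i ni /andP[it ti]] := @mesh_cover n n t t0.
  by rewrite mesh_last.
exists i; split=> //.
  by rewrite ger0_norm ?subr_ge0 ?(ltW it)// -(meshS T n i) lerD2r.
move=> w; rewrite /sp_val /= (bigD1 (Ordinal ni))//= indicE mem_set; last first.
  by rewrite /= in_itv/= it.
rewrite mulr1 big1 ?addr0// => j ji; rewrite indicE memNset ?mulr0//=.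
rewrite in_itv/= => /andP[jt tj].
have [ltij|ltji|eqij] := ltngtP i j.
- by have := le_lt_trans ti (le_lt_trans (mesh_le n T00 ltij) jt); rewrite ltxx.
- by have := lt_le_trans it (le_trans tj (mesh_le n T00 ltji)); rewrite ltxx.
- by move/eqP: ji; apply; apply/val_inj.
Qed.

Lemma step_jointly_measurable n : (0 < n)%N -> jointly_measurable T (sp_val (step n)).
Proof. by move=> n0; exact: (sp_val_jointly_measurable hF (step_admissible n0)). Qed.

Let jX : jointly_measurable T X := integrand_joint hF T0 hX.

(** At each positive time the step process equals [X] at the left end of the cell. The Hoelder bound
    has constant 1 there, which [scaled_moment] turns into [1 + 1] at exponent 2. *)
Lemma step_mean_sqr n : (0 < n)%N ->
  (mean_sqr P T (fun t w => (X t w - sp_val (step n) t w)%R) <=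
   ((1 + 1) * mesh_error n ^+ 2 * T)%:E)%E.
Proof.
move=> n0; apply: mean_sqr_le => //.
- by rewrite mulr_ge0// sqr_ge0.
- by apply: measurable_funB; [exact: jX|exact: step_jointly_measurable].
move=> t t0 tT; have [i [ni ti ei]] := step_val n0 t0 tT.
have tT' : 0 <= t <= T by rewrite (ltW t0).
have iT := mesh_itv n0 (ltnW ni).
have [l e] := holder_mesh_error n0 tT' iT ti.
have mXX : measurable_fun setT (fun w => X t w - X (mesh T n i) w).
  by apply: measurable_funB; exact: (integrand_measurable hF hX).
have [] := @scaled_moment _ _ _ P (fun w => X t w - X (mesh T n i) w) 2 r (mesh_error n) 1
  (mesh_error_gt0 n0) (ler0n R 2) r2 mXX l.
  by rewrite mul1r.
under eq_fun do rewrite norm_powR2.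
rewrite (powR_mulrn 2 (ltW (mesh_error_gt0 n0))) => l2 e2.
under eq_integral do rewrite ei.
by rewrite Ex_integral// lee_fin.
Qed.

Lemma mesh_error_pow2_cvg c : (c * mesh_error (2 ^ k) ^+ 2)%:E @[k --> \oo] --> 0%E.
Proof.
apply: cvg_EFin; first exact: nearW.
pose x : R := (2^-1 `^ rho) ^+ 2.
have x1 : 2^-1 `^ rho < 1.
  have := @gt0_ltr_powR R rho rho0 2^-1 1; rewrite powR1; apply.
  - by rewrite nnegrE invr_ge0.
  - by rewrite nnegrE.
  - by rewrite invf_lt1// ltr1n.
rewrite (_ : _ \o _ = fun k => c * ((L + 1) * T `^ rho) ^+ 2 * x ^+ k); last first.
  by apply/funext => k /=; rewrite mesh_error_pow2 exprMn mulrA /x -exprM mulnC exprM.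
rewrite -[X in _ --> X](mulr0 (c * ((L + 1) * T `^ rho) ^+ 2)).
apply: cvgMr; apply: cvg_expr.
by rewrite ger0_norm ?sqr_ge0// exprn_ilt1// powR_ge0.
Qed.

Lemma ito_limit_mean_sqr k :
  (\int[P]_w ((ito_limit w - maruyama (2 ^ k) w) ^+ 2)%:E <= ((1 + K) * mesh_error (2 ^ k) ^+ 2)%:E)%E.
Proof.
have k0 : (0 < 2 ^ k)%N by rewrite expn_gt0.
have [l e] := ito_limit_moment k.
have mf : measurable_fun setT (fun w => ito_limit w - maruyama (2 ^ k) w).
  by apply: measurable_funB; [exact: ito_limit_measurable|exact: maruyama_measurable].
have [] := @scaled_moment _ _ _ P (fun w => ito_limit w - maruyama (2 ^ k) w) 2 r
  (mesh_error (2 ^ k)) K (mesh_error_gt0 k0) (ler0n R 2) r2 mf l e.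
under eq_fun do rewrite norm_powR2.
rewrite (powR_mulrn 2 (ltW (mesh_error_gt0 k0))) => l2 e2.
by rewrite Ex_integral// lee_fin.
Qed.

Lemma ito_limit_is_ito : is_ito_integral P F W T X ito_limit.
Proof.
split; first exact: ito_limit_measurable.
exists (fun k => step (2 ^ k)); split.
- by move=> k; apply: step_admissible; rewrite expn_gt0.
- apply: (@squeeze_cvge _ _ _ _ (cst 0%E) _
    (fun k => ((1 + 1) * T * mesh_error (2 ^ k) ^+ 2)%:E)); last 2 first.
  + exact: cvg_cst.
  + exact: mesh_error_pow2_cvg.
  apply: nearW => k; apply/andP; split.
    apply: integral_ge0 => w _; apply: integral_ge0 => t _.
    by rewrite lee_fin sqr_ge0.
  by rewrite mulrAC; apply: step_mean_sqr; rewrite expn_gt0.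
- apply: (@squeeze_cvge _ _ _ _ (cst 0%E) _
    (fun k => ((1 + K) * mesh_error (2 ^ k) ^+ 2)%:E)); last 2 first.
  + exact: cvg_cst.
  + exact: mesh_error_pow2_cvg.
  apply: nearW => k; apply/andP; split.
    by apply: integral_ge0 => w _; rewrite lee_fin sqr_ge0.
  by rewrite step_integral; exact: ito_limit_mean_sqr.
Qed.

Lemma sp_integral_measurable H : sp_admissible P F T H ->
  measurable_fun setT (sp_integral W H).
Proof.
move=> aH; apply: measurable_sum => i.
have [k0 k1 _] := sp_knot_itv aH (ltn_ord i); have [_ _ _ ac _] := aH.
apply: measurable_funM; first exact: (adapted_measurable hF k0 (ac i (ltn_ord i))).
exact: (incr_measurable hF hW k0 k1).
Qed.

(** The approximations [H k] of [I] and the dyadic step processes both tend to [X] in mean square;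
    by the isometry their integrals become close, and so [I] and [ito_limit] are at mean square
    distance 0. *)
Lemma ito_integral_unique I : is_ito_integral P F W T X I ->
  {ae P, forall w, I w = ito_limit w}.
Proof.
move=> [mI [H [aH cH1 cH2]]].
pose J := ito_limit; have mJ : measurable_fun setT J := ito_limit_measurable.
pose a k := (\int[P]_w ((I w - sp_integral W (H k) w) ^+ 2)%:E)%E.
pose b k := mean_sqr P T (fun t w => (X t w - sp_val (H k) t w)%R).
(* The factor 4 splits [I - J] into three differences, through the integrals of [H k] and of the
   dyadic step process; the factor 2 inserts [X] between these two processes. *)
pose u k := (4%:E * (a k + (2%:E * (b k + ((1 + 1) * T * mesh_error (2 ^ k) ^+ 2)%:E)
   + ((1 + K) * mesh_error (2 ^ k) ^+ 2)%:E)))%E.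
have cu : u @ \oo --> 0%E.
  rewrite -(mule0 4%:E); apply: cvgeZl => //.
  rewrite -[X in _ --> X](adde0 0%E); apply: cvgeD => //.
  rewrite -[X in _ --> X](adde0 0%E); apply: cvgeD => //; last exact: mesh_error_pow2_cvg.
  rewrite -(mule0 2%:E); apply: cvgeZl => //.
  rewrite -[X in _ --> X](adde0 0%E); apply: cvgeD => //; exact: mesh_error_pow2_cvg.
have mIJ : measurable_fun setT (fun w => ((I w - J w) ^+ 2)%:E).
  by apply/measurable_EFinP; apply: measurable_funX; exact: measurable_funB.
have le k : (\int[P]_w ((I w - J w) ^+ 2)%:E <= u k)%E.
  have k0 : (0 < 2 ^ k)%N by rewrite expn_gt0.
  have mS := sp_integral_measurable (aH k).
  have mR := maruyama_measurable k0.
  have m2 (f g : Omega -> R) : measurable_fun setT f -> measurable_fun setT g ->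
      measurable_fun setT (fun w : Omega => ((f w - g w) ^+ 2)%:E : \bar R).
    by move=> mf mg; apply/measurable_EFinP; apply: measurable_funX; exact: measurable_funB.
  have p2 (f g : Omega -> R) w : setT w -> (0 <= ((f w - g w) ^+ 2)%:E)%E.
    by move=> _; rewrite lee_fin sqr_ge0.
  apply: (@le_trans _ _ (\int[P]_w (4%:E * (((I w - sp_integral W (H k) w) ^+ 2)%:E
     + (((sp_integral W (H k) w - maruyama (2 ^ k) w) ^+ 2)%:E
       + ((J w - maruyama (2 ^ k) w) ^+ 2)%:E))))%E).
    apply: ge0_le_integral => //; first exact: p2.
      apply: emeasurable_funM => //; apply: emeasurable_funD; first exact: m2.
      by apply: emeasurable_funD; exact: m2.
    move=> w _; rewrite -!EFinD -EFinM lee_fin.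
    set x := I w - sp_integral _ _ w; set y := sp_integral _ _ w - maruyama _ w.
    set z := J w - maruyama _ w.
    have -> : I w - J w = x + y - z by rewrite /x /y /z; ring.
    have := sqr_ge0 (x - y); have := sqr_ge0 (x + z); have := sqr_ge0 (y + z).
    have := sqr_ge0 x; have := sqr_ge0 y; have := sqr_ge0 z; nra.
  rewrite ge0_integralZl//; last 2 first.
  - apply: emeasurable_funD; first exact: m2.
    by apply: emeasurable_funD; exact: m2.
  - by move=> w _; rewrite -!EFinD lee_fin !addr_ge0 ?sqr_ge0.
  rewrite lee_pmul2l// ge0_integralD//; last 4 first.
  - by move=> w _; exact: p2.
  - exact: m2.
  - by move=> w _; rewrite -EFinD lee_fin addr_ge0 ?sqr_ge0.
  - by apply: emeasurable_funD; exact: m2.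
  rewrite leeD2l// ge0_integralD//; last 4 first.
  - by move=> w _; exact: p2.
  - exact: m2.
  - by move=> w _; exact: p2.
  - exact: m2.
  rewrite leeD//; last exact: ito_limit_mean_sqr.
  have [l e] := sp_integral_isometry hF hW (aH k) (step_admissible k0).
  rewrite -step_integral Ex_integral// -e.
  pose Y t w := sp_val (H k) t w - X t w.
  pose Z t w := X t w - sp_val (step (2 ^ k)) t w.
  have mY : jointly_measurable T Y.
    by apply: measurable_funB; [exact: (sp_val_jointly_measurable hF)|exact: jX].
  have mZ : jointly_measurable T Z.
    by apply: measurable_funB; [exact: jX|exact: step_jointly_measurable].
  have -> : (fun t w => sp_val (H k) t w - sp_val (step (2 ^ k)) t w)
     = fun t w => Y t w + Z t w.
    by apply/funext => t; apply/funext => w; rewrite /Y /Z; ring.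
  apply: (le_trans (mean_sqrD_le P mY mZ)); rewrite lee_pmul2l// leeD//; last first.
    by rewrite [(1 + 1) * T * _]mulrAC; exact: step_mean_sqr.
  rewrite le_eqVlt; apply/orP; left; apply/eqP; apply: eq_integral => w _.
  by apply: eq_integral => t _; rewrite -sqrrN opprB.
have : (\int[P]_w ((I w - J w) ^+ 2)%:E <= 0)%E.
  rewrite -(cvg_lim _ cu)//; apply: lime_ge; first by apply/cvg_ex; exists 0%E.
  exact: nearW.
move=> le0.
have : (\int[P]_w `|((I w - J w) ^+ 2)%:E| = 0)%E.
  apply/eqP; rewrite eq_le integral_ge0// andbT; apply: le_trans le0.
  rewrite le_eqVlt; apply/orP; left; apply/eqP; apply: eq_integral => w _.
  by rewrite gee0_abs// lee_fin sqr_ge0.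
move/(ae_eq_integral_abs P measurableT mIJ); apply: filterS => w /(_ Logic.I).
by case=> /eqP; rewrite sqrf_eq0 subr_eq0 => /eqP.
Qed.

(** A general [n] is not dyadic: the path leads from the limit to the mesh [2^n], up to the common
    refinement [n * 2^n] and down to [n]. Since [n <= 2^n], all three distances are controlled by
    the error of the mesh [n]; [powR_add_le], used twice, produces the constant. *)
Lemma ito_integral_error n : (0 < n)%N ->
  [/\ measurable_fun setT (ito_integral P F W T X),
  Lone P (fun w => `|ito_integral P F W T X w - maruyama n w| `^ r) &
  Ex P (fun w => `|ito_integral P F W T X w - maruyama n w| `^ r) <=
    2 `^ r * (1 + 2 `^ r * (1 + 1)) * K * mesh_error n `^ r].
Proof.
move=> n0; have isI : is_ito_integral P F W T X (ito_integral P F W T X).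
  exact: (xgetI (cst 0) ito_limit_is_ito).
have mI : measurable_fun setT (ito_integral P F W T X) by case: isI.
have eI := ito_integral_unique isI.
have k0 : (0 < 2 ^ n)%N by rewrite expn_gt0.
have [l1 e1] := ito_limit_moment n.
have [l2 e2] := maruyama_refine k0 n0.
have [l3 e3] := maruyama_refine n0 k0.
have en : mesh_error (2 ^ n) `^ r <= mesh_error n `^ r.
  apply: ler_powR2; [exact: ltW|exact/ltW/mesh_error_gt0|].
  by apply: mesh_error_le => //; exact/ltnW/ltn_expl.
pose B w := 2 `^ r * (`|ito_limit w - maruyama (2 ^ n) w| `^ r +
  2 `^ r * (`|maruyama (2 ^ n * n) w - maruyama (2 ^ n) w| `^ r
            + `|maruyama (n * 2 ^ n) w - maruyama n w| `^ r)).
have LB : Lone P B by apply: LoneZ; apply: LoneD => //; apply: LoneZ; exact: LoneD.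
have leB w : `|ito_limit w - maruyama n w| `^ r <= B w.
  rewrite /B (mulnC n).
  set x := ito_limit w - maruyama (2 ^ n) w; set y := maruyama (2 ^ n * n) w - maruyama (2 ^ n) w.
  set z := maruyama (2 ^ n * n) w - maruyama n w.
  have -> : ito_limit w - maruyama n w = x + (z - y) by rewrite /x /y /z; ring.
  have r00 := ltW r0.
  apply: (le_trans (ler_powR2 r00 (normr_ge0 _) (ler_normD _ _))).
  apply: (le_trans (powR_add_le r00 (normr_ge0 _) (normr_ge0 _))).
  rewrite ler_wpM2l ?powR_ge0// lerD2l.
  apply: (le_trans (ler_powR2 r00 (normr_ge0 _) (ler_normB _ _))).
  rewrite addrC.
  exact: (powR_add_le r00 (normr_ge0 _) (normr_ge0 _)).
have mf : measurable_fun setT (fun w => ito_limit w - maruyama n w).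
  by apply: measurable_funB; [exact: ito_limit_measurable|exact: maruyama_measurable].
have LJ : Lone P (fun w => `|ito_limit w - maruyama n w| `^ r).
  apply: Lone_le LB _ => [|w]; last by rewrite ger0_norm ?powR_ge0.
  exact: measurable_norm_powR.
have EJ : Ex P (fun w => `|ito_limit w - maruyama n w| `^ r) <=
    2 `^ r * (1 + 2 `^ r * (1 + 1)) * K * mesh_error n `^ r.
  apply: (le_trans (Ex_le LJ LB leB)).
  have Lyz := LoneD l2 l3; have Lyz2 := LoneZ (2 `^ r) Lyz.
  rewrite /B (ExZ _ (LoneD l1 Lyz2)) (ExD l1 Lyz2) (ExZ _ Lyz) (ExD l2 l3).
  have Ken : K * mesh_error (2 ^ n) `^ r <= K * mesh_error n `^ r by rewrite ler_wpM2l// ltW.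
  have h1 := le_trans e1 Ken; have h2 := le_trans e2 Ken.
  have h := lerD h1 (ler_wpM2l (powR_ge0 2 r) (lerD h2 e3)).
  apply: (le_trans (ler_wpM2l (powR_ge0 2 r) h)).
  by rewrite le_eqVlt; apply/orP; left; apply/eqP; ring.
have [] := @ae_eq_moment _ _ _ P (fun w => ito_integral P F W T X w - maruyama n w)
  (fun w => ito_limit w - maruyama n w) r _ _ mf _ LJ EJ; last by [].
- by apply: measurable_funB => //; exact: maruyama_measurable.
- by apply: filterS eI => w ->.
Qed.

End ItoConstruction.

(** * Noise *)

Section DisturbanceIncrements.
Context {R : realType}.
Variable T : R.
Implicit Types (t u x y s : R) (p dtp dyp : R -> R -> R).

(** A form of the growth condition that is monotone in [z] and covers the convention at [s = 0]. *)
Lemma abspow0_le s y z : 0 <= s -> `|y| <= z -> 1 + abspow0 s y <= 2 * (1 + z) `^ s.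
Proof.
move=> s0 yz; have z0 : 0 <= z := le_trans (normr_ge0 _) yz.
have h1 : 1 <= (1 + z) `^ s.
  by rewrite -[leLHS](powRr0 (1 + z)) ler_powR// lerDl.
have h2 : abspow0 s y <= (1 + z) `^ s.
  rewrite /abspow0; case: ifP => _; first by rewrite powR_ge0.
  by apply: ler_powR2 => //; rewrite (le_trans yz)// lerDr.
lra.
Qed.

Lemma partial_t_dist p dtp t y (e : R) : is_partial_t T p dtp -> 0 <= t <= T ->
  0 < e -> exists2 de, 0 < de & forall u, 0 <= u <= T -> u != t -> `|t - u| < de ->
    `|dtp t y - (p u y - p t y) / (u - t)| <= e.
Proof.
move=> h tT e0; have /cvgrPdist_le/(_ e e0) := h t y tT.
rewrite /within/= /dnbhs /within/= => -[de /= de0 hde].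
by exists de => // u uT ut tu; apply: hde => //; rewrite /= in_itv.
Qed.

(** In a ball of radius [min (t, T - t)] the restriction to [[0, T]] is invisible. *)
Lemma partial_t_is_derive p dtp t y : is_partial_t T p dtp -> 0 < t < T ->
  is_derive t 1 (p ^~ y) (dtp t y).
Proof.
move=> h /andP[t0 tT].
have tT' : 0 <= t <= T by rewrite !ltW.
have cv : (fun v : R => v^-1 *: (p (v *: 1 + t) y - p t y)) @ 0^' --> dtp t y.
  apply/cvgrPdist_le => e e0.
  have [de de0 hde] := partial_t_dist y h tT' e0.
  pose m := Num.min de (Num.min t (T - t)).
  have m0 : 0 < m by rewrite !lt_min de0 t0 subr_gt0.
  rewrite /dnbhs /within/=; exists m => //= v /=; rewrite sub0r normrN => vm v0.
  have /andP[v1 v2] : `|v| < de <= de by rewrite lexx andbT (lt_le_trans vm)// ge_min lexx.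
  have v3 : `|v| < t by rewrite (lt_le_trans vm)// !ge_min lexx orbT.
  have v4 : `|v| < T - t by rewrite (lt_le_trans vm)// !ge_min lexx !orbT.
  have := hde (v + t); rewrite addrK /GRing.scale/= mulr1 mulrC; apply.
  - by move: v3 v4; rewrite !ltr_norml => /andP[? ?] /andP[? ?]; lra.
  - by rewrite -subr_eq0 addrK.
  - by rewrite opprD addrCA subrr addr0 normrN.
split; first by apply/cvg_ex; exists (dtp t y).
exact: (cvg_lim _ cv).
Qed.

(** Near each point the difference quotient is at most [|dtp| + 1]. This includes the end points of
    [[0, T]], where the mean value theorem needs continuity. *)
Lemma partial_t_continuous p dtp y a b : is_partial_t T p dtp ->
  0 <= a -> b <= T -> {within `[a, b], continuous (p ^~ y)}.
Proof.
move=> h a0 bT; apply/subspace_continuousP => x /=; rewrite in_itv/= => /andP[ax xb].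
have xT : 0 <= x <= T by rewrite (le_trans a0 ax) (le_trans xb bT).
apply/cvgrPdist_le => e e0.
have [de de0 hde] := partial_t_dist y h xT (ltr01 : 0 < 1 :> R).
pose M := `|dtp x y| + 1; have M0 : 0 < M by rewrite ltr_wpDl.
pose m := Num.min de (e / M); have m0 : 0 < m by rewrite lt_min de0 divr_gt0.
rewrite /within/=; exists m => //= u /= um; rewrite in_itv/= => /andP[au ub].
have [->|ux] := eqVneq u x; first by rewrite subrr normr0 ltW.
have uT : 0 <= u <= T by rewrite (le_trans a0 au) (le_trans ub bT).
have um' : `|x - u| < de by rewrite (lt_le_trans um)// ge_min lexx.
have h1 := hde u uT ux um'.
have ux0 : u - x != 0 by rewrite subr_eq0.
have -> : p x y - p u y = - ((p u y - p x y) / (u - x) * (u - x)).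
  by rewrite divfK// opprB.
rewrite normrN normrM.
have h2 : `|(p u y - p x y) / (u - x)| <= M.
  rewrite /M -lerBlDl; apply: le_trans (lerB_dist _ _) _.
  by rewrite distrC.
have h3 : `|u - x| <= e / M by rewrite distrC ltW// (lt_le_trans um)// ge_min lexx orbT.
apply: le_trans (ler_pM (normr_ge0 _) (normr_ge0 _) h2 h3) _.
by rewrite mulrC divfK// gt_eqF.
Qed.

Lemma partial_t_increment p dtp y M a b : is_partial_t T p dtp ->
  (forall t, 0 <= t <= T -> `|dtp t y| <= M) -> 0 <= a -> a <= b -> b <= T ->
  `|p b y - p a y| <= M * (b - a).
Proof.
move=> h hM a0 ab bT.
have [||c] := @MVT_segment R (p ^~ y) (fun t => dtp t y) a b ab.
- move=> x; rewrite in_itv/= => /andP[ax xb]; apply: partial_t_is_derive => //.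
  by rewrite (le_lt_trans a0 ax) (lt_le_trans xb bT).
- exact: partial_t_continuous h a0 bT.
rewrite in_itv/= => /andP[ac cb] ->.
rewrite normrM (ger0_norm (_ : 0 <= b - a)) ?subr_ge0// ler_wpM2r ?subr_ge0// hM//.
by rewrite (le_trans a0 ac) (le_trans cb bT).
Qed.

(** The intermediate point is located relative to [x] in a form symmetric in the order of [x] and
    [y], ready for the growth bounds. *)
Lemma derive_mean_value (f df : R -> R) x y : (forall z : R, is_derive z 1 f (df z)) ->
  exists c, [/\ `|c - x| <= `|y - x|, `|c| <= `|x| + `|y - x| &
    f y - f x = df c * (y - x)].
Proof.
move=> hf.
have cf : continuous f.
  by move=> z; apply: differentiable_continuous; apply/derivable1_diffP; case: (hf z).
have key (a b : R) : a <= b -> exists2 c, a <= c <= b & f b - f a = df c * (b - a).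
  move=> ab; have cab := @continuous_subspaceT _ _ `[a, b]%classic f cf.
  have [c] := @MVT_segment R f df a b ab (fun z _ => hf z) cab.
  by rewrite in_itv/= => hc e; exists c.
have bd (c : R) : `|c - x| <= `|y - x| -> `|c| <= `|x| + `|y - x|.
  by move=> h; rewrite -[c](subrKC x) (le_trans (ler_normD _ _))// lerD2l.
have [xy|yx] := leP x y.
  have [c /andP[xc cy] e] := key x y xy; exists c.
  have h : `|c - x| <= `|y - x|.
    by rewrite !ger0_norm ?subr_ge0// lerD2r.
  by split=> //; exact: bd.
have [c /andP[yc cx] e] := key y x (ltW yx); exists c.
have h : `|c - x| <= `|y - x|.
  by rewrite ![`|_ - x|]distrC !ger0_norm ?subr_ge0 ?(ltW yx)// lerD2l lerN2.
split=> //; first exact: bd.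
by rewrite -opprB e -mulrN opprB.
Qed.

Lemma K2bar_increment s p : 0 <= s -> K2bar T s p -> forall a b x y,
  0 <= a -> a <= b -> b <= T ->
  `|p b y - p a x| <= 2 * (1 + (`|x| + `|y - x|)) `^ s * ((b - a) + `|y - x|).
Proof.
move=> s0 [dtp [dyp [[ht hy] [_ hb]]]] a b x y a0 ab bT.
have aT : 0 <= a <= T by rewrite a0 (le_trans ab bT).
set z := `|x| + `|y - x|.
have yz : `|y| <= z by rewrite -[y in leLHS](subrKC x) ler_normD.
have h1 : `|p b y - p a y| <= 2 * (1 + z) `^ s * (b - a).
  apply: partial_t_increment ht _ a0 ab bT => t tT.
  by have [+ _] := hb t y tT; move/le_trans; apply; exact: abspow0_le.
have [c [_ cz e]] := @derive_mean_value (p a) (dyp a) x y (fun z => hy a z aT).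
have h2 : `|p a y - p a x| <= 2 * (1 + z) `^ s * `|y - x|.
  rewrite e normrM ler_wpM2r//.
  by have [_] := hb a c aT; move/le_trans; apply; exact: abspow0_le.
rewrite mulrDr; apply: le_trans (lerD h1 h2).
by rewrite -[_ - p a x](subrKA (p a y)) ler_normD.
Qed.

(** Time moves first, at the end value [y], and costs one derivative; space is then expanded at the
    left time [a] by two mean values. The derivative thus sits at [(a, x)], in the past of the
    increment, and its continuity in space makes it an adapted coefficient. *)
Lemma K2_increment s p : 0 <= s -> K2 T s p ->
  exists dyp : R -> R -> R, [/\
    forall t, 0 <= t <= T -> continuous (dyp t),
    forall t y z, 0 <= t <= T -> `|y| <= z -> `|dyp t y| <= 2 * (1 + z) `^ s &
    forall a b x y, 0 <= a -> a <= b -> b <= T ->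
      `|p b y - p a x - dyp a x * (y - x)| <=
        2 * (1 + (`|x| + `|y - x|)) `^ s * ((b - a) + `|y - x| ^+ 2)].
Proof.
move=> s0 [dtp [dyp [dyyp [[ht hy hyy] [_ hb]]]]]; exists dyp; split.
- move=> t tT z; apply: differentiable_continuous; apply/derivable1_diffP.
  by case: (hyy t z tT).
- move=> t y z tT yz; have [_ + _] := hb t y tT; move/le_trans; apply.
  exact: abspow0_le.
move=> a b x y a0 ab bT.
have aT : 0 <= a <= T by rewrite a0 (le_trans ab bT).
set z := `|x| + `|y - x|.
have yz : `|y| <= z by rewrite -[y in leLHS](subrKC x) ler_normD.
have h1 : `|p b y - p a y| <= 2 * (1 + z) `^ s * (b - a).
  apply: partial_t_increment ht _ a0 ab bT => t tT.
  by have [+ _ _] := hb t y tT; move/le_trans; apply; exact: abspow0_le.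
have [c [cx cz e]] := @derive_mean_value (p a) (dyp a) x y (fun z => hy a z aT).
have [c' [_ c'z e']] := @derive_mean_value (dyp a) (dyyp a) x c (fun z => hyy a z aT).
have h2 : `|p a y - p a x - dyp a x * (y - x)| <= 2 * (1 + z) `^ s * `|y - x| ^+ 2.
  rewrite e -mulrBl e' !normrM -mulrA.
  have hd : `|dyyp a c'| <= 2 * (1 + z) `^ s.
    have [_ _] := hb a c' aT; move/le_trans; apply; apply: abspow0_le => //.
    by apply: (le_trans c'z); rewrite lerD2l.
  by apply: ler_pM => //; rewrite expr2 ler_wpM2r.
rewrite [leRHS]mulrDr; apply: le_trans (lerD h1 h2).
rewrite (_ : p b y - p a x - _ = (p b y - p a y) + (p a y - p a x - dyp a x * (y - x)));
  last by ring.
exact: ler_normD.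
Qed.

End DisturbanceIncrements.

(** * Calculus of bounds in L^r *)

Section LrBounds.
Context d (Omega : measurableType d) (R : realType) (P : probability Omega R).
Implicit Types (f g : Omega -> R) (a b c r : R).

Definition Lr_le r f c := [/\ 0 <= c, measurable_fun setT f,
  Lone P (fun w => `|f w| `^ r) & Ex P (fun w => `|f w| `^ r) <= c `^ r].

Lemma Lr_le_Lnorm r f g c : 0 < r -> Lr_le r g c -> (forall w, `|f w| <= `|g w|) ->
  ('N[P]_(r%:E)[EFin \o f] <= c%:E)%E.
Proof. by move=> r0 [c0 _ Lg Eg]; exact: moment_Lnorm. Qed.

Lemma Lr_le_weaken r f b c : 0 < r -> Lr_le r f b -> b <= c -> Lr_le r f c.
Proof.
move=> r0 [b0 mf L E] bc; split=> //; first exact: le_trans bc.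
by rewrite (le_trans E)// ler_powR2// ltW.
Qed.

Lemma Lr_le_moment r f b : 0 < r -> 0 <= b -> measurable_fun setT f ->
  Lone P (fun w => `|f w| `^ r) -> Ex P (fun w => `|f w| `^ r) <= b ->
  Lr_le r f (b `^ r^-1).
Proof.
move=> r0 b0 mf L E; split=> //; first exact: powR_ge0.
by rewrite -powRrM mulVf ?gt_eqF// powRr1.
Qed.

Lemma Lr_leD r f g b c : 1 <= r -> Lr_le r f b -> Lr_le r g c ->
  Lr_le r (fun w => f w + g w) (b + c).
Proof.
move=> r1 fb gc; have r0 : 0 < r by exact: lt_le_trans r1.
have [b0 mf _ _] := fb; have [c0 mg _ _] := gc.
have mfg : measurable_fun setT (fun w => f w + g w) by exact: measurable_funD.
have bc0 := addr_ge0 b0 c0.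
have r1' : (1 <= r%:E)%E by rewrite lee_fin.
have [L E] := Lnorm_moment (c := b + c) r0 bc0 mfg
  (le_trans (minkowski_EFin P mf mg r1')
    (leeD (Lr_le_Lnorm r0 fb (fun=> lexx _)) (Lr_le_Lnorm r0 gc (fun=> lexx _)))).
by split.
Qed.

Lemma Lr_leZ r a f b : 0 < r -> 0 <= a -> Lr_le r f b -> Lr_le r (fun w => a * f w) (a * b).
Proof.
move=> r0 a0 [b0 mf L E].
have e : (fun w => `|a * f w| `^ r) = fun w => a `^ r * `|f w| `^ r.
  by apply/funext => w; rewrite normrM powRM// ger0_norm.
split; [exact: mulr_ge0|exact: measurable_funM|by rewrite e; exact: LoneZ|].
by rewrite e ExZ// powRM// ler_wpM2l ?powR_ge0.
Qed.

Lemma Lr_le0 r : 0 < r -> Lr_le r (fun=> 0) 0.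
Proof.
move=> r0; split=> //; first exact: Lone_cst.
by rewrite Ex_cst normr0.
Qed.

Lemma Lr_le_sum r n (f : nat -> Omega -> R) c : 1 <= r ->
  (forall i, (i < n)%N -> Lr_le r (f i) c) ->
  Lr_le r (fun w => \sum_(i < n) f i w) (n%:R * c).
Proof.
move=> r1; have r0 : 0 < r by exact: lt_le_trans r1.
elim: n => [_|n ih fc].
  by under eq_fun do rewrite big_ord0; rewrite mul0r; exact: Lr_le0.
under eq_fun do rewrite big_ord_recr /=; rewrite mulrS addrC mulrDl mul1r.
by apply: Lr_leD => //; [apply: ih => i /ltnW; exact: fc|exact: fc].
Qed.

Lemma Lr_le_norm r f c : Lr_le r f c -> Lr_le r (fun w => `|f w|) c.
Proof.
move=> [c0 mf L E]; split=> //; first exact: measurableT_comp.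
  by under eq_fun do rewrite normr_id.
by under eq_fun do rewrite normr_id.
Qed.

End LrBounds.

(** * Moments of the Wiener process and of dominating sums *)

Section WienerPowers.
Context {R : realType}.

Lemma sqrt_mesh (D : R) (x : R) : 0 < D -> `|x| = Num.sqrt D * (`|x| / Num.sqrt D).
Proof. by move=> D0; rewrite mulrC divfK// gt_eqF// sqrtr_gt0. Qed.

(** [W t] is almost surely the increment from 0, whose scale [sqrt t] is at most [sqrt T]; at
    [t = 0] the normalisation degenerates and the increment is 0. *)
Lemma wiener_moment (T p : R) : 0 < T -> 0 <= p ->
  exists2 G : R, 0 < G &
  forall d (Omega : measurableType d) (P : probability Omega R)
    (F : R -> set (set Omega)) (W : R -> Omega -> R) (t : R),
    usual_conditions P F -> wiener P F W -> 0 <= t <= T ->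
    Lone P (fun w => (1 + `|W t w|) `^ p) /\
    Ex P (fun w => (1 + `|W t w|) `^ p) <= G.
Proof.
move=> T0 p0; have [G G0 HG] := incr_moment p.
pose c : R := (1 + Num.sqrt T) `^ p.
have sT : 0 <= Num.sqrt T by exact: sqrtr_ge0.
have c1 : 1 <= c.
  by rewrite -[leLHS](powRr0 (1 + Num.sqrt T)) ler_powR// lerDl.
exists (1 + c * G); first by rewrite addr_gt0// mulr_gt0// (lt_le_trans _ c1).
move=> d Omega P F W t hF hW /andP[t0 tT].
have mI := incr_measurable hF hW (lexx 0) t0.
have mW : measurable_fun setT (W t).
  by apply: (adapted_measurable hF t0); exact: (wiener_adapted hW).
have m1 (f : Omega -> R) : measurable_fun setT f ->
    measurable_fun setT (fun w => 1 + `|f w|).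
  by move=> mf; apply: measurable_funD => //; exact: measurableT_comp.
have [LI EI] : Lone P (fun w => `|1 + `|incr W 0 t w| | `^ p) /\
    Ex P (fun w => `|1 + `|incr W 0 t w| | `^ p) <= 1 + c * G.
  move: t0; rewrite le_eqVlt => /predU1P[<-|t0].
    have e : (fun w => `|1 + `|incr W 0 0 w| | `^ p) = fun=> 1.
      by apply/funext => w; rewrite /incr subrr normr0 addr0 normr1 powR1.
    rewrite e Ex_cst; split; first exact: Lone_cst.
    by rewrite lerDl mulr_ge0// ltW// (lt_le_trans _ c1).
  have [L E] := HG _ _ P F W 0 t hF hW (lexx 0) t0; rewrite subr0 in L E.
  have le w : `|1 + `|incr W 0 t w| | `^ p <=
      c * (1 + `|incr W 0 t w| / Num.sqrt t) `^ p.
    have st : Num.sqrt t <= Num.sqrt T by rewrite ler_wsqrtr.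
    have u0 : 0 <= `|incr W 0 t w| / Num.sqrt t by rewrite divr_ge0 ?sqrtr_ge0.
    rewrite /c -powRM ?addr_ge0// ler_powR2// ger0_norm ?addr_ge0//.
    have := ler_wpM2r u0 st; rewrite -sqrt_mesh//.
    set u : R := _ / _ in u0 *; set v : R := `|_|; set z := Num.sqrt T in sT *.
    nra.
  have LI : Lone P (fun w => `|1 + `|incr W 0 t w| | `^ p).
    apply: Lone_le (LoneZ c L) _ => [|w]; last by rewrite ger0_norm ?powR_ge0.
    by apply: measurable_norm_powR; exact: m1.
  split=> //; apply: (le_trans (Ex_le LI (LoneZ c L) le)).
  rewrite ExZ// (@le_trans _ _ (c * G))//; last by rewrite lerDr.
  by rewrite ler_wpM2l// (le_trans _ c1).
have [] := @ae_eq_moment _ _ _ P (fun w => 1 + `|W t w|)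
  (fun w => 1 + `|incr W 0 t w|) p (1 + c * G) (m1 _ mW) (m1 _ mI) _ LI EI.
  have [W0 _ _ _ _] := hW; apply: filterS W0 => w w0.
  by rewrite /incr w0 subr0.
have e : (fun w => `|1 + `|W t w| | `^ p) = (fun w => (1 + `|W t w|) `^ p).
  by apply/funext => w; rewrite ger0_norm// addr_ge0.
by rewrite e.
Qed.

(** Each [y_i] is independent of the following increment, so the [r]-th moment of a summand factors,
    and the normalised factor has a moment free of [n]. Minkowski's inequality contributes the
    [n]. *)
Lemma dominator_moment (T r p : R) : 0 < T -> 1 <= r ->
  exists2 G : R, 0 < G &
  forall d (Omega : measurableType d) (P : probability Omega R)
    (F : R -> set (set Omega)) (W : R -> Omega -> R) (n : nat)
    (y : nat -> Omega -> R) (b : R),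
    usual_conditions P F -> wiener P F W -> (0 < n)%N ->
    (forall i, (i < n)%N -> adapted_at F (mesh T n i) (y i)) ->
    (forall i, (i < n)%N -> Lone P (fun w => `|y i w| `^ r) /\
       Ex P (fun w => `|y i w| `^ r) <= b) ->
    Lr_le P r (fun w => \sum_(i < n) `|y i w| *
        (1 + `|incr W (mesh T n i) (mesh T n i.+1) w| / Num.sqrt (T / n%:R)) `^ p)
      (n%:R * (b * G) `^ r^-1).
Proof.
move=> T0 r1; have r0 : 0 < r by exact: lt_le_trans r1.
have [G G0 HG] := incr_moment (R := R) (p * r); exists G => //.
move=> d Omega P F W n y b hF hW n0 ay Ly.
have b0 : 0 <= b.
  by have [_] := Ly 0%N n0; apply: le_trans; apply: Ex_ge0 => w; exact: powR_ge0.
apply: (Lr_le_sum (f := fun i w => `|y i w| *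
  (1 + `|incr W (mesh T n i) (mesh T n i.+1) w| / Num.sqrt (T / n%:R)) `^ p)) => //.
move=> i ni; have m0 := mesh_ge0 n i (ltW T0); have mS := meshS_lt i T0 n0.
have [L E] := HG _ _ P F W _ _ hF hW m0 mS; rewrite meshS in L E.
have [Li Ei] := Ly i ni.
pose k (x : R) := (1 + `|x| / Num.sqrt (T / n%:R)) `^ (p * r).
have mk0 p' : measurable_fun setT (fun x : R => (1 + `|x| / Num.sqrt (T / n%:R)) `^ p').
  apply: (measurableT_comp (measurable_powR p')); apply: measurable_funD => //.
  exact: measurable_funM.
have ayr : adapted_at F (mesh T n i) (fun w => `|y i w| `^ r).
  by apply: measurable_norm_powR; exact: ay.
have mI := incr_measurable hF hW m0 (ltW mS).
have [Lm Em] := incr_indep hF hW m0 (ltW mS) ayr Li (mk0 (p * r)) L.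
have e : (fun w => `| `|y i w| *
    (1 + `|incr W (mesh T n i) (mesh T n i.+1) w| / Num.sqrt (T / n%:R)) `^ p| `^ r) =
  (fun w => `|y i w| `^ r * k (incr W (mesh T n i) (mesh T n i.+1) w)).
  apply/funext => w; rewrite normrM normr_id [`|_ `^ p|]ger0_norm ?powR_ge0//.
  by rewrite powRM ?powR_ge0// -powRrM.
apply: Lr_le_moment => //.
- by rewrite mulr_ge0// ltW.
- apply: measurable_funM.
    by apply: measurableT_comp => //; exact: (adapted_measurable hF m0 (ay i ni)).
  exact: (measurableT_comp (mk0 p) mI).
- by rewrite e.
rewrite e Em; apply: ler_pM => //.
- by apply: Ex_ge0 => w; exact: powR_ge0.
- by apply: Ex_ge0 => w; exact: powR_ge0.
Qed.

End WienerPowers.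

(** * From a bound on the noise to the worst-case error *)

Section NoiseBounds.
Context {R : realType}.
Implicit Types (rho r q L T s alpha beta : R) (p : R -> R -> R).

Definition noise_sum (Omega : Type) (W : R -> Omega -> R) T n
    (Y : nat -> Omega -> R) p (w : Omega) : R :=
  \sum_(i < n) Y i w * (p (mesh T n i.+1) (W (mesh T n i.+1) w)
                        - p (mesh T n i) (W (mesh T n i) w)).

(** The interface between the disturbance classes and the error bound: [C] depends on the moment
    bound [B] and on the class, and is chosen before the space, the mesh and the disturbance. The
    variable [D] supplies the measurability and the moments for the noise. *)
Definition noise_bound T r q (KW : set (R -> R -> R)) (g : nat -> R) : Prop :=
  forall B : R, 0 <= B -> exists2 C : R, 0 < C &
  forall d (Omega : measurableType d) (P : probability Omega R)
    (F : R -> set (set Omega)) (W : R -> Omega -> R) (n : nat)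
    (Y : nat -> Omega -> R) (p : R -> R -> R),
    usual_conditions P F -> wiener P F W -> (0 < n)%N ->
    (forall i, (i < n)%N -> adapted_at F (mesh T n i) (Y i)) ->
    (forall i, (i < n)%N -> Lone P (fun w => `|Y i w| `^ q) /\
       Ex P (fun w => `|Y i w| `^ q) <= B) ->
    KW p -> exists D : Omega -> R, Lr_le P r D (C * g n) /\
      forall w, `|noise_sum W T n Y p w| <= `|D w|.

Lemma ito_error_bound rho r q L T : 0 < rho -> 2 <= r -> 0 <= L -> 0 < T -> r <= q ->
  exists2 C : R, 0 < C &
  forall d (Omega : measurableType d) (P : probability Omega R)
    (F : R -> set (set Omega)) (W X : R -> Omega -> R) (n : nat),
    usual_conditions P F -> wiener P F W -> integrand_class T P F rho r q L X ->
    (0 < n)%N ->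
    Lr_le P r (fun w => ito_integral P F W T X w - maruyama W T X n w)
      (C * n%:R `^ (- rho)).
Proof.
move=> rho0 r2 L0 T0 rq; have r0 : 0 < r by lra.
have [K K0 HK] := martingale_transform_moment r2 T0.
pose C1 := 2 `^ r * (1 + 2 `^ r * (1 + 1)) * K.
have C10 : 0 < C1.
  rewrite /C1 mulr_gt0// mulr_gt0 ?powR_gt0// addr_gt0// mulr_gt0 ?powR_gt0//.
have L1 : 0 < L + 1 by lra.
exists (C1 `^ r^-1 * ((L + 1) * T `^ rho)).
  by rewrite !mulr_gt0 ?powR_gt0.
move=> d Omega P F W X n hF hW hX n0.
have [mI LI EI] := ito_integral_error hF hW T0 rho0 r2 rq L0 hX K0
  (fun n h b => HK d Omega P F W n h b hF hW) n0.
have [mR _] := maruyama_moment hF T0 r2 rq L0 hX (fun n h b => HK d Omega P F W n h b hF hW) n0.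
have e0 := mesh_error_gt0 rho T0 L0 n0.
have -> : C1 `^ r^-1 * ((L + 1) * T `^ rho) * n%:R `^ (- rho) =
    (C1 * mesh_error T rho L n `^ r) `^ r^-1.
  rewrite powRM ?powR_ge0 ?(ltW C10)// -powRrM mulfV ?gt_eqF// powRr1 ?(ltW e0)//.
  by rewrite /mesh_error powRM ?invr_ge0 ?(ltW T0)// powR_invl// !mulrA.
apply: Lr_le_moment => //; first by rewrite mulr_ge0 ?powR_ge0// ltW.
exact: measurable_funB.
Qed.

(** Linear growth and [delta <= 1] put both variables below [2 (1 + |X t|)]. The exponent [v] is [r]
    for the martingale transform and [q] for the noise of [W]. *)
Lemma noisy_integrand_moment rho r q L T p delta : 2 <= r -> r <= q -> 0 <= L -> 0 < T ->
  K1 T p -> 0 <= delta <= 1 ->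
  forall d (Omega : measurableType d) (P : probability Omega R)
    (F : R -> set (set Omega)) (X : R -> Omega -> R) (t v : R),
  usual_conditions P F -> integrand_class T P F rho r q L X -> 0 <= t <= T ->
  0 <= v -> v <= q ->
  [/\ adapted_at F t (fun w => p t (X t w)),
    adapted_at F t (fun w => X t w + delta * p t (X t w)),
    Lone P (fun w => `|p t (X t w)| `^ v) /\
      Ex P (fun w => `|p t (X t w)| `^ v) <= 2 `^ v * (2 `^ v * (2 + L `^ q)) &
    Lone P (fun w => `|X t w + delta * p t (X t w)| `^ v) /\
      Ex P (fun w => `|X t w + delta * p t (X t w)| `^ v) <=
        2 `^ v * (2 `^ v * (2 + L `^ q))].
Proof.
move=> r2 rq L0 T0 [mp bp] /andP[d0 d1] d Omega P F X t v hF hX tT v0 vq.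
have /andP[t0 _] := tT.
have aX := integrand_adapted hX tT.
have [LX EX] := integrand_moment hF r2 rq L0 hX v0 vq tT.
have mpt : measurable_fun setT (p t).
  have := measurable_comp _ _ mp (pair1_measurable t).
  apply; first by apply: measurableX => //; exact: measurable_itv.
  by move=> _ [y _ <-]; split=> //=; rewrite in_itv.
have apX : adapted_at F t (fun w => p t (X t w)) by exact: measurableT_comp mpt aX.
have aY : adapted_at F t (fun w => X t w + delta * p t (X t w)).
  by apply: measurable_funD => //; exact: measurable_funM.
pose B w := 2 `^ v * (2 `^ v * (1 + `|X t w| `^ v)).
have LB : Lone P B.
  by do 2 apply: LoneZ; apply: LoneD => //; exact: Lone_cst.
have EB : Ex P B <= 2 `^ v * (2 `^ v * (2 + L `^ q)).
  have l1 := LoneD (Lone_cst P 1) LX; have l2 := LoneZ (2 `^ v) l1.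
  rewrite /B (ExZ _ l2) (ExZ _ l1) (ExD (Lone_cst P 1) LX) Ex_cst.
  by rewrite !ler_wpM2l ?powR_ge0//; lra.
have le (f : Omega -> R) w : `|f w| <= 2 * (1 + `|X t w|) -> `|f w| `^ v <= B w.
  move=> h; apply: (le_trans (ler_powR2 v0 (normr_ge0 _) h)).
  rewrite powRM ?addr_ge0// /B ler_wpM2l ?powR_ge0//.
  by apply: (le_trans (powR_add_le v0 ler01 (normr_ge0 _))); rewrite powR1.
have main (f : Omega -> R) : adapted_at F t f ->
    (forall w, `|f w| <= 2 * (1 + `|X t w|)) ->
    Lone P (fun w => `|f w| `^ v) /\
    Ex P (fun w => `|f w| `^ v) <= 2 `^ v * (2 `^ v * (2 + L `^ q)).
  move=> af hf; have mf := adapted_measurable hF t0 af.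
  have Lf : Lone P (fun w => `|f w| `^ v).
    apply: Lone_le LB _ => [|w]; first exact: measurable_norm_powR.
    by rewrite ger0_norm ?powR_ge0//; exact: le.
  by split=> //; apply: le_trans EB; apply: Ex_le => // w; exact: le.
split=> //; apply: main => // w.
  by have := bp t (X t w) tT; have := normr_ge0 (X t w); lra.
apply: (le_trans (ler_normD _ _)); rewrite normrM (ger0_norm d0).
have h1 := bp t (X t w) tT; have h2 := ler_piMl (normr_ge0 (p t (X t w))) d1.
have := normr_ge0 (X t w); lra.
Qed.

Lemma noise_bound_bigO rho r q L T KW g : 0 < rho -> 2 <= r -> 0 <= L -> 0 < T ->
  r <= q -> noise_bound T r q KW g ->
  uniform_bigO (RM_error T rho r q L KW)
    (fun n delta1 delta2 => n%:R `^ (- rho) + delta1 + delta2 * g n).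
Proof.
move=> rho0 r2 L0 T0 rq hKW.
have r0 : 0 < r by lra. have r1 : 1 <= r by lra.
have q0 : 0 <= q by lra.
have [C0 C00 HC0] := ito_error_bound rho0 r2 L0 T0 rq.
have [K K0 HK] := martingale_transform_moment r2 T0.
pose B v := 2 `^ v * (2 `^ v * (2 + L `^ q)).
have B0 v : 0 < B v by rewrite !mulr_gt0 ?powR_gt0// ltr_wpDr ?powR_ge0.
have [C2 C20 HC2] := hKW (B q) (ltW (B0 q)).
pose C1 := (K * B r) `^ r^-1; have C10 : 0 < C1 by rewrite powR_gt0// mulr_gt0.
(* The bound holds for every [n >= 1]; the threshold 1 for the noise levels is the one that
   [noisy_integrand_moment] requires. *)
exists (C0 + C1 + C2), 1%N, 1; split; first by split=> //; rewrite !addr_gt0.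
move=> d Omega P F W hF hW n d1 d2 n0 hd1 hd2.
have /andP[d10 d11] := hd1; have /andP[d20 d21] := hd2.
apply: ge_ereal_sup => _ [X hX <-].
apply: ge_ereal_sup => _ [[Z1 Z2] [/= [p hp hZ1] [pW hpW hZ2]] <-].
have LI := HC0 d Omega P F W X n hF hW hX n0.
have tT i : (i <= n)%N -> 0 <= mesh T n i <= T by exact: mesh_itv.
pose Y i w := X (mesh T n i) w + d1 * p (mesh T n i) (X (mesh T n i) w).
have Yq i (ni : (i < n)%N) := noisy_integrand_moment r2 rq L0 T0 hp hd1 hF hX
  (tT i (ltnW ni)) q0 (lexx q).
have Yr i (ni : (i < n)%N) := noisy_integrand_moment r2 rq L0 T0 hp hd1 hF hX
  (tT i (ltnW ni)) (ltW r0) rq.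
have [D [LD hD]] := HC2 d Omega P F W n Y pW hF hW n0
  (fun i ni => let: And4 _ a _ _ := Yq i ni in a)
  (fun i ni => let: And4 _ _ _ a := Yq i ni in a) hpW.
pose h i w := p (mesh T n i) (X (mesh T n i) w).
have [mM LM EM] := HK d Omega P F W n h (B r) hF hW n0
  (fun i ni => let: And4 a _ _ _ := Yr i ni in a)
  (fun i ni => let: And4 _ _ a _ := Yr i ni in a).
have LrM : Lr_le P r (transform W T n h) C1.
  by apply: Lr_le_moment => //; rewrite mulr_ge0 ?ltW.
(* The product of the two noises is absorbed in the last term, because [Y] is the already disturbed
   integrand. *)
have eA w : riemann_maruyama T n Z1 Z2 w =
    maruyama W T X n w + d1 * transform W T n h w + d2 * noise_sum W T n Y pW w.
  rewrite /riemann_maruyama /maruyama /transform /noise_sum !mulr_sumr -!big_split/=.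
  apply: eq_bigr => i _; have ni := ltn_ord i.
  rewrite -!/(mesh T n _) hZ1 ?(tT i (ltnW ni))// !hZ2 ?(tT i (ltnW ni)) ?(tT i.+1 ni)//.
  by rewrite /Y /h /incr; ring.
have bound := Lr_leD r1 (Lr_leD r1 (Lr_le_norm LI)
  (Lr_leZ r0 d10 (Lr_le_norm LrM))) (Lr_leZ r0 d20 (Lr_le_norm LD)).
have ng0 : 0 <= g n by case: LD => + _ _ _; rewrite pmulr_rge0.
apply: (le_trans (Lr_le_Lnorm r0 bound _)).
  move=> w /=; rewrite eA; apply: le_trans (ler_norm _).
  set I := ito_integral _ _ _ _ _ w; set A := maruyama _ _ _ _ _; set M := transform _ _ _ _ _.
  set N := noise_sum _ _ _ _ _ _.
  have -> : I - (A + d1 * M + d2 * N) = (I - A) - d1 * M - d2 * N by ring.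
  apply: (le_trans (ler_normB _ _)); apply: lerD.
    by apply: (le_trans (ler_normB _ _)); rewrite normrM (ger0_norm d10).
  by rewrite normrM (ger0_norm d20) ler_wpM2l// hD.
rewrite lee_fin; set x := n%:R `^ _; have x0 : 0 <= x by exact: powR_ge0.
have dg : 0 <= d2 * g n by exact: mulr_ge0.
have := mulr_ge0 (ltW C00) dg; have := mulr_ge0 (ltW C10) dg.
have := mulr_ge0 (ltW C00) d10; have := mulr_ge0 (ltW C20) d10.
have := mulr_ge0 (ltW C10) x0; have := mulr_ge0 (ltW C20) x0.
rewrite (mulrCA d2); lra.
Qed.

End NoiseBounds.

(** * Noise bounds for the three classes of disturbances *)

Section NoiseClasses.
Context {R : realType}.
Implicit Types (r q T s alpha beta : R).

Lemma noise_sum_le (Omega : Type) (W : R -> Omega -> R) T n (Y : nat -> Omega -> R)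
    (p : R -> R -> R) (V : nat -> Omega -> R) (c : R) w : 0 <= c ->
  (forall i, (i < n)%N -> 0 <= V i w) ->
  (forall i, (i < n)%N -> `|p (mesh T n i.+1) (W (mesh T n i.+1) w)
     - p (mesh T n i) (W (mesh T n i) w)| <= c * V i w) ->
  `|noise_sum W T n Y p w| <= `|c * \sum_(i < n) `|Y i w| * V i w|.
Proof.
move=> c0 V0 h; apply: (le_trans (ler_norm_sum _ _ _)).
rewrite [leRHS]ger0_norm; last first.
  by rewrite mulr_ge0// sumr_ge0// => i _; rewrite mulr_ge0// V0.
rewrite mulr_sumr; apply: ler_sum => i _.
by rewrite normrM mulrCA ler_wpM2l// h.
Qed.

(** With [u] the increment of [W] normalised by [sqrt (T / n)], a disturbance increment is at most a
    constant times [n^(-m) (1 + u)], where [m = min (alpha, beta / 2)]. No power of [W(t_i)]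
    appears, so the [r]-th moment of [Y] is enough. *)
Lemma K3_noise_bound r q T alpha beta : 2 <= r -> r <= q -> 0 < T ->
  0 < alpha <= 1 -> 0 < beta <= 1 ->
  noise_bound T r q (K3 T alpha beta)
    (fun n => n%:R `^ (1 - Num.min alpha (beta / 2))).
Proof.
move=> r2 rq T0 /andP[a0 a1] /andP[b0 b1] B B0.
have r1 : 1 <= r by lra. have r0 : 0 < r by lra.
have [G G0 HG] := dominator_moment (1) T0 r1.
pose m := Num.min alpha (beta / 2).
pose c := T `^ alpha + T `^ (beta / 2); have c0 : 0 < c by rewrite addr_gt0// powR_gt0.
have BG0 : 0 < (1 + B) * G by rewrite mulr_gt0// ltr_wpDr.
exists (c * ((1 + B) * G) `^ r^-1); first by rewrite mulr_gt0// powR_gt0.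
move=> d Omega P F W n Y p hF hW n0 aY LY hp.
have nR0 : 0 < n%:R :> R by rewrite ltr0n.
have n1 : 1 <= n%:R :> R by rewrite ler1n.
have Yr i : (i < n)%N -> Lone P (fun w => `|Y i w| `^ r) /\
    Ex P (fun w => `|Y i w| `^ r) <= 1 + B.
  move=> ni; have [L E] := LY i ni.
  have mY := adapted_measurable hF (mesh_ge0 n i (ltW T0)) (aY i ni).
  have Lr : Lone P (fun w => `|Y i w| `^ r) := Lone_powR_le mY (ltW r0) rq L.
  have L1 : Lone P (fun w => 1 + `|Y i w| `^ q) := LoneD (Lone_cst P 1) L.
  split=> //; apply: (@le_trans _ _ (Ex P (fun w => 1 + `|Y i w| `^ q))).
    by apply: Ex_le => // w; exact: (powR_le_1D (normr_ge0 _) (ltW r0) rq).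
  by rewrite (ExD (Lone_cst P 1) L) Ex_cst lerD2l.
have LD := HG d Omega P F W n Y (1 + B) hF hW n0 aY Yr.
have cn0 : 0 <= c * n%:R `^ (- m) by rewrite mulr_ge0 ?powR_ge0 ?(ltW c0).
have := Lr_leZ r0 cn0 LD => LcD.
eexists; split; first apply: (Lr_le_weaken r0 LcD).
  rewrite powRB; last by rewrite (gt_eqF nR0) implybT.
  by rewrite powRr1 ?(ltW nR0)// powRN le_eqVlt; apply/orP; left; apply/eqP; rewrite -/m; ring.
move=> w; apply: (@noise_sum_le _ _ _ _ _ _ (fun i w =>
  (1 + `|incr W (mesh T n i) (mesh T n i.+1) w| / Num.sqrt (T / n%:R)) `^ 1)) => //.
move=> i ni; have i0 := mesh_itv T0 n0 (ltnW ni); have i1 := mesh_itv T0 n0 ni.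
apply: (le_trans (hp _ _ _ _ i1 i0)).
rewrite meshS -/(incr W (mesh T n i) (mesh T n i.+1) w).
set z := incr _ _ _ _; have D0 : 0 < T / n%:R by rewrite divr_gt0.
set u := `|z| / Num.sqrt (T / n%:R).
have u0 : 0 <= u by rewrite divr_ge0 ?sqrtr_ge0.
have ex (e : R) : m <= e -> (T / n%:R) `^ e <= T `^ e * n%:R `^ (- m).
  move=> me; rewrite powRM ?invr_ge0 ?(ltW T0)// powR_invl// ler_wpM2l ?powR_ge0//.
  by rewrite ler_powR// lerN2.
have h1 : `|T / n%:R| `^ alpha <= T `^ alpha * n%:R `^ (- m).
  by rewrite gtr0_norm// ex// ge_min lexx.
have h2 : `|z| `^ beta <= T `^ (beta / 2) * n%:R `^ (- m) * (1 + u).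
  rewrite (sqrt_mesh z D0) -/u powRM ?sqrtr_ge0//.
  apply: ler_pM; rewrite ?powR_ge0//.
    rewrite -powR12_sqrt ?(ltW D0)// -powRrM [2^-1 * _]mulrC ex//.
    by rewrite ge_min lexx orbT.
  by rewrite -[u in leRHS]powRr1// powR_le_1D// ltW.
rewrite powRr1 ?addr_ge0// /c.
have := mulr_ge0 (mulr_ge0 (powR_ge0 T alpha) (powR_ge0 n%:R (- m))) u0.
lra.
Qed.

(** Separates the growth factor into a part known at [t_i] and a function of the normalised
    increment, independent of it. *)
Lemma growth_le (s T D x z : R) : 0 <= s -> 0 < D -> D <= T ->
  (1 + (`|x| + `|z|)) `^ s <=
  (1 + Num.sqrt T) `^ s * ((1 + `|x|) `^ s * (1 + `|z| / Num.sqrt D) `^ s).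
Proof.
move=> s0 D0 DT; set u := `|z| / Num.sqrt D.
have u0 : 0 <= u by rewrite divr_ge0 ?sqrtr_ge0.
have sT := sqrtr_ge0 T; have x0 := normr_ge0 x.
rewrite -!powRM ?mulr_ge0 ?addr_ge0//; apply: ler_powR2 => //.
have zu : `|z| <= Num.sqrt T * u.
  by rewrite (sqrt_mesh z D0) ler_wpM2r// ler_wsqrtr.
have := mulr_ge0 x0 u0; have := mulr_ge0 sT u0; have := mulr_ge0 sT x0.
have := mulr_ge0 sT (mulr_ge0 x0 u0); lra.
Qed.

(** Young's inequality with exponent [q / r > 1] splits the product into [|Y|^q] and a power of
    [1 + |W t|]; [k] is [s r] times the conjugate exponent. This is where [q > r] is used. *)
Lemma weighted_moment r q T s B : 2 <= r -> r < q -> 0 < T -> 0 <= s -> 0 <= B ->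
  exists2 b : R, 0 < b &
  forall d (Omega : measurableType d) (P : probability Omega R)
    (F : R -> set (set Omega)) (W : R -> Omega -> R) (t : R) (Y : Omega -> R),
    usual_conditions P F -> wiener P F W -> 0 <= t <= T -> adapted_at F t Y ->
    Lone P (fun w => `|Y w| `^ q) -> Ex P (fun w => `|Y w| `^ q) <= B ->
    adapted_at F t (fun w => Y w * (1 + `|W t w|) `^ s) /\
    (Lone P (fun w => `|Y w * (1 + `|W t w|) `^ s| `^ r) /\
    Ex P (fun w => `|Y w * (1 + `|W t w|) `^ s| `^ r) <= b).
Proof.
move=> r2 rq T0 s0 B0; have r0 : 0 < r by lra.
have v1 : 1 < q / r by rewrite ltr_pdivlMr// mul1r.
pose k := s * r * (q / r / (q / r - 1)).
have k0 : 0 <= k.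
  apply: mulr_ge0; first exact: mulr_ge0 s0 (ltW r0).
  by move: v1; set x := q / r => v1; apply: divr_ge0; lra.
have [G G0 HG] := wiener_moment T0 k0.
exists (B + G); first by rewrite ltr_wpDl.
move=> d Omega P F W t Y hF hW tT aY LY EY; have /andP[t0 _] := tT.
have [LW EW] := HG d Omega P F W t hF hW tT.
have aV : adapted_at F t (fun w => Y w * (1 + `|W t w|) `^ s).
  apply: measurable_funM => //; apply: (measurableT_comp (measurable_powR s)).
  apply: measurable_funD => //; apply: measurableT_comp => //.
  exact: (wiener_adapted hW t0).
split=> //.
have V0 w : 0 <= 1 + `|W t w| by rewrite addr_ge0.
have le w : `|Y w * (1 + `|W t w|) `^ s| `^ r <= `|Y w| `^ q + (1 + `|W t w|) `^ k.
  rewrite normrM powRM// (ger0_norm (powR_ge0 _ _)) -powRrM.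
  apply: (le_trans (mul_le_powRD (powR_ge0 _ _) (powR_ge0 _ _) v1)).
  by rewrite -!powRrM -/k [r * _]mulrC divfK// gt_eqF.
have LYW := LoneD LY LW.
have L : Lone P (fun w => `|Y w * (1 + `|W t w|) `^ s| `^ r).
  apply: Lone_le LYW _ => [|w]; last by rewrite ger0_norm ?powR_ge0.
  by apply: measurable_norm_powR; exact: (adapted_measurable hF t0 aV).
split=> //; apply: (le_trans (Ex_le L LYW le)).
by rewrite (ExD LY LW) lerD.
Qed.

(** One factor [1 + u] from the size of the increment joins the [s] from the growth, hence the
    exponent [s + 1]. The order is [n * sqrt (T / n)], that is [n^(1/2)]. *)
Lemma K2bar_noise_bound r q T s : 2 <= r -> r < q -> 0 < T -> 0 <= s ->
  noise_bound T r q (K2bar T s) (fun n => 1 + n%:R `^ (1 / 2)).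
Proof.
move=> r2 rq T0 s0 B B0.
have r1 : 1 <= r by lra. have r0 : 0 < r by lra.
have [G G0 HG] := dominator_moment (s + 1) T0 r1.
have [b b0 Hb] := weighted_moment r2 rq T0 s0 B0.
have sT : 0 < Num.sqrt T by rewrite sqrtr_gt0.
pose c := 2 * (1 + Num.sqrt T) `^ s * (1 + Num.sqrt T).
have sT1 : 0 < 1 + Num.sqrt T by rewrite addr_gt0.
have c0 : 0 < c by rewrite mulr_gt0// mulr_gt0// powR_gt0.
have cb0 : 0 < c * Num.sqrt T * (b * G) `^ r^-1.
  by rewrite !mulr_gt0// powR_gt0// mulr_gt0.
exists (c * Num.sqrt T * (b * G) `^ r^-1) => //.
move=> d Omega P F W n Y p hF hW n0 aY LY hp.
have nR0 : 0 < n%:R :> R by rewrite ltr0n.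
have n1 : 1 <= n%:R :> R by rewrite ler1n.
have D0 : 0 < T / n%:R by rewrite divr_gt0.
have DT : T / n%:R <= T by rewrite ler_pdivrMr// ler_peMr// ltW.
pose y i w := Y i w * (1 + `|W (mesh T n i) w|) `^ s.
have hy i (ni : (i < n)%N) := Hb d Omega P F W (mesh T n i) (Y i) hF hW
  (mesh_itv T0 n0 (ltnW ni)) (aY i ni) (LY i ni).1 (LY i ni).2.
have LD := HG d Omega P F W n y b hF hW n0
  (fun i ni => (hy i ni).1) (fun i ni => (hy i ni).2).
have cD0 : 0 <= c * Num.sqrt (T / n%:R) by rewrite mulr_ge0 ?sqrtr_ge0 ?(ltW c0).
have LcD := Lr_leZ r0 cD0 LD.
eexists; split; first apply: (Lr_le_weaken r0 LcD).
  have e : Num.sqrt (T / n%:R) * n%:R = Num.sqrt T * n%:R `^ (1 / 2).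
    rewrite sqrtrM ?(ltW T0)// div1r powR12_sqrt ?ler0n// -mulrA; congr (_ * _).
    by rewrite sqrtrV// -[X in _ * X](sqr_sqrtr (ler0n R n)) expr2 mulKf// gt_eqF// sqrtr_gt0.
  rewrite [leLHS](_ : _ = c * (Num.sqrt (T / n%:R) * n%:R) * (b * G) `^ r^-1); last by ring.
  rewrite e [leLHS](_ : _ = c * Num.sqrt T * (b * G) `^ r^-1 * n%:R `^ (1 / 2)); last by ring.
  by rewrite ler_wpM2l ?(ltW cb0)// lerDr.
move=> w /=; under eq_bigr do rewrite /y normrM (ger0_norm (powR_ge0 _ _)) -mulrA.
apply: (@noise_sum_le _ _ _ _ _ _ (fun i w => (1 + `|W (mesh T n i) w|) `^ s *
  (1 + `|incr W (mesh T n i) (mesh T n i.+1) w| / Num.sqrt (T / n%:R)) `^ (s + 1))) => //.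
move=> i ni; have i0 := mesh_ge0 n i (ltW T0).
apply: (le_trans (K2bar_increment s0 hp _ _ i0 (ltW (meshS_lt i T0 n0))
  (mesh_leT (ltW T0) n0 ni))).
rewrite meshS -/(incr W (mesh T n i) (mesh T n i.+1) w).
set z := incr _ _ _ _; set x := W _ w.
have gr := growth_le x z s0 D0 DT; set u := `|z| / Num.sqrt (T / n%:R) in gr *.
have u0 : 0 <= u by rewrite divr_ge0 ?sqrtr_ge0.
have h : T / n%:R + `|z| <= (1 + Num.sqrt T) * Num.sqrt (T / n%:R) * (1 + u).
  rewrite (sqrt_mesh z D0) -/u -[X in X + _](sqr_sqrtr (ltW D0)).
  have sD : Num.sqrt (T / n%:R) <= Num.sqrt T by rewrite ler_wsqrtr.
  have sD0 := sqrtr_ge0 (T / n%:R).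
  have := ler_wpM2l sD0 sD; have := mulr_ge0 sD0 u0.
  have := mulr_ge0 (ltW sT) (mulr_ge0 sD0 u0); rewrite -expr2; lra.
have h0 : 0 <= T / n%:R + `|z| by rewrite addr_ge0// ltW.
rewrite -mulrA; apply: (@le_trans _ _ (2 * ((1 + Num.sqrt T) `^ s *
  ((1 + `|x|) `^ s * (1 + u) `^ s) * ((1 + Num.sqrt T) * Num.sqrt (T / n%:R) * (1 + u))))).
  by rewrite ler_wpM2l//; apply: ler_pM => //; exact: powR_ge0.
rewrite le_eqVlt; apply/orP; left; apply/eqP.
have u1 : 0 < 1 + u by rewrite ltr_wpDr.
rewrite powRD ?(gt_eqF u1) ?implybT// powRr1 ?(ltW u1)// /c; ring.
Qed.

(** The remainder contributes [(T / n) (1 + u)^2], hence the exponent [s + 2] and a total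
    [n * (T / n) = T]. In [C1] the factor [2^r] comes from the bound on the space derivative by
    [2 (1 + |W|)^s]. *)
Lemma K2_noise_bound r q T s : 2 <= r -> r < q -> 0 < T -> 0 <= s ->
  noise_bound T r q (K2 T s) (fun=> 1).
Proof.
move=> r2 rq T0 s0 B B0.
have r1 : 1 <= r by lra. have r0 : 0 < r by lra.
have [G G0 HG] := dominator_moment (s + 2) T0 r1.
have [b b0 Hb] := weighted_moment r2 rq T0 s0 B0.
have [K K0 HK] := martingale_transform_moment r2 T0.
have sT : 0 < Num.sqrt T by rewrite sqrtr_gt0.
have sT1 : 0 < 1 + Num.sqrt T by rewrite addr_gt0.
pose c := 2 * (1 + Num.sqrt T) `^ s.
have c0 : 0 < c by rewrite mulr_gt0// powR_gt0.
pose C1 := (K * (2 `^ r * b)) `^ r^-1.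
have C10 : 0 < C1 by rewrite powR_gt0// !mulr_gt0// powR_gt0.
have cb0 : 0 < c * T * (b * G) `^ r^-1.
  by rewrite !mulr_gt0// powR_gt0// mulr_gt0.
exists (C1 + c * T * (b * G) `^ r^-1); first by rewrite addr_gt0.
move=> d Omega P F W n Y p hF hW n0 aY LY hp.
have nR0 : 0 < n%:R :> R by rewrite ltr0n.
have n1 : 1 <= n%:R :> R by rewrite ler1n.
have D0 : 0 < T / n%:R by rewrite divr_gt0.
have DT : T / n%:R <= T by rewrite ler_pdivrMr// ler_peMr// ltW.
have [dyp [cdyp bdyp incp]] := K2_increment s0 hp.
pose y i w := Y i w * (1 + `|W (mesh T n i) w|) `^ s.
have hy i (ni : (i < n)%N) := Hb d Omega P F W (mesh T n i) (Y i) hF hW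
  (mesh_itv T0 n0 (ltnW ni)) (aY i ni) (LY i ni).1 (LY i ni).2.
have LD := HG d Omega P F W n y b hF hW n0
  (fun i ni => (hy i ni).1) (fun i ni => (hy i ni).2).
have cD0 : 0 <= c * (T / n%:R) by rewrite mulr_ge0 ?(ltW c0) ?(ltW D0).
have LcD := Lr_leZ r0 cD0 LD.
pose h i w := Y i w * dyp (mesh T n i) (W (mesh T n i) w).
have ah i : (i < n)%N -> adapted_at F (mesh T n i) (h i).
  move=> ni; apply: measurable_funM; first exact: aY.
  apply: measurableT_comp; last exact: (wiener_adapted hW (mesh_ge0 n i (ltW T0))).
  by apply: continuous_measurable_fun; exact: cdyp (mesh_itv T0 n0 (ltnW ni)).
have Lh i : (i < n)%N -> Lone P (fun w => `|h i w| `^ r) /\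
    Ex P (fun w => `|h i w| `^ r) <= 2 `^ r * b.
  move=> ni; have [_ [L E]] := hy i ni.
  have le w : `|h i w| `^ r <=
      2 `^ r * `|Y i w * (1 + `|W (mesh T n i) w|) `^ s| `^ r.
    rewrite -powRM// ler_powR2 ?(ltW r0)// !normrM (ger0_norm (powR_ge0 _ _)).
    by rewrite mulrCA ler_wpM2l// bdyp// mesh_itv// ltnW.
  have Lhi : Lone P (fun w => `|h i w| `^ r).
    apply: Lone_le (LoneZ (2 `^ r) L) _ => [|w]; last by rewrite ger0_norm ?powR_ge0.
    apply: measurable_norm_powR.
    exact: (adapted_measurable hF (mesh_ge0 n i (ltW T0)) (ah i ni)).
  split=> //; apply: (le_trans (Ex_le Lhi (LoneZ _ L) le)).
  by rewrite (ExZ _ L) ler_wpM2l ?powR_ge0.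
have [mM LM EM] := HK d Omega P F W n h (2 `^ r * b) hF hW n0 ah Lh.
have LrM : Lr_le P r (transform W T n h) C1.
  by apply: Lr_le_moment => //; rewrite !mulr_ge0 ?powR_ge0// ltW.
have LrD := Lr_leD r1 (Lr_le_norm LrM) (Lr_le_norm LcD).
eexists; split; first apply: (Lr_le_weaken r0 LrD).
  rewrite mulr1 lerD2l le_eqVlt; apply/orP; left; apply/eqP.
  by field; rewrite gt_eqF.
move=> w; apply: le_trans (ler_norm _).
pose rem i w := p (mesh T n i.+1) (W (mesh T n i.+1) w) - p (mesh T n i) (W (mesh T n i) w)
  - dyp (mesh T n i) (W (mesh T n i) w) * incr W (mesh T n i) (mesh T n i.+1) w.
have -> : noise_sum W T n Y p w =
    transform W T n h w + \sum_(i < n) Y i w * rem i w.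
  rewrite /noise_sum /transform -big_split/=; apply: eq_bigr => i _.
  by rewrite /h /rem; ring.
apply: (le_trans (ler_normD _ _)); rewrite lerD2l.
apply: (le_trans (ler_norm_sum _ _ _)); rewrite [leRHS]ger0_norm; last first.
  by rewrite mulr_ge0// sumr_ge0// => i _; rewrite mulr_ge0// powR_ge0.
rewrite mulr_sumr; apply: ler_sum => i _; have ni := ltn_ord i.
rewrite /y !normrM (ger0_norm (powR_ge0 _ _)) -[X in _ <= _ * X]mulrA [leRHS]mulrCA.
rewrite ler_wpM2l//.
apply: (le_trans (incp _ _ _ _ (mesh_ge0 n i (ltW T0)) (ltW (meshS_lt i T0 n0))
  (mesh_leT (ltW T0) n0 ni))).
rewrite meshS -/(incr W (mesh T n i) (mesh T n i.+1) w).
set z := incr _ _ _ _; set x := W _ w.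
have gr := growth_le x z s0 D0 DT; set u := `|z| / Num.sqrt (T / n%:R) in gr *.
have u0 : 0 <= u by rewrite divr_ge0 ?sqrtr_ge0.
have hz : T / n%:R + `|z| ^+ 2 <= T / n%:R * (1 + u) ^+ 2.
  rewrite (sqrt_mesh z D0) -/u exprMn sqr_sqrtr ?(ltW D0)//.
  have := mulr_ge0 (ltW D0) u0; rewrite sqrrD expr1n; lra.
have h0 : 0 <= T / n%:R + `|z| ^+ 2 by rewrite addr_ge0 ?sqr_ge0 ?(ltW D0).
rewrite -mulrA; apply: (@le_trans _ _ (2 * ((1 + Num.sqrt T) `^ s *
  ((1 + `|x|) `^ s * (1 + u) `^ s) * (T / n%:R * (1 + u) ^+ 2)))).
  by rewrite ler_wpM2l//; apply: ler_pM => //; exact: powR_ge0.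
rewrite le_eqVlt; apply/orP; left; apply/eqP.
have u1 : 0 < 1 + u by rewrite ltr_wpDr.
rewrite powRD ?(gt_eqF u1) ?implybT// (powR_mulrn 2 (ltW u1)) /c; ring.
Qed.

End NoiseClasses.

(** * The three error bounds *)

Theorem corollary1 (R : realType) (rho r L T : R)
    (hrho : 0 < rho <= 1) (hr : 2 <= r) (hL : 0 <= L) (hT : 0 < T) :
  [/\ forall s q : R, 0 <= s -> r < q ->
        uniform_bigO (RM_error T rho r q L (K2 T s))
          (fun n delta1 delta2 => n%:R `^ (- rho) + delta1 + delta2),
      forall s q : R, 0 <= s -> r < q ->
        uniform_bigO (RM_error T rho r q L (K2bar T s))
          (fun n delta1 delta2 =>
             n%:R `^ (- rho) + delta1 + delta2 * (1 + n%:R `^ (1 / 2))) &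
      forall alpha beta q : R, 0 < alpha <= 1 -> 0 < beta <= 1 -> r <= q ->
        uniform_bigO (RM_error T rho r q L (K3 T alpha beta))
          (fun n delta1 delta2 =>
             n%:R `^ (- rho) + delta1 +
             delta2 * n%:R `^ (1 - Num.min alpha (beta / 2)))].

Proof.
have /andP[rho0 _] := hrho; split.
- move=> s q s0 rq.
  have := noise_bound_bigO rho0 hr hL hT (ltW rq) (K2_noise_bound hr rq hT s0).
  by under [X in uniform_bigO _ X]eq_fun do under eq_fun do under eq_fun do rewrite mulr1.
- move=> s q s0 rq.
  exact: noise_bound_bigO rho0 hr hL hT (ltW rq) (K2bar_noise_bound hr rq hT s0).
- move=> alpha beta q ha hb rq.
  exact: noise_bound_bigO rho0 hr hL hT rq (K3_noise_bound hr rq hT ha hb).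
Qed.
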